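(* Let $\mathbb{k}$ be an algebraically closed field, let $V$ be a finite dimensional $\mathbb{k}$-vector space, and let $A$ and $B$ be associative $\mathbb{k}$-algebras of the same dimension $\dim_{\mathbb{k}}V$, regarded as points of the variety $\mathsf{Ass}_{\mathbb{k}}(V)$ of associative algebra structures on $V$. The algebra $B$ is a degeneration of $A$ (that is, $\mathcal{O}_B\subseteq\overline{\mathcal{O}_A}$) if and only if there exists a Gerstenhaber formal deformation $\mathcal{X}$ of $B$ such that $\mathcal{X}\otimes_{\mathbb{k}[[t]]}\mathbb{k}((t))$ is isomorphic to $A\otimes_{\mathbb{k}}\mathbb{k}((t))$ as algebras over $\mathbb{k}((t))$.
   Context: $\mathsf{Ass}_{\mathbb{k}}(V)$ is the set of $\varphi\in\operatorname{Hom}_{\mathbb{k}}(V\otimes V,V)$ such that $\varphi\circ(\varphi\otimes\mathrm{id})=\varphi\circ(\mathrm{id}\otimes\varphi)$ as maps $V\otimes V\otimes V\to V$; it is an affine variety. Algebras are not required to have a unit. The group $\operatorname{GL}(V)$ acts on it by $g\cdot\varphi=g\circ\varphi\circ(g^{-1}\otimes g^{-1})$, and the orbits correspond bijectively to isomorphism classes of associative algebras of dimension $\dim_{\mathbb{k}}V$. For such an algebra $A$, $\mathcal{O}_A$ is its orbit and $\overline{\mathcal{O}_A}$ the Zariski closure of the orbit in $\mathsf{Ass}_{\mathbb{k}}(V)$. $B$ is called a degeneration of $A$ if $\mathcal{O}_B\subseteq\overline{\mathcal{O}_A}$. $\mathbb{k}[[t]]$ is the algebra of formal power series and $\mathbb{k}((t))$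 its fraction field. A (Gerstenhaber) formal deformation of an associative $\mathbb{k}$-algebra $B$ is a pair $(\mathcal{X},\Phi)$ where $\mathcal{X}$ is a ($t$-adically) complete and torsion-free associative $\mathbb{k}[[t]]$-algebra and $\Phi:\mathcal{X}\otimes_{\mathbb{k}[[t]]}\mathbb{k}\to B$ is an isomorphism of $\mathbb{k}$-algebras ($\mathbb{k}$ being a $\mathbb{k}[[t]]$-algebra via $t\mapsto 0$). Equivalently, if $V$ is the underlying space of $B$, it is an associative $\mathbb{k}[[t]]$-algebra structure on $V[[t]]$ (formal series with coefficients in $V$) for which there are maps $F_i\in\operatorname{Hom}_{\mathbb{k}}(V\otimes_{\mathbb{k}}V,V)$, $i\ge1$, with $v\cdot_{\mathcal{X}}w=v\cdot_B w+F_1(v,w)t+F_2(v,w)t^2+\cdots$ for all $v,w\in V$. *)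

(* Defs.v *)
From HB Require Import structures.
From mathcomp Require Import all_boot all_order all_algebra generic_quotient.
From mathcomp Require Import boolp classical_sets.
From mathcomp Require Import mpoly.

Set Implicit Arguments.
Unset Strict Implicit.
Unset Printing Implicit Defensive.

Import GRing.Theory.
Local Open Scope quotient_scope.
Local Open Scope ring_scope.

(* A record rather than a bare function type, which would inherit pointwise
   operations. *)
Record fps (k : fieldType) := Fps { fpscoef : nat -> k }.

HB.instance Definition _ (k : fieldType) := gen_eqMixin (fps k).
HB.instance Definition _ (k : fieldType) := gen_choiceMixin (fps k).

Section FpsRing.
Variable k : fieldType.
Implicit Types f g h : fps k.

Lemma fpsP f g : fpscoef f =1 fpscoef g <-> f = g.
Proof. by split=> [|-> //]; case: f g => f [g] /= /funext ->. Qed.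

Definition fpsC (c : k) : fps k := Fps (fun n => if n == 0%N then c else 0).
Definition fpsX : fps k := Fps (fun n => (n == 1%N)%:R).
Definition fps_add f g : fps k := Fps (fun n => fpscoef f n + fpscoef g n).
Definition fps_opp f : fps k := Fps (fun n => - fpscoef f n).
Definition fps_mul f g : fps k :=
  Fps (fun n => \sum_(i < n.+1) fpscoef f i * fpscoef g (n - i)).

Fact fps_addA : associative fps_add.
Proof. by move=> f g h; apply/fpsP => n /=; rewrite addrA. Qed.
Fact fps_addC : commutative fps_add.
Proof. by move=> f g; apply/fpsP => n /=; rewrite addrC. Qed.
Fact fps_add0 : left_id (fpsC 0) fps_add.
Proof. by move=> f; apply/fpsP => n /=; rewrite if_same add0r. Qed.
Fact fps_addN : left_inverse (fpsC 0) fps_opp fps_add.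
Proof. by move=> f; apply/fpsP => n /=; rewrite if_same addNr. Qed.

HB.instance Definition _ := GRing.isZmodule.Build (fps k)
  fps_addA fps_addC fps_add0 fps_addN.

Definition fps_trunc N f : {poly k} := \poly_(i < N) fpscoef f i.

Lemma coef_fps_mul_poly N f g (p q : {poly k}) n :
    (forall i, (i < N)%N -> p`_i = fpscoef f i) ->
    (forall i, (i < N)%N -> q`_i = fpscoef g i) ->
  (n < N)%N -> (p * q)`_n = fpscoef (fps_mul f g) n.
Proof.
move=> pf qg ltnN; rewrite coefM /=; apply: eq_bigr => i _.
rewrite pf ?qg //; first exact: leq_ltn_trans (leq_subr _ _) ltnN.
by apply: leq_trans ltnN; exact: ltn_ord.
Qed.

Lemma coef_trunc N f i : (i < N)%N -> (fps_trunc N f)`_i = fpscoef f i.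
Proof. by rewrite coef_poly => ->. Qed.

Lemma coef_fps_mul n f g :
  fpscoef (fps_mul f g) n = (fps_trunc n.+1 f * fps_trunc n.+1 g)`_n.
Proof.
by apply/esym/(@coef_fps_mul_poly n.+1) => // i ltin; exact: coef_trunc.
Qed.

Fact fps_mulC : commutative fps_mul.
Proof.
by move=> f g; apply/fpsP => n; rewrite !coef_fps_mul (mulrC (fps_trunc _ f)).
Qed.

Fact fps_mulA : associative fps_mul.
Proof.
move=> f g h; apply/fpsP => n; pose T := fps_trunc n.+1.
have cT e i : (i < n.+1)%N -> (T e)`_i = fpscoef e i by exact: coef_trunc.
have cM e e' i : (i < n.+1)%N -> (T e * T e')`_i = fpscoef (fps_mul e e') i.
  by move=> ltin; apply: (@coef_fps_mul_poly n.+1) => // j; exact: cT.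
have <- : (T f * (T g * T h))`_n = fpscoef (fps_mul f (fps_mul g h)) n.
  apply: (@coef_fps_mul_poly n.+1) => //; [exact: cT | exact: cM].
rewrite mulrA; apply: (@coef_fps_mul_poly n.+1) => //; [exact: cM | exact: cT].
Qed.

Fact fps_mul1 : left_id (fpsC 1) fps_mul.
Proof.
move=> f; apply/fpsP => n /=; rewrite big_ord_recl /= mul1r subn0.
by rewrite big1 ?addr0 // => i _; rewrite mul0r.
Qed.

Fact fps_mulDl : left_distributive fps_mul fps_add.
Proof.
move=> f g h; apply/fpsP => n /=; rewrite -big_split /=.
by apply: eq_bigr => i _; rewrite mulrDl.
Qed.

Fact fps_1neq0 : fpsC 1 != 0.
Proof.
apply/eqP => /(congr1 (fun f => fpscoef f 0)) /= /eqP.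
by rewrite oner_eq0.
Qed.

HB.instance Definition _ := GRing.Zmodule_isComNzRing.Build (fps k)
  fps_mulA fps_mulC fps_mul1 fps_mulDl fps_1neq0.

Lemma fpscoef0 n : fpscoef (0 : fps k) n = 0.
Proof. by rewrite /= if_same. Qed.

Lemma fpscoefD f g n : fpscoef (f + g) n = fpscoef f n + fpscoef g n.
Proof. by []. Qed.

Lemma fpscoefN f n : fpscoef (- f) n = - fpscoef f n.
Proof. by []. Qed.

Lemma fpscoefM f g n :
  fpscoef (f * g) n = \sum_(i < n.+1) fpscoef f i * fpscoef g (n - i).
Proof. by []. Qed.

Definition fps_unit : pred (fps k) := fun f => `[< exists g, g * f = 1 >].

Definition fps_inv f : fps k :=
  if pselect (exists g, g * f = 1) is left e then projT1 (cid e) else f.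

Fact fps_mulV : {in fps_unit, left_inverse 1 fps_inv *%R}.
Proof.
move=> f /asboolP uf; rewrite /fps_inv; case: pselect => // e.
exact: (projT2 (cid e)).
Qed.

Fact fps_unitPl f g : g * f = 1 -> fps_unit f.
Proof. by move=> gf; apply/asboolP; exists g. Qed.

Fact fps_inv_out : {in [predC fps_unit], fps_inv =1 id}.
Proof. by move=> f /asboolPn nf; rewrite /fps_inv; case: pselect. Qed.

HB.instance Definition _ := GRing.ComNzRing_hasMulInverse.Build (fps k)
  fps_mulV fps_unitPl fps_inv_out.

Lemma fps_neq0_order f : f != 0 ->
  exists2 n, fpscoef f n != 0 & forall i, (i < n)%N -> fpscoef f i = 0.
Proof.
move=> nf; have ex : exists n, fpscoef f n != 0.
  apply: contrapT => nex; case/eqP: nf; apply/fpsP => n.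
  by rewrite fpscoef0; apply/eqP; apply: contraT => nn; case: nex; exists n.
exists (ex_minn ex); first by case: ex_minnP.
case: ex_minnP => n _ min i lt_in; apply/eqP; apply: contraT => /min.
by rewrite leqNgt lt_in.
Qed.

Fact fps_integral : GRing.integral_domain_axiom (fps k).
Proof.
move=> f g fg0; apply: contraT; rewrite negb_or => /andP[].
move=> /fps_neq0_order[m fm minf] /fps_neq0_order[n gn ming].
have := congr1 (fun h => fpscoef h (m + n)) fg0.
rewrite fpscoefM fpscoef0.
have ltm : (m < (m + n).+1)%N by rewrite ltnS leq_addr.
rewrite (bigD1 (Ordinal ltm)) //= addKn big1 => [|i ne_im].
  by rewrite addr0 => /eqP; rewrite mulf_eq0 (negPf fm) (negPf gn).
have [lt_im|lt_mi|eq_im] := ltngtP i m.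
- by rewrite minf ?mul0r.
- rewrite ming ?mulr0 // ltn_subLR; last by rewrite -ltnS ltn_ord.
  by rewrite ltn_add2r.
- by case/eqP: ne_im; apply: val_inj.
Qed.

HB.instance Definition _ := GRing.ComUnitRing_isIntegral.Build (fps k)
  fps_integral.

Fact fpsC_zmod : zmod_morphism fpsC.
Proof.
move=> a b; apply/fpsP => n; rewrite fpscoefD fpscoefN /=.
by case: eqP => // _; rewrite subr0.
Qed.

Fact fpsC_monoid : monoid_morphism fpsC.
Proof.
split=> // a b; apply/fpsP => n; rewrite fpscoefM /=.
rewrite big_ord_recl /= subn0 big1 ?addr0 => [|i _]; last by rewrite mul0r.
by case: eqP => // _; rewrite mulr0.
Qed.

HB.instance Definition _ := GRing.isZmodMorphism.Build k (fps k) fpsC fpsC_zmod.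
HB.instance Definition _ :=
  GRing.isMonoidMorphism.Build k (fps k) fpsC fpsC_monoid.

(* t |-> 0 *)
Definition fps_ev0 f : k := fpscoef f 0.

Fact fps_ev0_zmod : zmod_morphism fps_ev0.
Proof. by []. Qed.

Fact fps_ev0_monoid : monoid_morphism fps_ev0.
Proof. by split=> // f g; rewrite /fps_ev0 fpscoefM big_ord1. Qed.

HB.instance Definition _ :=
  GRing.isZmodMorphism.Build (fps k) k fps_ev0 fps_ev0_zmod.
HB.instance Definition _ :=
  GRing.isMonoidMorphism.Build (fps k) k fps_ev0 fps_ev0_monoid.

End FpsRing.

Definition laurent (k : fieldType) : fieldType := {fraction fps k}.

Definition fps_laurent (k : fieldType) : {rmorphism fps k -> laurent k} :=
  @tofrac (fps k).

Definition const_laurent (k : fieldType) : {rmorphism k -> laurent k} :=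
  @tofrac (fps k) \o @fpsC k.

(* Algebras are not required to have a unit. *)
Record assocAlg (R : comNzRingType) := AssocAlg {
  alg_sort :> lmodType R;
  amul : alg_sort -> alg_sort -> alg_sort;
  amul_linearr : forall x, linear (amul x);
  amul_linearl : forall y, linear (amul^~ y);
  amulA : associative amul
}.

Record algIso (R : comNzRingType) (X Y : assocAlg R) := AlgIso {
  iso_fun :> {linear X -> Y};
  iso_mul : forall x y, iso_fun (amul x y) = amul (iso_fun x) (iso_fun y);
  iso_bij : bijective iso_fun
}.

Definition isomorphic (R : comNzRingType) (X Y : assocAlg R) : Prop :=
  inhabited (algIso X Y).

Section AlgTheory.
Variables (R : comNzRingType) (X : assocAlg R).
Implicit Types x y : X.

Lemma amulDr x y z : amul x (y + z) = amul x y + amul x z.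
Proof. by have := amul_linearr x 1 y z; rewrite !scale1r. Qed.
Lemma amulDl x y z : amul (y + z) x = amul y x + amul z x.
Proof. by have := amul_linearl x 1 y z; rewrite !scale1r. Qed.
Lemma amul0r x : amul x 0 = 0.
Proof. by apply: (addrI (amul x 0)); rewrite -amulDr !addr0. Qed.
Lemma amul0l x : amul 0 x = 0.
Proof. by apply: (addrI (amul 0 x)); rewrite -amulDl !addr0. Qed.
Lemma amulZr x a y : amul x (a *: y) = a *: amul x y.
Proof. by have := amul_linearr x a y 0; rewrite amul0r !addr0. Qed.
Lemma amulZl x a y : amul (a *: y) x = a *: amul y x.
Proof. by have := amul_linearl x a y 0; rewrite amul0l !addr0. Qed.

End AlgTheory.

(* Base change X (x)_R S of an R-module or R-algebra X along f : R -> S; S is an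
   R-module through f. *)
Section BaseChange.
Variables (R S : comNzRingType) (f : {rmorphism R -> S}).

Section Tensor.
Variable X : lmodType R.

(* The list [:: (x_1, a_1); ...; (x_n, a_n)] stands for the formal sum
   x_1 (x) a_1 + ... + x_n (x) a_n. *)
Inductive tens_rel : seq (X * S) -> seq (X * S) -> Prop :=
| tens_refl s : tens_rel s s
| tens_sym s t : tens_rel s t -> tens_rel t s
| tens_trans s t u : tens_rel s t -> tens_rel t u -> tens_rel s u
| tens_cat s s' t t' :
    tens_rel s s' -> tens_rel t t' -> tens_rel (s ++ t) (s' ++ t')
| tens_catC s t : tens_rel (s ++ t) (t ++ s)
| tens_0 a : tens_rel [:: (0, a)] [::]
| tens_Dl x y a : tens_rel [:: (x + y, a)] [:: (x, a); (y, a)]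
| tens_Dr x a b : tens_rel [:: (x, a + b)] [:: (x, a); (x, b)]
| tens_Z r x a : tens_rel [:: (r *: x, a)] [:: (x, f r * a)].

Definition tens_eq : rel (seq (X * S)) := fun s t => `[< tens_rel s t >].

Fact tens_eq_refl : reflexive tens_eq.
Proof. by move=> s; apply/asboolP; exact: tens_refl. Qed.
Fact tens_eq_sym : ssrbool.symmetric tens_eq.
Proof. by move=> s t; apply/asboolP/asboolP => /tens_sym. Qed.
Fact tens_eq_trans : transitive tens_eq.
Proof.
by move=> s t u /asboolP ts /asboolP su; apply/asboolP; exact: tens_trans su.
Qed.

Canonical tens_equiv := EquivRel tens_eq tens_eq_refl tens_eq_sym tens_eq_trans.

Definition tens := {eq_quot tens_equiv}.
HB.instance Definition _ := Choice.on tens.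
HB.instance Definition _ := Quotient.on tens.

Definition tens_pi (s : seq (X * S)) : tens := \pi_tens s.

Lemma tens_piP s t : reflect (tens_pi s = tens_pi t) `[< tens_rel s t >].
Proof.
apply: (iffP idP) => [st|]; first exact/eqmodP.
by move/eqmodP.
Qed.

Lemma tens_piE s t : tens_rel s t -> tens_pi s = tens_pi t.
Proof. by move=> st; apply/tens_piP/asboolP. Qed.

Lemma tens_pi_repr u : tens_pi (repr u) = u.
Proof. exact: reprK. Qed.

Definition tens_zero : tens := tens_pi [::].
Definition tens_add (u v : tens) : tens := tens_pi (repr u ++ repr v).
Definition tens_opp (u : tens) : tens :=
  tens_pi [seq (- p.1, p.2) | p <- repr u].

Lemma tens_repr s : tens_rel (repr (tens_pi s)) s.
Proof. by apply/asboolP/tens_piP; rewrite tens_pi_repr. Qed.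

Lemma tens_add_pi s t : tens_add (tens_pi s) (tens_pi t) = tens_pi (s ++ t).
Proof. by apply: tens_piE; apply: tens_cat; exact: tens_repr. Qed.

Fact tens_addA : associative tens_add.
Proof.
move=> u v w; rewrite -(tens_pi_repr u) -(tens_pi_repr v) -(tens_pi_repr w).
by rewrite !tens_add_pi catA.
Qed.
Fact tens_addC : commutative tens_add.
Proof. by move=> u v; apply: tens_piE; exact: tens_catC. Qed.
Fact tens_add0 : left_id tens_zero tens_add.
Proof. by move=> u; rewrite -(tens_pi_repr u) tens_add_pi. Qed.
Fact tens_addN : left_inverse tens_zero tens_opp tens_add.
Proof.
move=> u; rewrite -{2}(tens_pi_repr u) tens_add_pi.
elim: (repr u) => [//|[x a] s IHs] /=.
have consE y l :
    tens_pi ((y, a) :: l) = tens_add (tens_pi [:: (y, a)]) (tens_pi l).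
  by rewrite tens_add_pi.
rewrite (consE (- x)) -tens_add_pi (consE x) [X in tens_add _ X]tens_addA.
rewrite (tens_addC (tens_pi (map _ _))) -[X in tens_add _ X]tens_addA.
rewrite (tens_add_pi (map _ _)) IHs [X in tens_add _ X]tens_addC tens_add0.
rewrite tens_add_pi; apply: tens_piE; apply: tens_trans (tens_0 a).
by rewrite -(addNr x); apply: tens_sym; exact: tens_Dl.
Qed.

HB.instance Definition _ := GRing.isZmodule.Build tens
  tens_addA tens_addC tens_add0 tens_addN.

Definition tensor (x : X) (a : S) : tens := tens_pi [:: (x, a)].

Lemma tens_pi_sum s : tens_pi s = \sum_(p <- s) tensor p.1 p.2.
Proof.
elim: s => [|[x a] s IHs]; first by rewrite big_nil.
by rewrite big_cons -IHs -cat1s -tens_add_pi.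
Qed.

Lemma tensP u : exists s : seq (X * S), u = \sum_(p <- s) tensor p.1 p.2.
Proof. by exists (repr u); rewrite -tens_pi_sum tens_pi_repr. Qed.

Lemma tensorDl x y a : tensor (x + y) a = tensor x a + tensor y a.
Proof. by rewrite [RHS]tens_add_pi; apply: tens_piE; exact: tens_Dl. Qed.
Lemma tensorDr x a b : tensor x (a + b) = tensor x a + tensor x b.
Proof. by rewrite [RHS]tens_add_pi; apply: tens_piE; exact: tens_Dr. Qed.
Lemma tensorZ r x a : tensor (r *: x) a = tensor x (f r * a).
Proof. by apply: tens_piE; exact: tens_Z. Qed.

Definition balanced (Z : zmodType) (g : X -> S -> Z) : Prop :=
  [/\ forall x y a, g (x + y) a = g x a + g y a,
      forall x a b, g x (a + b) = g x a + g x b &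
      forall r x a, g (r *: x) a = g x (f r * a)].

Lemma tensor_balanced : balanced tensor.
Proof. by split; [exact: tensorDl | exact: tensorDr | exact: tensorZ]. Qed.

(* The additive map u |-> g~(u) with g~(x (x) a) = g x a, for g balanced. *)
Definition tens_lift (Z : zmodType) (g : X -> S -> Z) (u : tens) : Z :=
  \sum_(p <- repr u) g p.1 p.2.

Lemma tens_rel_sum (Z : zmodType) (g : X -> S -> Z) s t :
  balanced g -> tens_rel s t ->
  \sum_(p <- s) g p.1 p.2 = \sum_(p <- t) g p.1 p.2.
Proof.
move=> [gDl gDr gZ]; elim=> {s t}.
- by [].
- by move=> s t _ ->.
- by move=> s t u _ -> _ ->.
- by move=> s s' t t' _ e _ e'; rewrite !big_cat /= e e'.
- by move=> s t; rewrite !big_cat /= addrC.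
- move=> a; rewrite big_nil big_seq1 /=.
  by apply: (addrI (g 0 a)); rewrite -gDl !addr0.
- by move=> x y a; rewrite !big_cons !big_nil /= !addr0 gDl.
- by move=> x a b; rewrite !big_cons !big_nil /= !addr0 gDr.
- by move=> r x a; rewrite !big_seq1 /= gZ.
Qed.

Lemma tens_lift_pi (Z : zmodType) (g : X -> S -> Z) s :
  balanced g -> tens_lift g (tens_pi s) = \sum_(p <- s) g p.1 p.2.
Proof. by move=> gb; apply: tens_rel_sum => //; exact: tens_repr. Qed.

Lemma tens_lift_tensor (Z : zmodType) (g : X -> S -> Z) x a :
  balanced g -> tens_lift g (tensor x a) = g x a.
Proof. by move=> gb; rewrite tens_lift_pi // big_seq1. Qed.

Lemma tens_liftD (Z : zmodType) (g : X -> S -> Z) u v :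
  balanced g -> tens_lift g (u + v) = tens_lift g u + tens_lift g v.
Proof.
by move=> gb; rewrite [u + v]/(tens_add u v) tens_lift_pi // big_cat.
Qed.

Lemma tens_ind (P : tens -> Prop) :
    P 0 -> (forall x a, P (tensor x a)) ->
    (forall u v, P u -> P v -> P (u + v)) ->
  forall u, P u.
Proof.
move=> P0 P1 PD u; have [s ->] := tensP u.
by elim/big_rec: _ => // p v _ Pv; exact: PD.
Qed.

Definition tens_scale (c : S) : tens -> tens :=
  tens_lift (fun x a => tensor x (c * a)).

Lemma tens_scale_balanced c : balanced (fun x a => tensor x (c * a)).
Proof.
split=> *; first exact: tensorDl; first by rewrite mulrDr tensorDr.
by rewrite tensorZ mulrCA.
Qed.

Lemma tens_scale_tensor c x a : tens_scale c (tensor x a) = tensor x (c * a).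
Proof. exact/tens_lift_tensor/tens_scale_balanced. Qed.

Fact tens_scaleDr : right_distributive tens_scale +%R.
Proof. by move=> c u v; exact/tens_liftD/tens_scale_balanced. Qed.

Lemma tens_scale0 c : tens_scale c 0 = 0.
Proof. by apply: (addrI (tens_scale c 0)); rewrite -tens_scaleDr !addr0. Qed.

Fact tens_scaleA c d u :
  tens_scale c (tens_scale d u) = tens_scale (c * d) u.
Proof.
elim/tens_ind: u => [|x a|u v IHu IHv]; rewrite ?tens_scale0 //.
  by rewrite !tens_scale_tensor mulrA.
by rewrite !tens_scaleDr IHu IHv.
Qed.
Fact tens_scale1 : left_id 1 tens_scale.
Proof.
elim/tens_ind=> [|x a|u v IHu IHv]; rewrite ?tens_scale0 //.
  by rewrite tens_scale_tensor mul1r.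
by rewrite tens_scaleDr IHu IHv.
Qed.
Fact tens_scaleDl u : {morph tens_scale^~ u : c d / c + d}.
Proof.
move=> c d /=; elim/tens_ind: u => [|x a|u v IHu IHv].
- by rewrite !tens_scale0 addr0.
- by rewrite !tens_scale_tensor mulrDl tensorDr.
- by rewrite !tens_scaleDr IHu IHv addrACA.
Qed.

HB.instance Definition _ := GRing.Zmodule_isLmodule.Build S tens
  tens_scaleA tens_scale1 tens_scaleDr tens_scaleDl.

Lemma scale_tensor (c : S) x a : c *: tensor x a = tensor x (c * a).
Proof. exact: tens_scale_tensor. Qed.

End Tensor.

Section TensorAlg.
Variable X : assocAlg R.

Definition tens_mul (u v : tens X) : tens X :=
  tens_lift (fun x a => tens_lift (fun y b => tensor (amul x y) (a * b)) v) u.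

Lemma tens_mul_balr x a :
  balanced (fun (y : X) b => tensor (amul x y) (a * b)).
Proof.
split=> *; first by rewrite amulDr tensorDl.
  by rewrite mulrDr tensorDr.
by rewrite amulZr tensorZ mulrCA.
Qed.

Lemma tens_mul_ball v : balanced
  (fun (x : X) a => tens_lift (fun y b => tensor (amul x y) (a * b)) v).
Proof.
split=> *; rewrite /tens_lift -?big_split /=; apply: eq_bigr => p _.
- by rewrite amulDl tensorDl.
- by rewrite mulrDl tensorDr.
- by rewrite amulZl tensorZ mulrA.
Qed.

Lemma tens_mulDl u u' v : tens_mul (u + u') v = tens_mul u v + tens_mul u' v.
Proof. exact/tens_liftD/tens_mul_ball. Qed.

Lemma tens_mulDr u v v' : tens_mul u (v + v') = tens_mul u v + tens_mul u v'.
Proof.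
rewrite /tens_mul /tens_lift -big_split; apply: eq_bigr => p _ /=.
exact: (tens_liftD v v' (tens_mul_balr p.1 p.2)).
Qed.

Lemma tens_mul_tensor x a y b :
  tens_mul (tensor x a) (tensor y b) = tensor (amul x y) (a * b).
Proof.
rewrite /tens_mul tens_lift_tensor; last exact: tens_mul_ball.
by rewrite tens_lift_tensor //; exact: tens_mul_balr.
Qed.

Lemma tens_mul0l v : tens_mul 0 v = 0.
Proof. by apply: (addrI (tens_mul 0 v)); rewrite -tens_mulDl !addr0. Qed.
Lemma tens_mul0r v : tens_mul v 0 = 0.
Proof. by apply: (addrI (tens_mul v 0)); rewrite -tens_mulDr !addr0. Qed.

Lemma tens_mulZr u c v : tens_mul u (c *: v) = c *: tens_mul u v.
Proof.
elim/tens_ind: u => [|x a|u u' IHu IHu'].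
- by rewrite !tens_mul0l scaler0.
- elim/tens_ind: v => [|y b|v v' IHv IHv'].
  + by rewrite !(scaler0, tens_mul0r).
  + by rewrite scale_tensor !tens_mul_tensor scale_tensor mulrCA.
  + by rewrite scalerDr !tens_mulDr IHv IHv' scalerDr.
- by rewrite !tens_mulDl IHu IHu' scalerDr.
Qed.

Lemma tens_mulZl v c u : tens_mul (c *: u) v = c *: tens_mul u v.
Proof.
elim/tens_ind: u => [|x a|u u' IHu IHu'].
- by rewrite !(scaler0, tens_mul0l).
- elim/tens_ind: v => [|y b|v v' IHv IHv'].
  + by rewrite !tens_mul0r scaler0.
  + by rewrite scale_tensor !tens_mul_tensor scale_tensor mulrA.
  + by rewrite !tens_mulDr IHv IHv' scalerDr.
- by rewrite scalerDr !tens_mulDl IHu IHu' scalerDr.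
Qed.

Fact tens_mul_linearr u : linear (tens_mul u).
Proof. by move=> c v w; rewrite tens_mulDr tens_mulZr. Qed.
Fact tens_mul_linearl v : linear (tens_mul^~ v).
Proof. by move=> c u w; rewrite tens_mulDl tens_mulZl. Qed.

Fact tens_mulA : associative tens_mul.
Proof.
move=> u v w; elim/tens_ind: u => [|x a|u u' IHu IHu'].
- by rewrite !tens_mul0l.
- elim/tens_ind: v => [|y b|v v' IHv IHv'].
  + by rewrite !(tens_mul0l, tens_mul0r).
  + elim/tens_ind: w => [|z c|w w' IHw IHw'].
    * by rewrite !tens_mul0r.
    * by rewrite !tens_mul_tensor amulA mulrA.
    * by rewrite !tens_mulDr IHw IHw'.
  + by rewrite !(tens_mulDl, tens_mulDr) IHv IHv'.
- by rewrite !tens_mulDl IHu IHu'.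
Qed.

Definition base_change : assocAlg S :=
  AssocAlg tens_mul_linearr tens_mul_linearl tens_mulA.

End TensorAlg.
End BaseChange.

Section Deformation.
Variable k : fieldType.

Definition tdiv (M : lmodType (fps k)) (n : nat) (x : M) : Prop :=
  exists y : M, x = fpsX k ^+ n *: y.

(* M -> lim M / t^n M is injective and surjective. *)
Definition t_complete (M : lmodType (fps k)) : Prop :=
  (forall x : M, (forall n, tdiv n x) -> x = 0) /\
  (forall u : nat -> M, (forall n, tdiv n (u n.+1 - u n)) ->
     exists x : M, forall n, tdiv n (x - u n)).

Definition torsion_free (R : comNzRingType) (M : lmodType R) : Prop :=
  forall (r : R) (x : M), r *: x = 0 -> r = 0 \/ x = 0.

Record formal_deformation (B : assocAlg k) := FormalDeformation {
  def_alg :> assocAlg (fps k);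
  def_complete : t_complete def_alg;
  def_torsion_free : torsion_free def_alg;
  def_iso : algIso (base_change (@fps_ev0 k) def_alg) B
}.

End Deformation.

Section Degeneration.
Variables (k : fieldType) (V : vectType k).

(* Hom(V (x) V, V) is represented in curried form as Hom(V, Hom(V, V)). *)
Record Ass := MkAss {
  ass_mul :> 'Hom(V, 'Hom(V, V));
  ass_mulA : forall u v w : V,
    ass_mul (ass_mul u v) w = ass_mul u (ass_mul v w)
}.

Lemma ass_mul_inj : injective ass_mul.
Proof.
by move=> [A hA] [B hB] /= eAB; case: _ / eAB in hB *; congr MkAss.
Qed.

Definition GL := {g : 'End(V) | lker g == 0%VS}.

Definition gl_act_mul (g : GL) (A : 'Hom(V, 'Hom(V, V))) :
    'Hom(V, 'Hom(V, V)) :=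
  linfun (fun v => (val g \o A ((val g)^-1%VF v) \o (val g)^-1)%VF).

Lemma gl_act_mulE (g : GL) (A : 'Hom(V, 'Hom(V, V))) v w :
  gl_act_mul g A v w = val g (A ((val g)^-1%VF v) ((val g)^-1%VF w)).
Proof.
pose F u := (val g \o A ((val g)^-1%VF u) \o (val g)^-1)%VF.
have linF : linear F.
  move=> c x y; apply/lfunP => z.
  rewrite add_lfunE scale_lfunE !comp_lfunE !linearP.
  by rewrite add_lfunE scale_lfunE linearP.
pose linFm := GRing.isLinear.Build k V 'Hom(V, V) *:%R F linF.
pose FL : {linear V -> 'Hom(V, V)} := HB.pack F linFm.
by rewrite /gl_act_mul (lfunE FL) /= /F !comp_lfunE.
Qed.

Fact gl_act_mulA (g : GL) (A : Ass) (u v w : V) :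
  gl_act_mul g A (gl_act_mul g A u v) w = gl_act_mul g A u (gl_act_mul g A v w).
Proof. by rewrite !gl_act_mulE !(lker0_lfunK (valP g)) ass_mulA. Qed.

Definition gl_act (g : GL) (A : Ass) : Ass := MkAss (gl_act_mulA g A).

Definition orbit (A : Ass) : set Ass :=
  [set gl_act g A | g in [set: GL]]%classic.

Definition poly_eval (W : vectType k) (p : {mpoly k[\dim {:W}]}) (w : W) : k :=
  p.@[fun i => coord (vbasis {:W}) i w].

(* Closed subsets of Ass V: common zeros of a set of polynomials in the
   coordinates of Hom(V (x) V, V). *)
Definition zariski_closed (Z : set Ass) : Prop :=
  exists P : set {mpoly k[\dim {:'Hom(V, 'Hom(V, V))}]},
    Z = [set A : Ass | forall p, P p -> poly_eval p A = 0]%classic.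

Definition zariski_closure (Y : set Ass) : set Ass := smallest zariski_closed Y.

Definition is_degeneration (B A : Ass) : Prop :=
  (orbit B `<=` zariski_closure (orbit A))%classic.

Fact ass_linearr (A : Ass) (v : V) : linear (fun w => A v w).
Proof. by move=> c x y; rewrite linearP. Qed.
Fact ass_linearl (A : Ass) (w : V) : linear (fun v => A v w).
Proof. by move=> c x y; rewrite linearP /= !lfunE /= !lfunE. Qed.
Fact ass_associative (A : Ass) : associative (fun v w => A v w).
Proof. by move=> u v w; rewrite ass_mulA. Qed.

Definition ass_alg (A : Ass) : assocAlg k :=
  @AssocAlg k V (fun v w => A v w)
    (ass_linearr A) (ass_linearl A) (@ass_associative A).

End Degeneration.

(* Main.v *)
Require Import Defs.
From HB Require Import structures.
From mathcomp Require Import all_boot all_order all_algebra.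
From mathcomp Require Import generic_quotient ring_quotient.
From mathcomp Require Import boolp classical_sets.
From mathcomp Require Import mpoly ring.

Set Implicit Arguments.
Unset Strict Implicit.
Unset Printing Implicit Defensive.

Import Order.TTheory GRing.Theory.
Local Open Scope ring_scope.

(** An algebra is handled through its structure constants in a basis, which form
    a point of an affine space; write n for the dimension of V and K for k((t)).
    In the basis mu det(h) h the structure constants of A are polynomial
    functions theta(h, mu) of a matrix h and a scalar mu ([theta_sbasis]), and
    over any field the constants of the algebras isomorphic to A are the values
    of theta at the points with mu det(h) <> 0.  As k is infinite, a polynomial p
    vanishes on the orbit of A exactly when p(theta) is the zero polynomial
    ([orbit_polynomialP]).

    From a deformation X of B to a degeneration: X is free over k[[t]], because
    lifting a basis of B gives a basis of X ([deformation_sbasis]), and its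
    structure constants c(t) reduce at t = 0 to those of B.  The isomorphism over
    K writes c(t) as theta(h, mu) with h and mu over K.  So a polynomial p that
    vanishes on the orbit of A satisfies p(c(t)) = 0, and t = 0 gives p(B) = 0.

    From a degeneration to a deformation: let h and mu be generic, with entries
    in the rational function field L.  That B lies in the closure means that
    theta(h, mu) |-> B is a homomorphism on the k-algebra generated by the
    entries of theta(h, mu).  By Chevalley's theorem it extends to a place of L
    ([chevalley]).  For each of the finitely many elements h_ij, mu and
    mu det(h), the element or its inverse lies in the valuation ring.  The arc
    lemma ([arc]) replaces these elements and the entries of theta(h, mu) by
    power series in t with the same polynomial relations and the values at t = 0
    prescribed by the place, none of the former series being zero.  Inverting
    where needed gives h(t) and mu(t) over K with mu det(h) <> 0, such that
    c(t) = theta(h(t), mu(t)) has entries in k[[t]] and c(0) = B.  The algebra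
    with constants c(t) is the required deformation.

    The arc lemma is a curve selection lemma.  Given y_1, ..., y_M in a field over
    k, a homomorphism phi from R = k[y_1, ..., y_M] to k and s <> 0 in R, it
    produces a homomorphism from R to k[[t]] that lifts phi and does not kill s.
    By Noether normalization R is integral over a polynomial ring Z = k[z_1, ..., z_d]
    ([noether_normalization]).  Some multiple of s is a nonzero element sigma of
    Z; choose a line through the point phi of Spec Z on which sigma is not
    identically zero.  Since Z is normal, going down holds ([going_down]): some
    prime of R inside the kernel of phi lies over the prime of the line.  The
    quotient is the ring of a curve through phi, finite over k[x].  A place of
    its function field E at phi is discrete, because E has finite dimension over
    k(x) and so only finitely many values are distinct modulo the value of x
    ([uniformizer]).  Expanding in powers of a uniformizer maps R to k[[t]].

    Normality of Z enters as a form of Gauss's lemma ([gauss_monic]), deduced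
    from complete integral closedness, which for polynomial rings follows from a
    comparison of leading monomials ([mpoly_completely_integrally_closed]). *)

(** * Polynomials over an infinite field *)

Lemma digits_inj n N (f g : 'I_n -> nat) :
    (forall i, f i < N)%N -> (forall i, g i < N)%N ->
  (\sum_i f i * N ^ i = \sum_i g i * N ^ i)%N -> f =1 g.
Proof.
elim: n => [|n IHn] in f g *; first by move=> _ _ _ [].
move=> ltf ltg; rewrite !big_ord_recl !expn0 !muln1.
have shift (h : 'I_n.+1 -> nat) : (\sum_(i < n) h (lift ord0 i) * N ^ lift ord0 i =
    (\sum_(i < n) h (lift ord0 i) * N ^ i) * N)%N.
  by rewrite big_distrl; apply: eq_bigr => i _; rewrite expnSr mulnA.
rewrite !shift => eq_fg; have N_gt0 : (0 < N)%N by apply: leq_ltn_trans (ltf ord0).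
have eq0 : f ord0 = g ord0.
  have := congr1 (modn^~ N) eq_fg.
  by rewrite addnC modnMDl (addnC (g _)) modnMDl !modn_small.
move: eq_fg; rewrite eq0 => /addnI/eqP; rewrite eqn_pmul2r // => /eqP eqS.
move=> i; case: (unliftP ord0 i) => [j|] -> //.
by apply: (IHn (fun i => f (lift ord0 i)) (fun i => g (lift ord0 i))) => // i1.
Qed.

Lemma closed_avoid (k : closedFieldType) (s : seq k) : exists x, x \notin s.
Proof.
have: \prod_(a <- s) ('X - a%:P) != 0.
  by rewrite monic_neq0 // monic_prod_XsubC.
by case/closed_nonrootP=> x; rewrite root_prod_XsubC => sx; exists x.
Qed.

(** Kronecker substitution X_i := T^(N^i), with N above all exponents, sends
    distinct monomials to distinct powers of T, so it reduces the claim to one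
    variable. *)
Lemma mpoly_nonroot (k : closedFieldType) n (p : {mpoly k[n]}) :
  p != 0 -> exists v, p.@[v] != 0.
Proof.
move=> nz_p; pose N := msize p.
pose wt (m : 'X_{1..n}) := (\sum_i m i * N ^ i)%N.
have wt_inj m m' : m \in msupp p -> m' \in msupp p -> wt m = wt m' -> m = m'.
  have bnd m1 : m1 \in msupp p -> forall i, (m1 i < N)%N.
    move=> m1p i; apply: leq_ltn_trans (msize_mdeg_lt m1p).
    by rewrite mdegE (bigD1 i) //= leq_addr.
  by move=> mp m'p /digits_inj eqm; apply/mnmP/eqm; apply: bnd.
pose P : {poly k} := \sum_(m <- msupp p) p@_m *: 'X^(wt m).
have [m0 m0p] : exists m, m \in msupp p.
  by exists (mlead p); apply: mlead_supp.
have: P != 0.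
  apply/eqP => /(congr1 (fun q : {poly k} => q`_(wt m0))).
  rewrite coef0 coef_sum (bigD1_seq m0) ?msupp_uniq //=.
  rewrite big1_seq ?addr0 => [|m /andP[ne_m mp]].
    rewrite coefZ coefXn eqxx mulr1 => /eqP.
    by rewrite mcoeff_eq0 m0p.
  rewrite coefZ coefXn; case: eqP => [/wt_inj eqm|]; rewrite ?mulr0 //.
  by rewrite eqm // eqxx in ne_m.
case/closed_nonrootP=> x Px; exists (fun i : 'I_n => x ^+ (N ^ i)).
congr (_ != 0): Px; rewrite horner_sum mevalE; apply: eq_bigr => m _.
rewrite hornerZ hornerXn; congr (_ * _); rewrite expr_sum.
by apply: eq_bigr => i _; rewrite -exprM mulnC.
Qed.

(** * Gauss's lemma over completely integrally closed domains *)

Section Gauss.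
Variables (k : closedFieldType) (Z : idomainType) (i0 : {rmorphism k -> Z}).
Local Notation F := {fraction Z}.
Local Notation toF := (@tofrac Z).

Definition in_dom (x : F) := exists z : Z, x = toF z.

Lemma in_dom_id z : in_dom (toF z). Proof. by exists z. Qed.
Lemma in_domD x y : in_dom x -> in_dom y -> in_dom (x + y).
Proof. by case=> a -> [b ->]; exists (a + b); rewrite rmorphD. Qed.
Lemma in_domB x y : in_dom x -> in_dom y -> in_dom (x - y).
Proof. by case=> a -> [b ->]; exists (a - b); rewrite rmorphB. Qed.
Lemma in_domM x y : in_dom x -> in_dom y -> in_dom (x * y).
Proof. by case=> a -> [b ->]; exists (a * b); rewrite rmorphM. Qed.
Lemma in_dom_sum (I : Type) (s : seq I) (P : pred I) (x : I -> F) :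
  (forall i, P i -> in_dom (x i)) -> in_dom (\sum_(i <- s | P i) x i).
Proof.
move=> sx; elim/big_rec: _ => [|i y Pi]; last by apply/in_domD/sx.
by rewrite -(rmorph0 toF); apply: in_dom_id.
Qed.
Lemma in_dom_prod (I : Type) (s : seq I) (P : pred I) (x : I -> F) :
  (forall i, P i -> in_dom (x i)) -> in_dom (\prod_(i <- s | P i) x i).
Proof.
move=> sx; elim/big_rec: _ => [|i y Pi]; last by apply/in_domM/sx.
by rewrite -(rmorph1 toF); apply: in_dom_id.
Qed.
Lemma in_dom_det n (A : 'M[F]_n) :
  (forall i j, in_dom (A i j)) -> in_dom (\det A).
Proof.
move=> iA; apply: in_dom_sum => s _; apply: in_domM.
  by rewrite -(rmorph_sign toF); apply: in_dom_id.
by apply: in_dom_prod.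
Qed.

Lemma frac_denom (x : F) : exists2 c : Z, c != 0 & in_dom (toF c * x).
Proof.
elim/quotW: x => x; exists x.2; rewrite ?denom_ratioP //.
exists x.1; unlock FracField.tofrac; rewrite -[LHS]FracField.pi_mul.
apply/eqmodP; rewrite /= FracField.equivfE.
rewrite /FracField.mulf !numden_Ratio ?mul1r ?oner_neq0 ?denom_ratioP //.
by rewrite mulr1.
Qed.

Lemma frac_denoms (T : finType) (x : T -> F) :
  exists2 c : Z, c != 0 & forall t, in_dom (toF c * x t).
Proof.
have /choice[c Hc] : forall t, exists c : Z, c != 0 /\ in_dom (toF c * x t).
  by move=> t; have [c] := frac_denom (x t); exists c.
exists (\prod_t c t) => [|t].
  by apply/prodf_neq0 => t _; case: (Hc t).
rewrite (bigD1 t) //= rmorphM mulrAC.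
by apply: in_domM (in_dom_id _); case: (Hc t).
Qed.

(** Divided differences: if p takes values in Z then so does (p - p(a)) / (T - a)
    away from a, because the differences of elements of k are units.  Excluding
    finitely many points makes the induction go through. *)
Lemma in_dom_interp (p : {poly F}) (s : seq k) :
    (forall a, a \notin s -> in_dom p.[toF (i0 a)]) ->
  forall i, in_dom p`_i.
Proof.
have [n] := ubnP (size p); elim: n => // n IHn in p s * => /ltnSE le_p ip.
have [a sa] := closed_avoid s; pose t := toF (i0 a).
have: root (p - p.[t]%:P) t by rewrite /root !hornerE subrr.
case/factor_theorem=> q def_q.
have{def_q} def_p : p = q * ('X - t%:P) + p.[t]%:P by rewrite -def_q subrK.
have [q0|nz_q] := eqVneq q 0.
  rewrite def_p q0 mul0r add0r => i; rewrite coefC; case: eqP => _ //.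
    exact: ip.
  by rewrite -(rmorph0 toF); apply: in_dom_id.
have iq : forall i, in_dom q`_i.
  apply: (IHn q (a :: s)).
    move: le_p; rewrite def_p size_polyDl ?size_Mmonic ?monicXsubC //.
      by rewrite size_XsubC addn2.
    rewrite size_XsubC addn2 /= (leq_ltn_trans (size_polyC_leq1 _)) //.
    by rewrite ltnS lt0n size_poly_eq0.
  move=> x; rewrite inE negb_or => /andP[ne_xa sx].
  have nz : x - a != 0 by rewrite subr_eq0.
  have [b def_b] : exists b, b * (x - a) = 1 by exists (x - a)^-1; rewrite mulVf.
  have -> : q.[toF (i0 x)] = toF (i0 b) * (p.[toF (i0 x)] - p.[t]).
    have E : toF (i0 b) * (toF (i0 x) - t) = 1.
      by rewrite /t -!rmorphB -!rmorphM def_b !rmorph1.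
    by rewrite {1}def_p !hornerE addrK mulrCA E mulr1.
  by apply: in_domM (in_dom_id _) _; apply: in_domB; apply: ip.
move=> i; rewrite def_p coefD coefC mulrBr coefB coefMX coefMC.
apply: in_domD; last first.
  by case: eqP => _; [exact: ip | rewrite -(rmorph0 toF); apply: in_dom_id].
apply: in_domB; last exact: in_domM (iq i) (in_dom_id _).
by case: eqP => _; [rewrite -(rmorph0 toF); apply: in_dom_id | exact: iq].
Qed.

(** This strong form of normality suits determinants: powers of a determinant have
    a common denominator as soon as the powers of the matrix have one. *)
Definition completely_integrally_closed := forall x : F,
  (exists2 c : Z, c != 0 & forall n, in_dom (toF c * x ^+ n)) -> in_dom x.

(** Division by G leaves the finitely many powers M^l with l < size G, which have
    a common denominator. *)
Lemma in_dom_horner_mx r (M : 'M[F]_r.+1) (G : {poly Z}) :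
    G \is monic -> horner_mx M (map_poly toF G) = 0 ->
  exists2 c : Z, c != 0 &
    forall (p : {poly Z}) i j, in_dom (toF c * horner_mx M (map_poly toF p) i j).
Proof.
move=> monG MG0; pose N := size G.
have [c nz_c cM] :=
  frac_denoms (fun t : 'I_N * 'I_r.+1 * 'I_r.+1 => (M ^+ t.1.1) t.1.2 t.2).
exists c => // p i j; rewrite (Pdiv.RingMonic.rdivp_eq monG p).
rewrite rmorphD rmorphM /= rmorphD rmorphM /= MG0 mulr0 add0r.
set R := Pdiv.Ring.rmodp p G.
have ltR : (size R < N)%N.
  by rewrite Pdiv.Ring.ltn_rmodpN0 // monic_neq0.
rewrite -[R]coefK poly_def rmorph_sum /= rmorph_sum summxE mulr_sumr.
apply: in_dom_sum => l _; rewrite map_polyZ map_polyXn /= horner_mxZ rmorphXn /=.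
rewrite horner_mx_X mxE mulrCA; apply: in_domM (in_dom_id _) _.
exact: (cM (Ordinal (ltn_trans (ltn_ord l) ltR), i, j)).
Qed.

(** A monic factor mu of G is the characteristic polynomial of a matrix M over
    the fractions. As G(M) = 0, the powers of x - M have a common denominator for
    every x in k, hence so do the powers of mu(x) = det(x - M).  So mu takes
    values in Z on k, and interpolation gives its coefficients. *)
Lemma gauss_monic (mu : {poly F}) (G : {poly Z}) :
    completely_integrally_closed -> mu \is monic -> G \is monic -> mu %| map_poly toF G ->
  exists2 nu : {poly Z}, nu \is monic & mu = map_poly toF nu.
Proof.
move=> Zcic monmu monG muG.
have [|smu] := leqP (size mu) 1.
  move/size1_polyC => def_mu; exists 1; rewrite ?monic1 // rmorph1.
  by move: monmu; rewrite def_mu monicE lead_coefC => /eqP ->.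
have [r [M char_M]] : exists r, exists M : 'M[F]_r.+1, char_poly M = mu.
  have := companionmxK monmu; move: (companionmx mu).
  case: (size mu) smu => [|[|r]] // _ M defM.
  by exists r, M.
have MG0 : horner_mx M (map_poly toF G) = 0.
  case/dvdpP: muG => q ->; rewrite rmorphM /= -char_M Cayley_Hamilton.
  by rewrite mulr0.
have [c nz_c cM] := in_dom_horner_mx monG MG0.
have imu i : in_dom mu`_i.
  apply: (@in_dom_interp mu [::]) => a _; apply: Zcic.
  exists (c ^+ r.+1) => [|n]; first exact: expf_neq0.
  have -> : mu.[toF (i0 a)] = \det (horner_mx M (map_poly toF ((i0 a)%:P - 'X))).
    rewrite -char_M /char_poly -horner_evalE -det_map_mx; congr (\det _).
    have -> : map_poly toF ((i0 a)%:P - 'X) = (toF (i0 a))%:P - 'X.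
      by rewrite rmorphB /= map_polyC map_polyX.
    rewrite [horner_mx _ _]rmorphB /= horner_mx_C horner_mx_X.
    apply/matrixP => s t; rewrite !mxE /horner_eval !hornerE.
    by rewrite hornerMn hornerX.
  have -> : toF (c ^+ r.+1) = \det ((toF c)%:M : 'M_r.+1).
    by rewrite det_scalar rmorphXn.
  have detX (N : 'M[F]_r.+1) m : \det N ^+ m = \det (N ^+ m).
    by elim: m => [|m IHm]; rewrite ?det1 // !exprS IHm -det_mulmx.
  rewrite detX -det_mulmx -rmorphXn -rmorphXn /= mul_scalar_mx.
  by apply: in_dom_det => s t; rewrite mxE; apply: cM.
have /choice[z def_z] := imu.
exists (\poly_(i < size mu) z i); last first.
  by apply/polyP=> i; rewrite coef_map coef_poly; case: ltnP => [_|/(nth_default 0)->];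
    rewrite ?rmorph0 ?def_z.
have inj : injective toF by move=> x y /eqP; rewrite tofrac_eq => /eqP.
rewrite monicE lead_coef_poly ?(ltnW smu) //; first last.
  apply/eqP => z0; have := def_z (size mu).-1; rewrite z0 rmorph0 => /eqP.
  by rewrite -lead_coefE lead_coef_eq0 (negPf (monic_neq0 monmu)).
rewrite -(inj_eq inj) -def_z rmorph1 -lead_coefE; exact: monmu.
Qed.
End Gauss.

Local Notation toF := (@tofrac _).

(** An almost integral fraction a / b has mlead b | mlead a, by comparing the
    leading exponents of c a^n = b^n d for all n.  So the leading term of a can
    be divided off, and the leading exponent decreases. *)
Lemma mpoly_completely_integrally_closed (k : fieldType) n : completely_integrally_closed {mpoly k[n]}.
Proof.
move=> x [c nz_c cx].
have [b nz_b [a bx]] := frac_denom x.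
elim/mleadrect: a => a IHa in x cx bx *.
have inj := @tofrac_eq {mpoly k[n]}.
have nz_toF (p : {mpoly k[n]}) : p != 0 -> toF p != 0 by rewrite tofrac_eq0.
have [a0|nz_a] := eqVneq a 0.
  exists 0; apply: (mulfI (nz_toF b nz_b)).
  by rewrite bx a0 rmorph0 mulr0.
have le_ba : (mlead b <= mlead a)%MM.
  apply/mnm_lepP => i; rewrite leqNgt; apply/negP => lt_ab.
  pose m := (mlead c i).+1; have [d] := cx m.
  move/(congr1 (fun y => toF b ^+ m * y)); rewrite mulrCA -exprMn bx.
  rewrite -!rmorphXn -!rmorphM => /eqP; rewrite inj => /eqP def_ca.
  have nz_d : d != 0.
    apply/eqP => d0; move/eqP: def_ca; rewrite d0 mulr0 mulf_eq0 (negPf nz_c).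
    by rewrite expf_eq0 (negPf nz_a) andbF.
  have /(congr1 (fun p => mlead p i)) := def_ca.
  rewrite !mleadM ?expf_neq0 // !mleadX // !mnmDE !mulmnE => eq_m.
  have: (mlead c i + mlead a i * m < mlead c i + mlead a i * m)%N.
    rewrite {2}eq_m; apply: leq_trans (leq_addr _ _).
    apply: leq_trans (leq_mul lt_ab (leqnn m)).
    by rewrite mulSn ltn_add2r /m.
  by rewrite ltnn.
pose q := (mleadc a / mleadc b) *: 'X_[mlead a - mlead b] : {mpoly k[n]}.
have nz_r : mleadc a / mleadc b != 0.
  by rewrite mulf_neq0 ?invr_neq0 // mleadc_eq0.
have nz_q : q != 0 by rewrite -mleadc_eq0 mleadcZE mleadXm mcoeffX eqxx mulr1.
have lead_q : mlead q = (mlead a - mlead b)%MM by rewrite mleadZ // mleadXm.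
have lead_bq : mlead (b * q) = mlead a.
  by rewrite mleadM // lead_q addmC submK.
have coef_bq : (b * q)@_(mlead a) = mleadc a.
  rewrite -{1}lead_bq mleadM // mleadcM mulrC mleadcZE mleadXm mcoeffX eqxx.
  by rewrite mulr1 divfK // mleadc_eq0.
have cxq m l : in_dom (toF c * (x ^+ l * (x - toF q) ^+ m)).
  elim: m l => [|m IHm] l; first by rewrite expr0 mulr1.
  rewrite exprS mulrBl mulrBr mulrBr; apply: in_domB.
    by rewrite (mulrA _ x) -exprSr.
  rewrite (mulrCA _ (toF q)) (mulrCA _ (toF q)).
  exact: in_domM (in_dom_id _) (IHm l).
have bxq : toF b * (x - toF q) = toF (a - b * q).
  by rewrite mulrBr bx !rmorphB rmorphM.
suff: in_dom (x - toF q).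
  by move=> ixq; rewrite -(subrK (toF q) x); apply: in_domD (in_dom_id _).
have [a0|nz_a'] := eqVneq (a - b * q) 0.
  exists 0; apply: (mulfI (nz_toF b nz_b)).
  by rewrite bxq a0 rmorph0 mulr0.
apply: (IHa (a - b * q)) => //; last first.
  by move=> m; have := cxq m 0%N; rewrite expr0 mul1r.
(* b q has the leading term of a, so the difference has a smaller exponent. *)
rewrite lt_neqAle; apply/andP; split; last first.
  by rewrite (le_trans (mleadB_le _ _)) // lead_bq joinxx.
apply/eqP => eq_lead; move: nz_a'; rewrite -mleadc_eq0 eq_lead mcoeffB coef_bq.
by rewrite subrr eqxx.
Qed.

(** * Noether normalization *)

Section MpolyMorphism.
Variables (k : fieldType) (n : nat) (S : comNzRingType).

Lemma rmorph_mpoly (f : {rmorphism {mpoly k[n]} -> S}) p :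
  f p = mmap (f \o @mpolyC n k) (fun i => f 'X_i) p.
Proof.
rewrite [in LHS](mpolyE p) rmorph_sum; apply: eq_bigr => m _ /=.
rewrite -mul_mpolyC rmorphM mpolyXE_id rmorph_prod; congr (_ * _).
by apply: eq_bigr => i _; rewrite rmorphXn.
Qed.

Lemma eq_mmap (f g : k -> S) (u v : 'I_n -> S) p :
  f =1 g -> u =1 v -> mmap f u p = mmap g v p.
Proof.
move=> fg uv; apply: eq_bigr => m _; rewrite fg; congr (_ * _).
exact: mmap1_eq.
Qed.

Lemma eq_rmorph_mpoly (f g : {rmorphism {mpoly k[n]} -> S}) :
    (forall c, f c%:MP = g c%:MP) -> (forall i, f 'X_i = g 'X_i) -> f =1 g.
Proof.
by move=> fgC fgX p; rewrite [LHS]rmorph_mpoly [RHS]rmorph_mpoly; apply: eq_mmap.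
Qed.

End MpolyMorphism.

Lemma mmapXU (k : fieldType) n (S : comNzRingType) (f : {rmorphism k -> S})
  (u : 'I_n -> S) i : mmap f u 'X_i = u i.
Proof. by rewrite mmapX mmap1U. Qed.

Lemma mmap_comp (k : fieldType) m n (S : comNzRingType) (f : {rmorphism k -> S})
    (u : 'I_n -> S) (v : 'I_m -> {mpoly k[n]}) p :
  mmap f u (mmap (@mpolyC n k) v p) = mmap f (fun i => mmap f u (v i)) p.
Proof.
apply: (@eq_rmorph_mpoly k m S (mmap f u \o mmap (@mpolyC n k) v)) => [c|i] /=.
  by rewrite !mmapC.
by rewrite !mmapXU.
Qed.

Lemma rmorph_mmap (k : fieldType) n (S T : comNzRingType) (g : {rmorphism S -> T})
    (f : {rmorphism k -> S}) (u : 'I_n -> S) p :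
  g (mmap f u p) = mmap (g \o f) (g \o u) p.
Proof.
apply: (@eq_rmorph_mpoly k n T (g \o mmap f u)) => [c|i] /=.
  by rewrite !mmapC.
by rewrite !mmapXU.
Qed.

Section TopCoef.
Variable R : comNzRingType.

Definition top_coef (q : {poly R}) d e := (size q <= d.+1)%N /\ q`_d = e.

Lemma top_coefM q q' d d' e e' :
  top_coef q d e -> top_coef q' d' e' -> top_coef (q * q') (d + d') (e * e').
Proof.
move=> [sq <-] [sq' <-]; split.
  rewrite (leq_trans (size_polyMleq _ _)) // -subn1 leq_subLR.
  by rewrite (leq_trans (leq_add sq sq')) // addSn addnS add1n.
have ltd : (d < (d + d').+1)%N by rewrite ltnS leq_addr.
rewrite coefM (bigD1 (Ordinal ltd)) //= addKn big1 ?addr0 // => i ne_id.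
have [lt_id|lt_di|eq_id] := ltngtP i d.
- rewrite [q'`__]nth_default ?mulr0 // (leq_trans sq') // ltn_subRL.
  by rewrite ltn_add2r.
- by rewrite nth_default ?mul0r // (leq_trans sq).
- by case/eqP: ne_id; apply: val_inj.
Qed.

Lemma top_coefX q d e m : top_coef q d e -> top_coef (q ^+ m) (d * m) (e ^+ m).
Proof.
move=> tq; elim: m => [|m IHm]; first by rewrite muln0; split; rewrite ?size_poly1 ?coef1.
by rewrite !exprS mulnS; apply: top_coefM.
Qed.

Lemma top_coef_prod n (q : 'I_n -> {poly R}) (d : 'I_n -> nat) (e : 'I_n -> R) :
    (forall i, top_coef (q i) (d i) (e i)) ->
  top_coef (\prod_i q i) (\sum_i d i) (\prod_i e i).
Proof.
move=> tq; apply: (big_ind3 (@top_coef)) => // [|*]; last exact: top_coefM.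
by split; rewrite ?size_poly1 ?coef1.
Qed.

End TopCoef.

Section IntegralPoly.
Variables (R K : comNzRingType) (f : {rmorphism R -> K}).
Definition int_poly (p : {poly K}) := forall i, integralOver f p`_i.

Lemma int_polyC c : integralOver f c -> int_poly c%:P.
Proof. by move=> ic i; rewrite coefC; case: ifP => _ //; exact: integral0. Qed.
Lemma int_polyX : int_poly 'X.
Proof. by move=> i; rewrite coefX; exact: integral_nat. Qed.
Lemma int_polyD p q : int_poly p -> int_poly q -> int_poly (p + q).
Proof. by move=> ip iq i; rewrite coefD; exact: integral_add. Qed.
Lemma integral_sum (I : Type) (s : seq I) (P : pred I) (F : I -> K) :
  (forall i, P i -> integralOver f (F i)) ->
  integralOver f (\sum_(i <- s | P i) F i).
Proof.
by move=> iF; elim/big_rec: _ => [|i x /iF]; [exact: integral0 | exact: integral_add].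
Qed.
Lemma int_polyM p q : int_poly p -> int_poly q -> int_poly (p * q).
Proof.
by move=> ip iq i; rewrite coefM; apply: integral_sum => j _; exact: integral_mul.
Qed.
Lemma int_poly_mmap (k : fieldType) n (h : {rmorphism k -> {poly K}})
    (u : 'I_n -> {poly K}) p :
    (forall c, int_poly (h c)) -> (forall i, int_poly (u i)) ->
  int_poly (mmap h u p).
Proof.
have int1 : int_poly 1 by rewrite -polyC1; apply/int_polyC/integral1.
move=> ih iu; rewrite /mmap; elim/big_rec: _ => [|m x _ ix].
  by rewrite -polyC0; apply/int_polyC/integral0.
apply: int_polyD ix; apply: int_polyM (ih _) _.
rewrite /mmap1; elim/big_rec: _ => [//|i z _ iz]; apply: int_polyM iz.
elim: (m i) => [//|l IHl]; rewrite exprS; exact: int_polyM (iu i) IHl.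
Qed.
End IntegralPoly.

(** If the y_i satisfy p = 0 and the leading form of p does not vanish at c, then
    along the direction c the relation p is an equation of integral dependence
    of y_last over the elements y_i - (c_i / c_last) y_last. *)
Lemma noether_normalization (k : closedFieldType) (L : fieldType)
    (iota : {rmorphism k -> L}) M (y : 'I_M -> L) :
  exists d (zeta : 'I_d -> {mpoly k[M]}),
    let z i := mmap iota y (zeta i) in
    (forall p : {mpoly k[d]}, mmap iota z p = 0 -> p = 0) /\
    (forall i, integralOver (mmap iota z) (y i)).
Proof.
elim: M => [|M IHM] in y *.
  exists 0%N, (fun=> 0) => z; split=> [p|[]//].
  rewrite [p]nvar0_mpolyC mmapC => /eqP; rewrite fmorph_eq0 => /eqP ->.
  exact: mpolyC0.
have [indep|] := pselect (forall p, mmap iota y p = 0 -> p = 0).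
  exists M.+1, (fun i => 'X_i) => z.
  have zy p : mmap iota z p = mmap iota y p.
    by apply: eq_mmap => // i; rewrite /z mmapXU.
  split=> [p|i]; first by rewrite zy; exact: indep.
  have [P monP P0] := integral_id (mmap iota z) 'X_i.
  by exists P; rewrite // -[y i](mmapXU iota y) -zy.
move/existsNP=> [p /not_implyP[py0 /eqP nz_p]].
pose D := (msize p).-1.
(* The leading form of p.  The factor X_last below forces c_last <> 0. *)
pose pD := \sum_(m <- msupp p | mdeg m == D) p@_m *: 'X_[m] : {mpoly k[M.+1]}.
have nz_pD : pD != 0.
  apply/eqP => /(congr1 (mcoeff (mlead p))); rewrite mcoeff0 raddf_sum /=.
  rewrite -big_filter (bigD1_seq (mlead p)) ?filter_uniq ?msupp_uniq //=; last first.
    by rewrite mem_filter mlead_supp // /D -mlead_deg //= eqxx.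
  rewrite mcoeffZ mcoeffX eqxx mulr1 big1 => [|m ne_m]; last first.
    by rewrite mcoeffZ mcoeffX (negPf ne_m) mulr0.
  by move/eqP; rewrite addr0 mleadc_eq0 (negPf nz_p).
have [c] : exists c, (pD * 'X_ord_max).@[c] != 0.
  by apply: mpoly_nonroot; rewrite mulf_neq0 // -msize_poly_eq0 msizeX.
rewrite mevalM mevalXU mulf_eq0 negb_or => /andP[pDc nz_c].
pose tau := y ord_max / iota (c ord_max).
pose a i := y i - iota (c i) * tau.
have nz_ic : iota (c ord_max) != 0 by rewrite fmorph_eq0.
have a_max : a ord_max = 0 by rewrite /a /tau mulrC divfK ?subrr.
pose r (i : 'I_M) : {mpoly k[M.+1]} :=
  'X_(lift ord_max i) - (c (lift ord_max i) / c ord_max) *: 'X_ord_max.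
have [d [zeta' [indep int_y']]] := IHM (fun i => a (lift ord_max i)).
have ev_r i : mmap iota y (r i) = a (lift ord_max i).
  rewrite /r mmapB mmapZ !mmapXU /a /tau; congr (_ - _).
  by rewrite rmorphM fmorphV mulrAC mulrA.
exists d, (fun i => mmap (@mpolyC _ k) r (zeta' i)) => z.
pose z' i := mmap iota (fun j => a (lift ord_max j)) (zeta' i).
have eq_z p' : mmap iota z p' = mmap iota z' p'.
  by apply: eq_mmap => // i; rewrite /z mmap_comp; apply: eq_mmap.
split=> [p'|]; first by rewrite eq_z; exact: indep.
have eq_int x : integralOver (mmap iota z') x -> integralOver (mmap iota z) x.
  by case=> P monP P0; exists P => //; rewrite (eq_map_poly eq_z).
have int_k x : integralOver (mmap iota z) (iota x).
  by rewrite -(mmapC z iota); exact: integral_id.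
have int_a i : integralOver (mmap iota z) (a i).
  case: (unliftP ord_max i) => [j|] ->; first exact/eq_int/int_y'.
  by rewrite a_max; exact: integral0.
(* y_i = a_i + c_i tau, so tau is a root of P(T) = p(a + c T), whose coefficient
   of degree D is the leading form at c. *)
pose lin i := (a i)%:P + (iota (c i))%:P * 'X.
pose P := mmap (polyC \o iota) lin p.
have P_tau : P.[tau] = 0.
  rewrite -[RHS]py0 -horner_evalE (rmorph_mmap (horner_eval tau)).
  apply: eq_mmap => [x|i] /=; rewrite /horner_eval ?hornerC //.
  by rewrite /lin hornerD hornerM !hornerC hornerX /a subrK.
have int_P : int_poly (mmap iota z) P.
  apply: int_poly_mmap => [x|i]; first exact/int_polyC/int_k.
  apply: int_polyD; first exact/int_polyC/int_a.
  by apply: int_polyM; [exact/int_polyC/int_k | exact: int_polyX].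
have top_lin i : top_coef (lin i) 1 (iota (c i)).
  split; last by rewrite /lin coefD coefC coefMX coefC add0r.
  rewrite (leq_trans (size_polyD _ _)) // geq_max.
  rewrite (leq_trans (size_polyC_leq1 _)) //=.
  by rewrite mul_polyC (leq_trans (size_scale_leq _ _)) ?size_polyX.
have top_m m : top_coef ((polyC \o iota) p@_m * mmap1 lin m) (mdeg m)
    (iota (p@_m * \prod_i c i ^+ m i)).
  rewrite rmorphM -[mdeg m]add0n; apply: top_coefM.
    by split; rewrite ?coefC // size_polyC_leq1.
  rewrite mdegE rmorph_prod; apply: top_coef_prod => i.
  by rewrite rmorphXn; have := top_coefX (m i) (top_lin i); rewrite mul1n.
have [sP coefP] : top_coef P D (iota pD.@[c]).
  have le_m m : m \in msupp p -> (mdeg m <= D)%N.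
    by move/msize_mdeg_lt; rewrite /D; case: (msize p).
  split.
    rewrite (leq_trans (size_sum _ _ _)) //; apply/bigmax_leqP_seq => m mp _.
    by case: (top_m m) => sm _; rewrite (leq_trans sm) // ltnS le_m.
  have -> : pD.@[c] = \sum_(m <- msupp p | mdeg m == D) p@_m * \prod_i c i ^+ m i.
    by rewrite raddf_sum; apply: eq_bigr => m _ /=; rewrite mevalZ mevalX.
  rewrite /P /mmap coef_sum rmorph_sum /= [RHS]big_mkcond big_seq [RHS]big_seq.
  apply: eq_bigr => m mp; case: (top_m m) => sm cm; case: eqP => [<-|ne_m].
    by rewrite -cm.
  rewrite nth_default // (leq_trans sm) // ltn_neqAle le_m // andbT.
  exact/eqP.
have nz_pDc : iota pD.@[c] != 0 by rewrite fmorph_eq0.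
have size_P : size P = D.+1.
  apply/eqP; rewrite eqn_leq sP ltnNge; apply: contra nz_pDc.
  by move/(nth_default 0) <-; rewrite coefP.
have int_tau : integralOver (mmap iota z) tau.
  apply: (@integral_root_monic _ _ _ _ ((iota pD.@[c])^-1 *: P)).
  - by rewrite monicE lead_coefZ lead_coefE size_P coefP mulVf.
  - by rewrite rootE hornerZ P_tau mulr0.
  - apply/integral_poly => i; rewrite coefZ; apply: integral_mul (int_P i).
    by rewrite -fmorphV; exact: int_k.
move=> i; rewrite -[y i](subrK (iota (c i) * tau)); apply: integral_add (int_a i) _.
exact: integral_mul (int_k _) int_tau.
Qed.

(** * Going down *)

Section IntegralMinpoly.
Variables (k : closedFieldType) (Z : idomainType) (i0 : {rmorphism k -> Z}).
Hypothesis Zcic : completely_integrally_closed Z.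
Variables (L : fieldType) (f : {rmorphism Z -> L}).
Hypothesis f_inj : forall z, f z = 0 -> z = 0.

Lemma min_size_root u :
    (exists2 p : {poly Z}, p != 0 & root (map_poly f p) u) ->
  exists p : {poly Z}, [/\ p != 0, root (map_poly f p) u &
    forall q, root (map_poly f q) u -> (size q < size p)%N -> q = 0].
Proof.
pose P n := `[< exists p : {poly Z}, [/\ p != 0, root (map_poly f p) u & size p = n] >].
move=> [p nz_p pu]; have ex : exists n, P n.
  by exists (size p); apply/asboolP; exists p.
have [n /asboolP[{nz_p pu}p [nz_p pu <-]] min_p] := ex_minnP ex.
exists p; split=> // q qu lt_qp; apply/eqP; apply: contraTT lt_qp => nz_q.
by rewrite -leqNgt; apply: min_p; apply/asboolP; exists q.
Qed.

(** By pseudo-division, a relation p of least degree divides every other relation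
    over the fractions; Gauss's lemma then makes p monic over Z. *)
Lemma integral_minpoly u : integralOver f u ->
  exists nu : {poly Z}, [/\ nu \is monic, root (map_poly f nu) u &
    forall G, root (map_poly f G) u -> exists q, G = q * nu].
Proof.
move=> [G monG Gu].
have [|p [nz_p pu min_p]] := @min_size_root u.
  by exists G => //; apply: monic_neq0.
have inj := @tofrac_eq0 Z.
have lead_p : @tofrac Z (lead_coef p) != 0 by rewrite inj lead_coef_eq0.
pose mu := (tofrac (lead_coef p))^-1 *: map_poly (@tofrac Z) p.
have mon_mu : mu \is monic.
  rewrite monicE lead_coefZ lead_coef_map_inj ?rmorph0 ?mulVf //.
  by move=> x y /eqP; rewrite tofrac_eq => /eqP.
have muG : mu %| map_poly (@tofrac Z) G.
  have := Pdiv.Idomain.divp_eq G p; set c := lead_coef p ^+ _ => eqG.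
  have rem0 : Pdiv.Idomain.modp G p = 0.
    apply: min_p; last by rewrite Pdiv.Idomain.ltn_modp.
    have /(congr1 (fun q => (map_poly f q).[u])) := eqG.
    rewrite linearZ /= hornerZ (rootP Gu) mulr0 rmorphD rmorphM /= hornerD hornerM.
    by rewrite (rootP pu) mulr0 add0r => /esym/rootP.
  have nz_c : @tofrac Z c != 0 by rewrite inj expf_neq0 // lead_coef_eq0.
  rewrite -(dvdpZr _ _ nz_c) -(map_polyZ (@tofrac Z)) eqG rem0 addr0 rmorphM /=.
  by rewrite /mu dvdpZl ?invr_eq0 // dvdp_mull.
have [nu mon_nu def_mu] := gauss_monic i0 Zcic mon_mu monG muG.
have def_p : p = lead_coef p *: nu.
  apply: (@map_inj_poly _ _ (@tofrac Z)); rewrite ?rmorph0 //.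
    by move=> x y /eqP; rewrite tofrac_eq => /eqP.
  by rewrite map_polyZ -def_mu /mu scalerA mulfV // scale1r.
have nu_u : root (map_poly f nu) u.
  move: pu; rewrite def_p linearZ /= !rootE hornerZ mulf_eq0 => /orP[|//].
  by move/eqP/f_inj/eqP; rewrite lead_coef_eq0 (negPf nz_p).
exists nu; split=> // H Hu.
exists (Pdiv.Ring.rdivp H nu); rewrite [LHS](Pdiv.RingMonic.rdivp_eq mon_nu).
rewrite (min_p (Pdiv.Ring.rmodp H nu)) ?addr0 //; last first.
  rewrite [in X in (_ < X)%N]def_p size_scale ?lead_coef_eq0 //.
  by rewrite Pdiv.Ring.ltn_rmodpN0 // monic_neq0.
move/rootP: Hu; rewrite {1}(Pdiv.RingMonic.rdivp_eq mon_nu H).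
by rewrite rmorphD rmorphM /= hornerD hornerM (rootP nu_u) mulr0 add0r => /rootP.
Qed.

Lemma size_monic_map (g : {poly Z}) : size (map_poly f g) = size g.
Proof.
rewrite size_map_inj_poly ?rmorph0 // => x y /eqP; rewrite -subr_eq0 -rmorphB.
by move/eqP/f_inj/eqP; rewrite subr_eq0 => /eqP.
Qed.

(** For w = u h the minimal polynomials satisfy mu_w(T) = h^r mu_u(T/h).  The
    image of mu_w under lam divides that of chi, so it is a power of T: lam
    kills the lower coefficients h^(r-j) mu_u,j of mu_w, hence those of mu_u. *)
Lemma minpoly_mod_prime (D : idomainType) (lam : {rmorphism Z -> D}) u h chi m :
    integralOver f u -> lam h != 0 ->
    chi \is monic -> root (map_poly f chi) (u * f h) ->
    map_poly lam chi = 'X^m ->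
  exists nu : {poly Z}, root (map_poly f nu) u /\
    exists r, map_poly lam nu = 'X^r.
Proof.
move=> int_u nz_lh mon_chi chi_w lam_chi.
have nz_h : h != 0 by apply: contraNneq nz_lh => ->; rewrite rmorph0.
have [nu [mon_nu nu_u min_nu]] := integral_minpoly int_u.
have [|nu' [mon_nu' nu'_w min_nu']] := @integral_minpoly (u * f h).
  by exists chi.
pose r := (size nu).-1.
have size_nu : size nu = r.+1 by rewrite prednK // size_poly_gt0 monic_neq0.
pose nuw := \poly_(j < r.+1) (h ^+ (r - j) * nu`_j).
have coef_nuw j : nuw`_j = if (j < r.+1)%N then h ^+ (r - j) * nu`_j else 0.
  by rewrite coef_poly.
have nu_r : nu`_r = 1 by move: mon_nu; rewrite monicE lead_coefE size_nu => /eqP.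
have size_nuw : size nuw = r.+1.
  by rewrite size_poly_eq // subnn expr0 mul1r nu_r oner_neq0.
have mon_nuw : nuw \is monic.
  by rewrite monicE lead_coefE size_nuw coef_nuw ltnSn subnn expr0 mul1r nu_r.
have nuw_w : root (map_poly f nuw) (u * f h).
  rewrite rootE; apply/eqP; have:= rootP nu_u => /(congr1 (fun x => f h ^+ r * x)).
  rewrite mulr0 => <-; rewrite !horner_coef !size_monic_map size_nuw size_nu.
  rewrite mulr_sumr; apply: eq_bigr => j _.
  rewrite !coef_map /= coef_nuw ltn_ord rmorphM rmorphXn exprMn /=.
  have -> : f h ^+ r = f h ^+ (r - j) * f h ^+ j by rewrite -exprD subnK // -ltnS.
  by move: (f h ^+ _) (f h ^+ j) (u ^+ j) => x y z; ring.
have [q nuw_q] := min_nu' _ nuw_w.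
pose r' := (size nu').-1.
have size_nu' : size nu' = r'.+1 by rewrite prednK // size_poly_gt0 monic_neq0.
(* mu_w(h T) is a relation of u, so mu_w has at least the degree of mu_u. *)
have le_rr' : (r <= r')%N.
  pose g := \poly_(j < r'.+1) (h ^+ j * nu'`_j).
  have size_g : size g = r'.+1.
    rewrite size_poly_eq // mulf_neq0 ?expf_neq0 //.
    by have := monic_neq0 mon_nu'; rewrite -lead_coef_eq0 lead_coefE size_nu'.
  have [|q' def_g] := min_nu g.
    rewrite rootE; apply/eqP; rewrite -[RHS](rootP nu'_w).
    rewrite !horner_coef !size_monic_map size_g size_nu'.
    apply: eq_bigr => j _; rewrite !coef_map /= coef_poly ltn_ord rmorphM rmorphXn.
    by rewrite exprMn /=; move: (f h ^+ j) (u ^+ j) => x y; ring.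
  have: (size nu <= size g)%N.
    rewrite def_g size_Mmonic //; last first.
      by apply/eqP => q0; move: size_g; rewrite def_g q0 mul0r size_poly0.
    rewrite size_nu addnS /= -add1n leq_add2r.
    rewrite size_poly_gt0; apply/eqP => q0.
    by move: size_g; rewrite def_g q0 mul0r size_poly0.
  by rewrite size_nu size_g.
have nuw_nu' : nuw = nu'.
  have q_mon : q \is monic by rewrite -(monicMr _ mon_nu') -nuw_q.
  have size_q : size q = 1%N.
    have /eqP := size_Mmonic (monic_neq0 q_mon) mon_nu'.
    rewrite -nuw_q size_nuw size_nu' addnS /= => /eqP size_q.
    apply/eqP; rewrite eqn_leq size_poly_gt0 monic_neq0 // andbT.
    by rewrite -(leq_add2r r') -size_q add1n ltnS.
  move: q_mon; rewrite nuw_q (size1_polyC (eq_leq size_q)) monicE lead_coefC.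
  by move/eqP ->; rewrite mul1r.
have [q' chi_q] := min_nu' _ chi_w.
have lam_nuw_mon : map_poly lam nuw \is monic by apply: monic_map.
have [m' lam_nuw] : exists m', map_poly lam nuw = 'X^m'.
  have: map_poly lam nuw %| ('X - 0%:P) ^+ m.
    rewrite polyC0 subr0 -lam_chi chi_q nuw_nu' rmorphM.
    by apply: dvdp_mull.
  case/dvdp_exp_XsubCP=> m' _; rewrite polyC0 subr0 eqp_monic ?monicXn //.
  by move/eqP; exists m'.
have coef_lam j : lam (nuw`_j) = (j == m')%:R.
  by rewrite -coef_map lam_nuw coefXn.
have def_m' : m' = r.
  have := coef_lam r; rewrite coef_nuw ltnSn subnn expr0 mul1r nu_r rmorph1.
  by case: eqP => // _ /eqP; rewrite oner_eq0.
exists nu; split=> //; exists r.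
apply/polyP=> j; rewrite coef_map coefXn /=.
have := coef_lam j; rewrite coef_nuw def_m' ltnS.
have [lt_jr|lt_rj|->] := ltngtP j r.
- rewrite rmorphM rmorphXn => /eqP; rewrite mulf_eq0 expf_eq0 (negPf nz_lh) andbF.
  by move/eqP.
- by rewrite nth_default ?rmorph0 // size_nu.
- by rewrite subnn expr0 mul1r.
Qed.
End IntegralMinpoly.

Section PowerSpan.
Variables (Z : idomainType) (L : comNzRingType) (f : {rmorphism Z -> L}).

Lemma integral_power_span x : integralOver f x ->
  exists n, forall N, (n <= N)%N -> forall l, exists c : 'I_N -> Z,
    x ^+ l = \sum_j f (c j) * x ^+ j.
Proof.
move=> [G monG Gx]; exists (size G) => N le_GN l.
pose R := Pdiv.Ring.rmodp ('X^l) G.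
have ltR : (size R < size G)%N by rewrite Pdiv.Ring.ltn_rmodpN0 // monic_neq0.
exists (fun j => R`_j).
have /(congr1 (fun p => (map_poly f p).[x])) :=
  Pdiv.RingMonic.rdivp_eq monG ('X^l).
rewrite map_polyXn hornerXn => ->; rewrite rmorphD rmorphM /= hornerD hornerM.
rewrite (rootP Gx) mulr0 add0r.
rewrite (@horner_coef_wide _ N); first by apply: eq_bigr => j _; rewrite coef_map.
by rewrite (leq_trans (size_poly _ _)) // (leq_trans (ltnW ltR)).
Qed.

End PowerSpan.

(** The monomials of bounded exponents in the X_i span, each power of X_i being
    reducible by the equation of X_i. *)
Lemma finite_span (Z : idomainType) (k : fieldType) M (L : comNzRingType)
    (zeta : {rmorphism Z -> {mpoly k[M]}}) (ev : {rmorphism {mpoly k[M]} -> L}) :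
    (forall c, exists z, zeta z = c%:MP) ->
    (forall i, integralOver (ev \o zeta) (ev 'X_i)) ->
  exists m (r : 'I_m -> {mpoly k[M]}), forall p, exists c : 'I_m -> Z,
    ev p = \sum_l ev (zeta (c l) * r l).
Proof.
move=> zetaC int_ev.
have /choice[n Hn] := fun i => integral_power_span (int_ev i).
pose N := (\max_i n i)%N; pose T := {ffun 'I_M -> 'I_N}.
pose s (e : T) : {mpoly k[M]} := \prod_i 'X_i ^+ e i.
suff span p : exists c : T -> Z, ev p = \sum_e ev (zeta (c e) * s e).
  exists #|{: T}|, (fun l => s (enum_val l)) => p; have [c ->] := span p.
  exists (fun l => c (enum_val l)).
  by rewrite (reindex _ (onW_bij _ (@enum_val_bij T))).
elim/mpolyind: p => [|a m p _ _ [c IHp]].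
  exists (fun=> 0); rewrite rmorph0 big1 // => e _.
  by rewrite rmorph0 mul0r rmorph0.
have [z def_a] := zetaC a.
have /choice[b Hb] := fun i => Hn i N (leq_bigmax i) (m i).
exists (fun e : T => z * \prod_i b i (e i) + c e).
rewrite rmorphD IHp -mul_mpolyC rmorphM mpolyXE_id rmorph_prod /=.
under eq_bigr => i _ do rewrite rmorphXn Hb.
rewrite bigA_distr_bigA mulr_sumr -big_split; apply: eq_bigr => e _ /=.
rewrite raddfD /= mulrDl raddfD /= -def_a !rmorphM /= -mulrA.
congr (_ * _ + _); rewrite big_split /= /s !rmorph_prod; congr (_ * _).
by apply: eq_bigr => i _; rewrite rmorphXn.
Qed.

Section GoingDown.
Variables (k : closedFieldType) (Z : idomainType) (i0 : {rmorphism k -> Z}).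
Hypothesis Zcic : completely_integrally_closed Z.
Variables (Y : comNzRingType) (L : fieldType).
Variables (ev : {rmorphism Y -> L}) (zeta : {rmorphism Z -> Y}).
Hypothesis ev_zeta_inj : forall z, ev (zeta z) = 0 -> z = 0.
Variables (m : nat) (r : 'I_m -> Y).
Hypothesis span : forall p, exists c : 'I_m -> Z,
  ev p = \sum_l ev (zeta (c l) * r l).

Let f : {rmorphism Z -> L} := ev \o zeta.

(** The determinant trick: the vector of the ev (r j) is an eigenvector of A for
    the eigenvalue w. *)
Lemma root_span_char_poly w (A : 'M[Z]_m) :
    (forall j, w * ev (r j) = \sum_l f (A l j) * ev (r l)) ->
  root (map_poly f (char_poly A)) w.
Proof.
move=> wr; rewrite map_char_poly -eigenvalue_root_char; apply/eigenvalueP.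
exists (\row_j ev (r j)).
  apply/rowP=> j; rewrite !mxE wr; apply: eq_bigr => l _.
  by rewrite !mxE mulrC.
apply/eqP => /rowP r0; have [c] := span 1; rewrite rmorph1 big1 => [/eqP|l _].
  by rewrite oner_eq0.
by rewrite rmorphM; have := r0 l; rewrite !mxE => ->; rewrite mulr0.
Qed.

Lemma integral_span p : integralOver f (ev p).
Proof.
have /choice[c Hc] := fun j => span (p * r j).
exists (char_poly (\matrix_(l, j) c j l)); first exact: char_poly_monic.
apply: root_span_char_poly => j; rewrite -rmorphM Hc; apply: eq_bigr => l _.
by rewrite !mxE rmorphM.
Qed.

Variables (D : idomainType) (lam : {rmorphism Z -> D}).
Variables (phi : {rmorphism Y -> k}) (eps : {rmorphism D -> k}).
Hypothesis phi_zeta : forall z, phi (zeta z) = eps (lam z).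
Hypothesis phi_ker : forall p, ev p = 0 -> phi p = 0.

(** Let P be the kernel of lam.  An element w of the extension of P satisfies a
    monic equation congruent to a power of T modulo P, by the determinant trick.
    For w = u h with h outside P this passes to the minimal equation of u; the
    point phi lies on the zero set of P, so it sends u to a nilpotent element. *)
Lemma going_down u h N (g : 'I_N -> Z) (s : 'I_N -> Y) :
    lam h != 0 -> (forall a, lam (g a) = 0) ->
    ev (u * zeta h) = ev (\sum_a zeta (g a) * s a) ->
  phi u = 0.
Proof.
move=> nz_lh lam_g ev_uh.
have /choice[c Hc] : forall a, exists c : 'I_m -> 'I_m -> Z, forall j,
    ev (s a * r j) = \sum_l ev (zeta (c j l) * r l).
  by move=> a; have /choice[c Hc] := fun j => span (s a * r j); exists c.
pose A := \matrix_(l, j) \sum_a g a * c a j l.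
have [||nu [nu_u [d lam_nu]]] := @minpoly_mod_prime k Z i0 Zcic L f ev_zeta_inj
    D lam (ev u) h (char_poly A) m (integral_span u) nz_lh (char_poly_monic A).
- apply: root_span_char_poly => j; rewrite -rmorphM ev_uh.
  rewrite rmorph_sum mulr_suml.
  under eq_bigr => a _ do rewrite rmorphM -mulrA -rmorphM Hc mulr_sumr.
  rewrite exchange_big; apply: eq_bigr => l _ /=; rewrite mxE !rmorph_sum mulr_suml.
  by apply: eq_bigr => a _; rewrite !rmorphM /= mulrA.
- rewrite map_char_poly (_ : map_mx lam A = 0).
    by rewrite /char_poly /char_poly_mx map_mx0 subr0 det_scalar.
  apply/matrixP => l j; rewrite !mxE rmorph_sum big1 // => a _.
  by rewrite rmorphM lam_g mul0r.
have : phi (map_poly zeta nu).[u] = 0.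
  by apply: phi_ker; rewrite -horner_map -map_poly_comp; apply/rootP.
rewrite -horner_map -map_poly_comp (eq_map_poly (g := eps \o lam)) => [|z].
  2: exact: phi_zeta.
rewrite map_poly_comp lam_nu map_polyXn hornerXn => /eqP.
by rewrite expf_eq0 => /andP[_ /eqP].
Qed.

End GoingDown.

(** * Places and Chevalley's extension theorem *)

(** A k-valued place of E, given by its graph: the valuation ring is the domain. *)
Record place (k : closedFieldType) (E : fieldType) := Place {
  plval :> E -> k -> Prop;
  plB : forall x y a b, plval x a -> plval y b -> plval (x - y) (a - b);
  plM : forall x y a b, plval x a -> plval y b -> plval (x * y) (a * b);
  pl1 : plval 1 1;
  pl_fun0 : forall a, plval 0 a -> a = 0;
  pl_total : forall x, (exists a, plval x a) \/ plval x^-1 0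
}.

Lemma expf_subV (F : fieldType) (x : F) m i :
  x != 0 -> (i <= m)%N -> x ^+ (m - i) = x ^+ m * x^-1 ^+ i.
Proof.
move=> nz_x le_im; rewrite -{2}(subnK le_im) exprD -mulrA -exprMn mulfV //.
by rewrite expr1n mulr1.
Qed.

Section Chevalley.
Local Open Scope classical_set_scope.
Variables (k : closedFieldType) (E : fieldType) (R : comNzRingType).
Variables (c0 : {rmorphism k -> R}) (e : {rmorphism R -> E}).
Variables (phi : {rmorphism R -> k}).
Hypothesis phi_c0 : forall c, phi (c0 c) = c.
Hypothesis phi_ker : forall p, e p = 0 -> phi p = 0.

Record good_graph (G : set (E * k)) : Prop := GoodGraph {
  gg_img : forall p, G (e p, phi p);
  ggB : forall x y a b, G (x, a) -> G (y, b) -> G (x - y, a - b);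
  ggM : forall x y a b, G (x, a) -> G (y, b) -> G (x * y, a * b);
  gg_fun : forall a, G (0, a) -> a = 0
}.

(** Zorn's lemma for bare sets also asks for the union of the empty chain, which
    is why the empty graph is admitted below. *)
Lemma max_good_graph : exists G, good_graph G /\
  forall H, good_graph H -> G `<=` H -> H `<=` G.
Proof.
pose P (G : set (E * k)) := G = set0 \/ good_graph G.
have [F FP totF|A [PA maxA]] := @Zorn_bigcup _ P.
  have [[G0 [FG0 gG0]]|noF] := pselect (exists G, F G /\ good_graph G); last first.
    left; rewrite -subset0 => x [G FG Gx]; case: (FP G FG) => [G0|gG].
      by rewrite -G0.
    by case: noF; exists G.
  right; have common u v : (\bigcup_(X in F) X) u -> (\bigcup_(X in F) X) v ->
      exists G, [/\ F G, good_graph G, G u & G v].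
    move=> [G FG Gu] [H FH Hv].
    have gG : good_graph G by case: (FP G FG) => // G_0; rewrite G_0 in Gu.
    have gH : good_graph H by case: (FP H FH) => // H_0; rewrite H_0 in Hv.
    by case: (totF G H FG FH) => [GH|HG]; [exists H | exists G]; split=> //;
      [apply: GH | apply: HG].
  split=> [p|x y a b Ux Uy|x y a b Ux Uy|a [G FG G0a]].
  - by exists G0 => //; apply: gg_img.
  - by have [G [FG gG Gx Gy]] := common _ _ Ux Uy; exists G => //; apply: ggB.
  - by have [G [FG gG Gx Gy]] := common _ _ Ux Uy; exists G => //; apply: ggM.
  - case: (FP G FG) => [G_0|gG]; first by rewrite G_0 in G0a.
    exact: (gg_fun gG G0a).
have gA : good_graph A.
  case: PA => // A0.
  pose G := [set u | exists p, u = (e p, phi p)].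
  case: (maxA G); last first.
    right; split=> [p|x y a b [p [-> ->]] [q [-> ->]]|
      x y a b [p [-> ->]] [q [-> ->]]|a [p [/esym p0 ->]]].
    - by exists p.
    - by exists (p - q); rewrite !rmorphB.
    - by exists (p * q); rewrite !rmorphM.
    - exact: phi_ker.
  rewrite A0; split; first exact: sub0set.
  by move=> /(_ (e 1, phi 1)); apply; exists 1.
exists A; split=> // H gH AH; apply: contrapT => nHA.
by apply: (maxA H); [split | right].
Qed.

Section MaxGraph.
Variable A : set (E * k).
Hypothesis gA : good_graph A.
Hypothesis maxA : forall H, good_graph H -> A `<=` H -> H `<=` A.

Definition lifts (f : {poly E}) (g : {poly k}) := forall i, A (f`_i, g`_i).

Lemma gg0 : A (0, 0).
Proof. by have := gg_img gA 0; rewrite !rmorph0. Qed.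
Lemma ggD x y a b : A (x, a) -> A (y, b) -> A (x + y, a + b).
Proof.
move=> Ax Ay; rewrite -[y]opprK -[b]opprK -(add0r (- y)) -(add0r (- b)).
by apply: (ggB gA Ax); apply: (ggB gA gg0 Ay).
Qed.
Lemma gg_sum (I : finType) (x : I -> E) (a : I -> k) :
  (forall i, A (x i, a i)) -> A (\sum_i x i, \sum_i a i).
Proof.
move=> Axa; pose K x a := A (x, a).
by apply: (big_ind2 K); [exact: gg0 | move=> *; exact: ggD | move=> *; exact: Axa].
Qed.
Lemma gg_c c : A (e (c0 c), c).
Proof. by have := gg_img gA (c0 c); rewrite phi_c0. Qed.

Lemma liftsB f g f' g' : lifts f g -> lifts f' g' -> lifts (f - f') (g - g').
Proof. by move=> fg fg' i; rewrite !coefB; apply: ggB. Qed.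
Lemma liftsM f g f' g' : lifts f g -> lifts f' g' -> lifts (f * f') (g * g').
Proof.
by move=> fg fg' i; rewrite !coefM; apply: gg_sum => j; apply: ggM.
Qed.
Lemma lifts_C x a : A (x, a) -> lifts x%:P a%:P.
Proof. by move=> Ax i; rewrite !coefC; case: ifP => _ //; exact: gg0. Qed.
Lemma lifts_X : lifts 'X 'X.
Proof.
move=> i; rewrite !coefX; case: eqP => _; last exact: gg0.
by have := gg_img gA 1; rewrite !rmorph1.
Qed.
Lemma lifts_k (g : {poly k}) : lifts (map_poly (e \o c0) g) g.
Proof. by move=> i; rewrite coef_map; exact: gg_c. Qed.

(** Unless the relations of x over the valuation ring generate the unit ideal
    of k[T], they have a common root c, and x |-> c extends the place. *)
Lemma extend_place x :
  (exists a, A (x, a)) \/ exists2 f, lifts f 1 & f.[x] = 0.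
Proof.
pose I g := exists2 f, lifts f g & f.[x] = 0.
have [I1|nI1] := pselect (I 1); [by right | left].
have IB g h : I g -> I h -> I (g - h).
  move=> [f fg fx] [f' fh f'x]; exists (f - f'); first exact: liftsB.
  by rewrite hornerD hornerN fx f'x subrr.
have IM q g : I g -> I (q * g).
  move=> [f fg fx]; exists (map_poly (e \o c0) q * f).
    exact: liftsM (lifts_k q) fg.
  by rewrite hornerM fx mulr0.
have [c Ic] : exists c, forall g, I g -> g.[c] = 0.
  have [I0|] := pselect (forall g, I g -> g = 0).
    by exists 0 => g /I0 ->; rewrite horner0.
  move=> /existsNP[g /not_implyP[Ig /eqP nz_g]].
  pose P n := `[< exists g, [/\ I g, g != 0 & size g = n] >].
  have ex : exists n, P n by exists (size g); apply/asboolP; exists g.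
  have [n /asboolP[{Ig nz_g}g [Ig nz_g size_g]] min_n] := ex_minnP ex.
  have /closed_rootP[c gc] : size g != 1%N.
    apply: contra_notN nI1 => /size_poly1P[a nz_a def_g].
    suff -> : 1 = a^-1%:P * g by apply: IM.
    by rewrite def_g -polyCM mulVf.
  exists c => h Ih; have : I (h %% g).
    have -> : h %% g = h - h %/ g * g by rewrite {2}(divp_eq h g) addrC addKr.
    by apply: IB => //; apply: IM.
  have [h0 _|nz_h Ihg] := eqVneq (h %% g) 0.
    by rewrite (divp_eq h g) h0 addr0 hornerM (rootP gc) mulr0.
  have: (n <= size (h %% g)%R)%N by apply: min_n; apply/asboolP; exists (h %% g).
  by rewrite -size_g leqNgt ltn_modp nz_g.
pose H := [set u | exists f g, [/\ lifts f g, u.1 = f.[x] & u.2 = g.[c]]].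
have gH : good_graph H.
  split=> [p|y z a b [f [g /= [fg -> ->]]] [f' [g' /= [fg' -> ->]]]|
    y z a b [f [g /= [fg -> ->]]] [f' [g' /= [fg' -> ->]]]|
    a [f [g /= [fg fx ->]]]].
  - exists (e p)%:P, (phi p)%:P; rewrite !hornerC; split=> //.
    by apply: lifts_C; apply: gg_img.
  - by exists (f - f'), (g - g'); rewrite !hornerE; split=> //; apply: liftsB.
  - by exists (f * f'), (g * g'); rewrite !hornerE; split=> //; apply: liftsM.
  - by apply: Ic; exists f.
exists c; apply: (maxA gH) => [[y b] Ayb|].
  by exists y%:P, b%:P; rewrite !hornerC; split=> //; apply: lifts_C.
by exists 'X, 'X; rewrite !hornerX; split=> //; apply: lifts_X.
Qed.

Lemma lifts1 f i : lifts f 1 -> A (f`_i, (i == 0%N)%:R).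
Proof. by move=> /(_ i); rewrite coef1. Qed.

(** Eliminating the leading coefficient of the longer relation by means of the
    reversal of the shorter one produces a shorter relation of the same kind. *)
Lemma no_unit_relations n x (f f' : {poly E}) : (size f + size f' < n)%N -> x != 0 ->
  lifts f 1 -> lifts f' 1 -> f.[x] = 0 -> f'.[x^-1] = 0 -> False.
Proof.
elim: n => // n IHn in x f f' *; wlog le_ff' : x f f' / (size f' <= size f)%N.
  move=> hwlog; have [|/ltnW le_ff' lt_n nz_x f1 f'1 fx f'x] := leqP (size f') (size f).
    exact: hwlog.
  by apply: (hwlog x^-1 f' f); rewrite ?invr_eq0 ?invrK // addnC.
move=> lt_n nz_x f1 f'1 fx f'x.
have no_const h : lifts h 1 -> h.[x] = 0 -> (1 < size h)%N.
  move=> h1 hx; rewrite ltnNge; apply/negP => /size1_polyC def_h.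
  have := lifts1 0 h1; move: hx; rewrite def_h hornerC coefC eqxx => -> /(gg_fun gA).
  by move/eqP; rewrite oner_eq0.
have lt1f := no_const f f1 fx.
pose m := (size f).-1; have size_f : size f = m.+1 by rewrite prednK // ltnW.
have m_gt0 : (0 < m)%N by rewrite -ltnS -size_f.
pose g := \poly_(i < m) (f'`_0 * f`_i - f`_m * f'`_(m - i)).
have g1 : lifts g 1.
  move=> i; rewrite coef_poly coef1; have [lt_im|le_mi] := ltnP i m; last first.
    by rewrite gtn_eqF ?(leq_trans m_gt0) //; exact: gg0.
  have := ggB gA (ggM gA (lifts1 0 f'1) (lifts1 i f1))
                 (ggM gA (lifts1 m f1) (lifts1 (m - i) f'1)).
  by rewrite eqxx mul1r (gtn_eqF m_gt0) mul0r subr0.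
have gx : g.[x] = 0.
  have -> : g = f'`_0 *: f - f`_m *: \poly_(i < m.+1) f'`_(m - i).
    apply/polyP=> i; rewrite coefB !coefZ !coef_poly ltnS.
    have [//|lt_mi|->] := ltngtP i m.
      by rewrite [f`_i]nth_default ?size_f // !mulr0 subr0.
    by rewrite subnn mulrC subrr.
  rewrite hornerD hornerN !hornerZ fx mulr0 add0r.
  suff -> : (\poly_(i < m.+1) f'`_(m - i)).[x] = x ^+ m * f'.[x^-1].
    by rewrite f'x !mulr0 oppr0.
  rewrite horner_poly (@horner_coef_wide _ m.+1) -?size_f // mulr_sumr size_f.
  rewrite (reindex_inj rev_ord_inj); apply: eq_bigr => i _ /=.
  rewrite subSS subKn -1?ltnS // mulrCA; congr (_ * _).
  by rewrite expf_subV // -ltnS.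
apply: (IHn x g f') => //; rewrite -ltnS (leq_trans _ lt_n) // !ltnS ltn_add2r.
by rewrite size_f ltnS size_poly.
Qed.

(** If 1/x has a nonzero value a and x satisfies a relation reducing to 1, then the
    relation divided by the power of x of its degree m has value a^m, although
    it is zero. *)
Lemma max_graph_total x : (exists a, A (x, a)) \/ A (x^-1, 0).
Proof.
have [->|nz_x] := eqVneq x 0; first by left; exists 0; exact: gg0.
have [|[f f1 fx]] := extend_place x; [by left|].
have [[a Ax']|[f' f'1 f'x]] := extend_place x^-1; last first.
  by case: (@no_unit_relations (size f + size f').+1 x f f').
have [a0|nz_a] := eqVneq a 0; first by rewrite a0 in Ax'; right.
have ggX l : A (x^-1 ^+ l, a ^+ l).
  elim: l => [|l IHl]; last by rewrite !exprS; apply: ggM.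
  by have := gg_img gA 1; rewrite !rmorph1.
pose m := (size f).-1.
have size_f : (size f <= m.+1)%N by rewrite leqSpred.
have := gg_sum (fun i : 'I_m.+1 => ggM gA (lifts1 i f1) (ggX (m - i)%N)).
rewrite [X in A (_, X)](_ : _ = a ^+ m); last first.
  by rewrite big_ord_recl mul1r subn0 big1 ?addr0 // => i _; rewrite mul0r.
have -> : \sum_(i < m.+1) f`_i * x^-1 ^+ (m - i) = x^-1 ^+ m * f.[x].
  rewrite (horner_coef_wide x size_f) mulr_sumr; apply: eq_bigr => i _.
  by rewrite mulrCA expf_subV ?invr_eq0 ?invrK // -ltnS.
rewrite fx mulr0 => /(gg_fun gA)/eqP.
by rewrite expf_eq0 (negPf nz_a) andbF.
Qed.
End MaxGraph.

(** Since k is algebraically closed, the residue field of a maximal extension is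
    again k, so that places with values in k suffice. *)
Lemma chevalley : exists P : place k E, forall p, P (e p) (phi p).
Proof.
have [A [gA maxA]] := max_good_graph.
have A1 : A (1, 1) by have := gg_img gA 1; rewrite !rmorph1.
exists (@Place k E (fun x a => A (x, a)) (ggB gA) (ggM gA) A1 (gg_fun gA)
  (max_graph_total gA maxA)) => p /=.
exact: gg_img.
Qed.
End Chevalley.

Section PlaceTheory.
Variables (k : closedFieldType) (E : fieldType) (P : place k E).

Lemma pl00 : P 0 0.
Proof. by have := plB (pl1 P) (pl1 P); rewrite !subrr. Qed.
Lemma plN x a : P x a -> P (- x) (- a).
Proof. by move=> Px; have := plB pl00 Px; rewrite !sub0r. Qed.
Lemma plD x y a b : P x a -> P y b -> P (x + y) (a + b).
Proof. by move=> Px /plN Py; have := plB Px Py; rewrite !opprK. Qed.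
Lemma pl_fun x a b : P x a -> P x b -> a = b.
Proof.
move=> Pa Pb; have := plB Pa Pb; rewrite subrr => /pl_fun0/eqP.
by rewrite subr_eq0 => /eqP.
Qed.
Lemma plX x a n : P x a -> P (x ^+ n) (a ^+ n).
Proof.
by move=> Px; elim: n => [|n IHn]; [exact: pl1 | rewrite !exprS; exact: plM].
Qed.
Lemma plV x a : P x a -> a != 0 -> P x^-1 a^-1.
Proof.
move=> Px nz_a; have nz_x : x != 0.
  by apply: contraNneq nz_a => x0; apply/eqP/(@pl_fun0 _ _ P); rewrite -x0.
case: (pl_total P x^-1) => [[b Pb]|]; last first.
  by rewrite invrK => /(pl_fun Px)/eqP; rewrite (negPf nz_a).
have := plM Px Pb; rewrite mulfV // => /(pl_fun (pl1 P)) ab.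
suff -> : a^-1 = b by [].
by apply: (mulfI nz_a); rewrite mulfV.
Qed.
Lemma pl_sum (I : Type) (s : seq I) (C : pred I) (x : I -> E) (a : I -> k) :
  (forall i, C i -> P (x i) (a i)) ->
  P (\sum_(i <- s | C i) x i) (\sum_(i <- s | C i) a i).
Proof.
by move=> Pxa; apply: (big_ind2 P); [exact: pl00 | move=> *; exact: plD | exact: Pxa].
Qed.
End PlaceTheory.

(** * Discrete places and power series expansions *)

Section DiscretePlace.
Variables (k : closedFieldType) (E : fieldType) (P : place k E).
Variables (c : {rmorphism k -> E}) (zeta : E).
Hypothesis Pc : forall a, P (c a) a.
Hypothesis nz_zeta : zeta != 0.
Hypothesis Pzeta : P zeta 0.
Variable r : nat.
Hypothesis dependent : forall x : 'I_r.+1 -> E, exists g : 'I_r.+1 -> {poly k},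
  (exists i, g i != 0) /\ \sum_i (map_poly c (g i)).[zeta] * x i = 0.

Definition vring (x : E) := exists a, P x a.

Lemma vringB x y : vring x -> vring y -> vring (x - y).
Proof. by move=> [a Px] [b Py]; exists (a - b); apply: plB. Qed.
Lemma vringD x y : vring x -> vring y -> vring (x + y).
Proof. by move=> [a Px] [b Py]; exists (a + b); apply: plD. Qed.
Lemma vringM x y : vring x -> vring y -> vring (x * y).
Proof. by move=> [a Px] [b Py]; exists (a * b); apply: plM. Qed.
Lemma vring_c a : vring (c a). Proof. by exists a. Qed.
Lemma vring_horner (p : {poly k}) x : vring x -> vring (map_poly c p).[x].
Proof.
move=> Ox; elim/poly_ind: p => [|p b IHp].
  by rewrite rmorph0 horner0; exists 0; exact: pl00.
rewrite rmorphD rmorphM /= map_polyX map_polyC hornerMXaddC.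
exact: vringD (vringM IHp Ox) (vring_c b).
Qed.

Lemma not_pl10 : ~ P 1 0.
Proof. by move/(pl_fun (pl1 P))/eqP; rewrite oner_eq0. Qed.

Lemma pl_inv0 x : x != 0 -> P x 0 -> ~ vring x^-1.
Proof.
by move=> nz_x Px [a Px']; have := plM Px Px'; rewrite mulfV // mul0r => /not_pl10.
Qed.

Lemma le_total x y : vring (y / x) \/ vring (x / y).
Proof.
case: (pl_total P (y / x)) => [|]; first by left.
by rewrite invf_div; right; exists 0.
Qed.

Lemma min_value (I : eqType) (s : seq I) (t : I -> E) :
    s != [::] -> (forall i, t i != 0) ->
  exists2 i, i \in s & forall j, j \in s -> vring (t j / t i).
Proof.
move=> + nz_t; elim: s => // i s IHs _; case: s => [|j s] in IHs *.
  exists i => [|j]; rewrite inE // => /eqP ->; rewrite mulfV //.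
  by exists 1; exact: pl1.
have [//|l sl minl] := IHs; have [Oil|Oli] := le_total (t l) (t i).
  exists l => [|j']; first by rewrite inE sl orbT.
  by rewrite inE => /predU1P[->//|/minl].
exists i => [|j']; first by rewrite inE eqxx.
rewrite inE => /predU1P[->|/minl Ojl].
  by rewrite mulfV //; exists 1; exact: pl1.
by have := vringM Ojl Oli; rewrite mulrA divfK.
Qed.

(** Factor out of g the largest power of its variable: the cofactor has a nonzero
    constant term, which is its value because zeta has value 0. *)
Lemma horner_zeta (g : {poly k}) : g != 0 ->
  exists n u a, [/\ (map_poly c g).[zeta] = zeta ^+ n * u, P u a & a != 0].
Proof.
move=> nz_g; have [n [q [qP def_g]]] := multiplicity_XsubC g 0.
rewrite nz_g /= in qP; rewrite polyC0 subr0 in def_g.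
exists n, (map_poly c q).[zeta], q.[0]; split=> //.
  by rewrite def_g rmorphM rmorphXn /= map_polyX hornerM hornerXn mulrC.
elim/poly_ind: q {qP def_g} => [|q b _].
  by rewrite rmorph0 !horner0; exact: pl00.
rewrite rmorphD rmorphM /= map_polyX map_polyC !hornerMXaddC mulr0 add0r addrC.
have [a Pa] : vring (map_poly c q).[zeta] by apply: vring_horner; exists 0.
by have := plD (Pc b) (plM Pa Pzeta); rewrite mulr0 addr0.
Qed.

(** Elements whose values are distinct modulo the value of zeta are independent
    over k(zeta): the least term of a relation cannot be cancelled. *)
Lemma distinct_values_indep (x : 'I_r.+1 -> E) :
    (forall i, x i != 0) ->
    (forall i j, i != j -> forall n m a,
       P (zeta ^+ n * x i / (zeta ^+ m * x j)) a -> a = 0) ->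
  False.
Proof.
move=> nz_x distinct; have [g [[i0 nz_i0] sum0]] := dependent x.
have /choice[w Hw] : forall i, exists w : nat * E * k,
    g i != 0 -> [/\ (map_poly c (g i)).[zeta] = zeta ^+ w.1.1 * w.1.2,
      P w.1.2 w.2 & w.2 != 0].
  move=> i; have [->|/horner_zeta[n [u [a Ha]]]] := eqVneq (g i) 0.
    by exists (0%N, 0, 0).
  by exists (n, u, a).
pose t i := if g i != 0 then zeta ^+ (w i).1.1 * (w i).1.2 * x i else 1.
have nz_u i : g i != 0 -> (w i).1.2 != 0.
  case/Hw => _ Pu nz_a; apply: contraNneq nz_a => u0; apply/eqP.
  by move: Pu; rewrite u0 => /pl_fun0.
have nz_t i : t i != 0.
  rewrite /t; case: ifP => [gi|_]; last exact: oner_neq0.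
  by rewrite !mulf_neq0 ?expf_neq0 ?nz_u.
pose s := [seq i <- enum 'I_r.+1 | g i != 0].
have si i : (i \in s) = (g i != 0) by rewrite mem_filter mem_enum andbT.
have [|i gi mini] := min_value (s := s) _ nz_t.
  by apply/eqP => s0; have := si i0; rewrite s0 nz_i0.
rewrite si in gi.
have sum1 : P (\sum_j (map_poly c (g j)).[zeta] * x j / t i) (\sum_j (j == i)%:R).
  apply: pl_sum => j _; have [gj0|gj] := eqVneq (g j) 0.
    rewrite gj0 rmorph0 horner0 !mul0r; case: eqP => [ji|_]; last exact: pl00.
    by rewrite -ji gj0 eqxx in gi.
  have [def_j Puj nz_aj] := Hw j gj; have [def_i Pui nz_ai] := Hw i gi.
  have [->|ne_ji] := eqVneq j i.
    have -> : (map_poly c (g i)).[zeta] * x i = t i by rewrite /t gi def_i.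
    by rewrite mulfV //; exact: pl1.
  have -> : (map_poly c (g j)).[zeta] * x j = t j by rewrite /t gj def_j.
  have [|b Pb] := mini j; first by rewrite si.
  suff b0 : b = 0 by rewrite b0 in Pb.
  have := distinct j i ne_ji (w j).1.1 (w i).1.1 (b * ((w i).2 / (w j).2)).
  have -> : zeta ^+ (w j).1.1 * x j / (zeta ^+ (w i).1.1 * x i) =
      t j / t i * ((w i).1.2 / (w j).1.2).
    rewrite /t gi gj; have := nz_u i gi; have := nz_u j gj; have := nz_x i.
    have : zeta ^+ (w i).1.1 != 0 by apply: expf_neq0.
    move: (zeta ^+ _) (zeta ^+ _) => z z' n1 n2 n3 n4.
    by field; rewrite n1 n2 n3 n4.
  have Puv : P ((w i).1.2 / (w j).1.2) ((w i).2 / (w j).2).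
    by apply: plM => //; apply: plV.
  move/(_ (plM Pb Puv))/eqP; rewrite !mulf_eq0 invr_eq0 (negPf nz_ai) (negPf nz_aj).
  by rewrite !orbF => /eqP.
move: sum1; rewrite -mulr_suml sum0 mul0r => /pl_fun0/eqP.
by rewrite (bigD1 i) //= eqxx big1 ?addr0 ?oner_eq0 // => j /negPf ->.
Qed.

(** The values of the x i lie strictly between 0 and the value of zeta, so they are
    distinct modulo the value of zeta. *)
Lemma chain_bound (x : nat -> E) :
    (forall i, (i <= r)%N -> x i != 0) -> (forall i, (i <= r)%N -> P (x i) 0) ->
    (forall i, (i < r)%N -> P (x i / x i.+1) 0) -> P (zeta / x 0%N) 0 -> False.
Proof.
move=> nz_x Px step Pz0.
have step_lt i j : (i < j)%N -> (j <= r)%N -> P (x i / x j) 0.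
  elim: j => // j IHj; rewrite ltnS leq_eqVlt => /predU1P[->|lt_ij] lt_jr.
    exact: step.
  have := plM (IHj lt_ij (ltnW lt_jr)) (step j lt_jr).
  by rewrite mulrA divfK ?mulr0 // nz_x // ltnW.
have Pz j : (j <= r)%N -> P (zeta / x j) 0.
  case: j => // j lt_jr; have := plM Pz0 (step_lt 0%N j.+1 isT lt_jr).
  by rewrite mulrA divfK ?mulr0 // nz_x.
have lt_case n m i j a : (i <= r)%N -> (j <= r)%N -> (m < n)%N ->
    P (zeta ^+ n * x i / (zeta ^+ m * x j)) a -> a = 0.
  move=> ler_i ler_j lt_mn Pa; apply: (pl_fun Pa).
  have -> : zeta ^+ n * x i / (zeta ^+ m * x j) = zeta ^+ (n - m.+1) * (zeta / x j * x i).
    rewrite -{1}(subnK lt_mn) exprD exprS.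
    have : zeta ^+ m != 0 by apply: expf_neq0.
    move: (zeta ^+ m) (zeta ^+ _) (nz_x j ler_j) => z z' n1 n2.
    by field; rewrite n1 n2.
  by have := plM (plX (n - m.+1) Pzeta) (plM (Pz j ler_j) (Px i ler_i)); rewrite !mulr0.
apply: (@distinct_values_indep (fun i => x i)) => [i|i j ne_ij n m a].
  by rewrite nz_x // -ltnS.
have leri : (i <= r)%N by rewrite -ltnS.
have lerj : (j <= r)%N by rewrite -ltnS.
have [lt_nm|lt_mn|->] := ltngtP n m; last 1 first.
- rewrite -mulf_div mulfV ?expf_neq0 // mul1r => Pa.
  have [lt_ij|lt_ji|eq_ij] := ltngtP i j.
  + exact: pl_fun Pa (step_lt _ _ lt_ij lerj).
  + have := plM Pa (step_lt _ _ lt_ji leri); rewrite mulrA divfK ?nz_x // mulfV ?nz_x //.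
    by rewrite mulr0 => /not_pl10.
  + by case/eqP: ne_ij; apply: val_inj.
- move=> Pa; apply/eqP; apply: contraT => nz_a; have := plV Pa nz_a.
  rewrite invf_div => /(lt_case _ _ _ _ _ lerj leri lt_nm)/eqP.
  by rewrite invr_eq0 (negPf nz_a).
- exact: lt_case.
Qed.

(** Otherwise one could descend from zeta for ever, in a chain of positive values. *)
Lemma uniformizer : exists pi, [/\ pi != 0, P pi 0 & forall x, P x 0 -> vring (x / pi)].
Proof.
apply: contrapT => no_pi.
have /choice[s Hs] : forall y, exists x,
    y != 0 -> P y 0 -> [/\ x != 0, P x 0 & P (y / x) 0].
  move=> y; have [y0|nz_y] := eqVneq y 0; first by exists 0.
  have [Py|] := pselect (P y 0); last by exists 0.
  apply: contrapT => no_x; apply: no_pi; exists y; split=> // x Px.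
  case: (pl_total P (x / y)) => //; rewrite invf_div => Pyx.
  have [->|nz_x] := eqVneq x 0; first by rewrite mul0r; exists 0; exact: pl00.
  by case: no_x; exists x.
pose x i := iter i.+1 s zeta.
have Hx i : iter i s zeta != 0 /\ P (iter i s zeta) 0.
  by elim: i => [//|i [nz_i Pi]]; have [] := Hs _ nz_i Pi.
apply: (@chain_bound x) => [i _|i _|i _|].
- by case: (Hx i.+1).
- by case: (Hx i.+1).
- by have [nz_i Pi] := Hx i.+1; have [] := Hs _ nz_i Pi.
- by have [] := Hs _ nz_zeta Pzeta.
Qed.

Section Expansion.
Variable pi : E.
Hypothesis nz_pi : pi != 0.
Hypothesis Ppi : P pi 0.
Hypothesis div_pi : forall x, P x 0 -> vring (x / pi).

Definition tsum n (f : fps k) := (map_poly c (fps_trunc n f)).[pi].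

Definition expansion x f := forall n, vring ((x - tsum n f) / pi ^+ n).

Lemma vring_pi : vring pi. Proof. by exists 0. Qed.

Lemma tsumB n f g : tsum n (f - g) = tsum n f - tsum n g.
Proof.
rewrite /tsum -hornerN -hornerD -rmorphB; congr ((map_poly c _).[pi]).
apply/polyP=> i; rewrite coefB !coef_poly; case: ifP => _; last by rewrite subr0.
by rewrite fpscoefD fpscoefN.
Qed.

Lemma expansionB x y f g :
  expansion x f -> expansion y g -> expansion (x - y) (f - g).
Proof.
move=> xf yg n; have := vringB (xf n) (yg n); rewrite -mulrBl tsumB.
by congr (vring (_ / _)); ring.
Qed.

Lemma vring_tsum n f : vring (tsum n f).
Proof. exact/vring_horner/vring_pi. Qed.

Lemma expansion_vring x f : expansion x f -> vring x.
Proof.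
move=> /(_ 0%N); rewrite expr0 divr1 => Ox.
by rewrite -(subrK (tsum 0 f) x); apply: vringD Ox (vring_tsum _ _).
Qed.

(** The product of the partial sums differs from the partial sum of the product by
    terms of order at least n. *)
Lemma expansionM x y f g :
  expansion x f -> expansion y g -> expansion (x * y) (f * g).
Proof.
move=> xf yg n; have Oy := expansion_vring yg.
pose p := fps_trunc n f * fps_trunc n g - fps_trunc n (f * g).
have def_p : p = drop_poly n p * 'X^n.
  rewrite -[LHS](poly_take_drop n p) (_ : take_poly n p = 0) ?add0r //.
  apply/polyP=> i; rewrite coef_take_poly coef0; case: ifP => // lt_in.
  rewrite coefB (@coef_fps_mul_poly k n f g) ?coef_trunc ?subrr // => j ltj;
    exact: coef_trunc.
have eq_p : tsum n f * tsum n g - tsum n (f * g) =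
    (map_poly c (drop_poly n p)).[pi] * pi ^+ n.
  rewrite /tsum -hornerM -rmorphM -hornerN -hornerD -rmorphB -/p {1}def_p.
  by rewrite rmorphM /= map_polyXn hornerM hornerXn.
have -> : x * y - tsum n (f * g) =
   (x - tsum n f) * y + tsum n f * (y - tsum n g) +
     (map_poly c (drop_poly n p)).[pi] * pi ^+ n.
  by rewrite -eq_p; ring.
have OD3 a b d : vring (a / pi ^+ n) -> vring (b / pi ^+ n) -> vring (d / pi ^+ n) ->
    vring ((a + b + d) / pi ^+ n).
  by move=> Oa Ob Od; rewrite !mulrDl; apply: vringD (vringD Oa Ob) Od.
apply: OD3; first by rewrite mulrAC; apply: vringM (xf n) Oy.
  by rewrite -mulrA; apply: vringM (vring_tsum _ _) (yg n).
by rewrite mulfK ?expf_neq0 //; apply/vring_horner/vring_pi.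
Qed.

Lemma expansion_c a : expansion (c a) (fpsC a).
Proof.
move=> [|n]; first by rewrite expr0 divr1; apply: vringB (vring_c a) (vring_tsum _ _).
rewrite (_ : tsum n.+1 (fpsC a) = c a) ?subrr ?mul0r; first by exists 0; exact: pl00.
rewrite /tsum (_ : fps_trunc _ _ = a%:P) ?map_polyC ?hornerC //.
apply/polyP=> i; rewrite coef_poly coefC /=; case: ifP => // /negbT.
by rewrite -leqNgt; case: i.
Qed.

(** If n is the order of f, the partial sum of n + 1 terms is a unit times pi^n,
    which is not divisible by pi^(n + 1). *)
Lemma expansion_inj0 f : expansion 0 f -> f = 0.
Proof.
move=> f0; apply/eqP; apply: contraT => /fps_neq0_order[n nz_n min_n].
have := f0 n.+1; have -> : tsum n.+1 f = c (fpscoef f n) * pi ^+ n.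
  rewrite /tsum (_ : fps_trunc _ _ = fpscoef f n *: 'X^n).
    by rewrite linearZ /= map_polyXn hornerZ hornerXn.
  apply/polyP=> i; rewrite coef_poly coefZ coefXn ltnS leq_eqVlt.
  case: eqP => [->|_]; first by rewrite mulr1.
  by case: ltnP => [/min_n|]; rewrite mulr0.
have -> : (0 - c (fpscoef f n) * pi ^+ n) / pi ^+ n.+1 = - (c (fpscoef f n) / pi).
  have := expf_neq0 n nz_pi; rewrite exprS; move: (pi ^+ n) (c _) => q a nz_q.
  by field; rewrite nz_pi.
move=> Oc1; case: (pl_inv0 nz_pi Ppi).
have -> : pi^-1 = c (- (fpscoef f n)^-1) * - (c (fpscoef f n) / pi).
  rewrite rmorphN fmorphV mulrNN mulrA mulVf ?mul1r //.
  by rewrite fmorph_eq0.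
by apply: vringM => //; exact: vring_c.
Qed.

Lemma expansion_exists x a : P x a -> exists2 f, expansion x f & fpscoef f 0 = a.
Proof.
move=> Px.
have /choice[v Hv] : forall y, exists b, vring y -> P y b.
  by move=> y; have [[b Py]|] := pselect (vring y); [exists b | exists 0].
pose step y := (y - c (v y)) / pi.
pose x_ n := iter n step x.
have Ox_ n : vring (x_ n).
  elim: n => [|n IHn] /=; first by exists a.
  by apply: div_pi; have := plB (Hv _ IHn) (Pc (v (x_ n))); rewrite subrr.
pose f := Fps (fun n => v (x_ n)); exists f; last exact: pl_fun (Hv _ (Ox_ 0%N)) Px.
move=> n; suff -> : x - tsum n f = x_ n * pi ^+ n by rewrite mulfK ?expf_neq0.
rewrite /tsum /fps_trunc; elim: n => [|n IHn].
  by rewrite poly_def big_ord0 rmorph0 horner0 subr0 mulr1.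
move: IHn; rewrite !poly_def big_ord_recr /= => IHn.
rewrite rmorphD /= hornerD opprD addrA IHn linearZ /= map_polyXn hornerZ hornerXn.
by rewrite -mulrBl exprS mulrA /step divfK.
Qed.

(** Were the expansion zero, zeta would be divisible by all powers of pi, and
    these would form too long a chain. *)
Lemma expansion_zeta f : expansion zeta f -> f != 0.
Proof.
move=> zf; apply/eqP => f0; rewrite {}f0 in zf.
have Oz n : vring (zeta / pi ^+ n).
  have := zf n; rewrite (_ : tsum n 0 = 0) ?subr0 // /tsum.
  rewrite (_ : fps_trunc n 0 = 0) ?rmorph0 ?horner0 //.
  by apply/polyP => i; rewrite coef_poly fpscoef0 if_same coef0.
apply: (@chain_bound (fun i => pi ^+ (r.+1 - i))) => [i _|i le_ir|i lt_ir|].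
- exact: expf_neq0.
- by rewrite subSn // exprS -(mul0r (0 ^+ (r - i))); apply: plM Ppi (plX _ Ppi).
- by rewrite subSS subSn ?(ltnW lt_ir) // exprS mulfK ?expf_neq0.
- rewrite subn0; have [b Pb] := Oz r.+2; rewrite -(mulr0 b).
  have -> : zeta / pi ^+ r.+1 = zeta / pi ^+ r.+2 * pi.
    by rewrite [in RHS]exprSr invfM -!mulrA mulVf ?mulr1.
  exact: plM.
Qed.

Lemma expansion0 : expansion 0 0.
Proof. by have := expansion_c 0; rewrite !rmorph0. Qed.
Lemma expansion1 : expansion 1 1.
Proof. by have := expansion_c 1; rewrite !rmorph1. Qed.

Lemma expansionD x y f g :
  expansion x f -> expansion y g -> expansion (x + y) (f + g).
Proof.
move=> xf yg; rewrite -[y]opprK -[g]opprK -(sub0r y) -(sub0r g).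
exact: expansionB xf (expansionB expansion0 yg).
Qed.

Lemma expansionX x f n : expansion x f -> expansion (x ^+ n) (f ^+ n).
Proof.
move=> xf; elim: n => [|n IHn]; last by rewrite !exprS; apply: expansionM.
exact: expansion1.
Qed.

Lemma expansion_horner_neq0 (g : {poly k}) f :
  g != 0 -> expansion (map_poly c g).[zeta] f -> f != 0.
Proof.
case/horner_zeta=> n [u [a [-> Pu nz_a]]] uf; apply/eqP => f0.
rewrite {}f0 in uf; have [h zh _] := expansion_exists Pzeta.
have [v uv _] := expansion_exists (plV Pu nz_a).
have nz_u : u != 0.
  by apply: contraNneq nz_a => u0; move: Pu; rewrite u0 => /pl_fun0 ->.
have := expansionB (expansionM uf uv) (expansionX n zh).
rewrite mulfK // subrr mul0r sub0r => /expansion_inj0/eqP.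
by rewrite oppr_eq0 expf_eq0 (negPf (expansion_zeta zh)) andbF.
Qed.

Lemma expansion_mmap n (e : {rmorphism {mpoly k[n]} -> E}) (eta : 'I_n -> fps k) :
    (forall a, e a%:MP = c a) -> (forall i, expansion (e 'X_i) (eta i)) ->
  forall p, expansion (e p) (mmap (@fpsC k) eta p).
Proof.
move=> eC eX; elim/mpolyind=> [|a m p _ _ IHp].
  by rewrite mmap0 rmorph0; exact: expansion0.
rewrite mmapD rmorphD; apply: expansionD => //.
rewrite -mul_mpolyC !rmorphM /= mmapC eC; apply: expansionM; first exact: expansion_c.
rewrite mpolyXE_id !rmorph_prod.
apply: (big_ind2 expansion) => [|*|i _]; [exact: expansion1 | exact: expansionM |].
by rewrite !rmorphXn /= mmapXU; exact: expansionX.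
Qed.

End Expansion.
End DiscretePlace.

(** * Prime ideals and their residue fields *)

Section PrimeIdeals.
Local Open Scope classical_set_scope.
Variable Y : comNzRingType.

Record is_ideal (I : set Y) : Prop := IsIdeal {
  ideal0 : I 0;
  idealB : forall p q, I p -> I q -> I (p - q);
  idealM : forall a p, I p -> I (a * p)
}.

Lemma idealD I p q : is_ideal I -> I p -> I q -> I (p + q).
Proof.
move=> iI Ip Iq; rewrite -[q]opprK -(sub0r q); apply: idealB => //.
exact: idealB (ideal0 iI) Iq.
Qed.

Record is_prime (I : set Y) : Prop := IsPrime {
  prime_ideal :> is_ideal I;
  prime1 : ~ I 1;
  primeM : forall p q, I (p * q) -> I p \/ I q
}.

(** An ideal maximal among those disjoint from a multiplicative set is prime. *)
Lemma exists_prime (J S : set Y) :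
    is_ideal J -> S 1 -> (forall p q, S p -> S q -> S (p * q)) ->
    (forall p, J p -> ~ S p) ->
  exists Q, [/\ is_prime Q, J `<=` Q & forall p, Q p -> ~ S p].
Proof.
move=> iJ S1 SM JS.
pose good (I : set Y) := [/\ is_ideal I, J `<=` I & forall p, I p -> ~ S p].
pose C (I : set Y) := I = set0 \/ good I.
have [F FC totF|Q [CQ maxQ]] := @Zorn_bigcup _ C.
  have [[I0 [FI0 [iI0 JI0 I0S]]]|noF] := pselect (exists I, F I /\ good I); last first.
    left; rewrite -subset0 => x [I FI Ix]; case: (FC I FI) => [I_0|gI].
      by rewrite -I_0.
    by case: noF; exists I.
  have good_of I u : F I -> I u -> good I.
    by move=> FI Iu; case: (FC I FI) => // I_0; rewrite I_0 in Iu.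
  right; split=> [|p Jp|p [I FI Ip]]; last 2 first.
  - by exists I0 => //; apply: JI0.
  - by case: (good_of I p FI Ip) => _ _; apply.
  split=> [|p q [I FI Ip] [H FH Hq]|a p [I FI Ip]].
  - by exists I0 => //; apply: ideal0.
  - have [iI _ _] := good_of I p FI Ip; have [iH _ _] := good_of H q FH Hq.
    case: (totF I H FI FH) => [IH|HI].
      by exists H => //; apply: idealB => //; apply: IH.
    by exists I => //; apply: idealB => //; apply: HI.
  - by have [iI _ _] := good_of I p FI Ip; exists I => //; apply: idealM.
have gJ : good J by split.
have [iQ JQ QS] : good Q.
  case: CQ => // Q0; case: (maxQ J); last by right.
  rewrite Q0; split; first exact: sub0set.
  by move=> /(_ 0); apply; apply: ideal0.
exists Q; split=> //.
have adjoin p : ~ Q p -> exists a q, Q q /\ S (q + a * p).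
  move=> nQp; apply: contrapT => noS.
  pose H := [set u | exists a q, Q q /\ u = q + a * p].
  case: (maxQ H).
    split; first by move=> q Qq; exists 0, q; rewrite mul0r addr0.
    move=> HQ; apply: nQp; apply: HQ; exists 1, 0; rewrite mul1r add0r.
    by split=> //; apply: ideal0.
  right; split=> [|q Jq|u [a [q [Qq ->]]] Su].
  - split=> [|u v [a [q [Qq ->]]] [b [q' [Qq' ->]]]|b u [a [q [Qq ->]]]].
    + by exists 0, 0; rewrite mul0r addr0; split=> //; apply: ideal0.
    + by exists (a - b), (q - q'); split; [apply: idealB | ring].
    + by exists (b * a), (b * q); split; [apply: idealM | ring].
  - by exists 0, q; rewrite mul0r addr0; split=> //; apply: JQ.
  - by apply: noS; exists a, q.
split=> // [Q1|p q Qpq]; first exact: (QS 1).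
apply: contrapT => /not_orP[/adjoin[a [u [Qu Su]]] /adjoin[b [v [Qv Sv]]]].
apply: (QS _ _ (SM _ _ Su Sv)).
have -> : (u + a * p) * (v + b * q) =
  (v + b * q) * u + (a * p * v + a * b * (p * q)) by ring.
by apply: idealD (idealM _ _ _) (idealD _ (idealM _ _ _) (idealM _ _ _)).
Qed.

End PrimeIdeals.

(** Units and inverses are supplied by choice, which makes an integral ring into
    a domain to which the construction of the fraction field applies. *)
Lemma integral_ring_field (Q : comNzRingType) :
    (forall x y : Q, x * y = 0 -> (x == 0) || (y == 0)) ->
  exists (E : fieldType) (e : {rmorphism Q -> E}),
    (forall x, e x = 0 -> x = 0) /\
    (forall z, exists x y, e y != 0 /\ e y * z = e x).
Proof.
move=> Qint.
pose unit : pred Q := fun f => `[< exists g, g * f = 1 >].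
pose inv f : Q := if pselect (exists g, g * f = 1) is left ex then projT1 (cid ex) else f.
have mulV : {in unit, left_inverse 1 inv *%R}.
  by move=> f /asboolP uf; rewrite /inv; case: pselect => // ex; exact: (projT2 (cid ex)).
have unitPl f g : g * f = 1 -> unit f by move=> gf; apply/asboolP; exists g.
have inv_out : {in [predC unit], inv =1 id}.
  by move=> f /asboolPn nf; rewrite /inv; case: pselect.
pose U := GRing.ComNzRing_hasMulInverse.Build Q mulV unitPl inv_out.
pose UQ : comUnitRingType := HB.pack Q U.
pose D : idomainType := HB.pack Q U (GRing.ComUnitRing_isIntegral.Build UQ Qint).
exists {fraction D}, (@tofrac D \o (idfun : {rmorphism Q -> D})).
split=> [x /eqP|z] /=; first by rewrite tofrac_eq0 => /eqP.
have [y nz_y [x def_x]] := @frac_denom D z.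
by exists x, y; rewrite tofrac_eq0.
Qed.

Local Open Scope quotient_scope.
Lemma prime_quotient_field (Y : comNzRingType) (I : set Y) : is_prime I ->
  exists (E : fieldType) (e : {rmorphism Y -> E}),
    (forall p, e p = 0 <-> I p) /\
    (forall z, exists p q, e q != 0 /\ e q * z = e p).
Proof.
move=> pI; pose b : Y -> bool := fun p => `[< I p >].
have b_ideal : idealr_closed (b : {pred Y}).
  split=> [||a u v /asboolP Iu /asboolP Iv].
  - by apply/asboolP/(ideal0 pI).
  - by apply/asboolPn/(prime1 pI).
  - by apply/asboolP/(idealD pI) => //; apply: (idealM pI).
have b_prime : prime_idealr_closed (b : {pred Y}).
  by move=> u v /asboolP/(primeM pI)[] Iu; apply/orP; [left | right]; apply/asboolP.
pose J : prime_idealr Y := HB.pack b (isIdealr.Build Y b b_ideal)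
  (isPrimeIdealrClosed.Build Y b b_prime).
have [E [e [e_inj e_frac]]] :=
  @integral_ring_field {ideal_quot J} (@Quotient.rquot_IdomainAxiom Y J).
exists E, (e \o \pi_{ideal_quot J}).
have pi0 p : \pi_{ideal_quot J} p = 0 <-> I p.
  rewrite -(rmorph0 \pi_{ideal_quot J}); split=> [/eqP|Ip].
    by rewrite -Quotient.idealrBE subr0 => /asboolP.
  by apply/eqP; rewrite -Quotient.idealrBE subr0; apply/asboolP.
split=> [p|z] /=.
  by rewrite -pi0; split=> [/e_inj|->]; rewrite ?rmorph0.
by have [x [y]] := e_frac z; elim/quotW: x => p; elim/quotW: y => q; exists p, q.
Qed.

(** * The arc lemma *)

Lemma wide_kernel (D : idomainType) m (A : 'M[D]_(m.+1, m)) :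
  exists2 v : 'rV[D]_m.+1, v != 0 & v *m A = 0.
Proof.
pose A' := map_mx (@tofrac D) A.
have /rowV0Pn[w /sub_kermxP wA nz_w] : kermx A' != 0.
  rewrite kermx_eq0 /row_free; apply/negP => /eqP rA.
  by have := rank_leq_col A'; rewrite rA ltnn.
have [c nz_c cw] := frac_denoms (fun j => w 0 j).
have /choice[v Hv] := cw.
have tofrac_inj : injective (@tofrac D) by move=> x y /eqP; rewrite tofrac_eq => /eqP.
have def_v : map_mx (@tofrac D) (\row_j v j) = tofrac c *: w.
  by apply/rowP => j; rewrite !mxE Hv.
exists (\row_j v j).
  apply: contraNneq nz_w => v0; move: def_v; rewrite v0 map_mx0 => /esym/eqP.
  by rewrite scaler_eq0 tofrac_eq0 (negPf nz_c).
have vA0 : map_mx (@tofrac D) ((\row_j v j) *m A) = 0.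
  by rewrite map_mxM def_v -scalemxAl wA scaler0.
by apply/rowP => j; apply: tofrac_inj; have /rowP/(_ j) := vA0; rewrite !mxE rmorph0.
Qed.

Section Arc.
Variables (k : closedFieldType) (L : fieldType) (iota : {rmorphism k -> L}).
Variables (M : nat) (y : 'I_M -> L) (b : 'I_M -> k).
Local Notation Y := {mpoly k[M]}.
Local Notation ev := (mmap iota y).
Hypothesis spec : forall p : Y, ev p = 0 -> p.@[b] = 0.

Lemma algebraic_const (x : L) : integralOver iota x -> exists c, x = iota c.
Proof.
move=> [G monG]; have [s ->] := closed_field_poly_normal G.
rewrite (monicP monG) scale1r rmorph_prod /=.
under eq_bigr => a _ do rewrite rmorphB /= map_polyX map_polyC.
rewrite -(big_map iota xpredT (fun a => 'X - a%:P)) root_prod_XsubC.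
by case/mapP=> c _ ->; exists c.
Qed.

(** Specializing the relation y_i - c_i = 0 shows that y_i is the constant b_i. *)
Lemma constant_arc (s : Y) : ev s != 0 -> (forall i, exists c, y i = iota c) ->
  exists eta : 'I_M -> fps k,
    [/\ forall p, ev p = 0 -> mmap (@fpsC k) eta p = 0,
        forall i, fpscoef (eta i) 0 = b i &
        mmap (@fpsC k) eta s != 0].
Proof.
move=> nz_s /choice[c def_y].
have eq_cb i : c i = b i.
  have /spec : ev ('X_i - (c i)%:MP) = 0.
    by rewrite mmapB mmapC mmapXU def_y subrr.
  by rewrite mevalB mevalXU mevalC => /eqP; rewrite subr_eq0 => /eqP.
have evE p : ev p = iota p.@[b].
  by rewrite /meval rmorph_mmap; apply: eq_mmap => // i; rewrite def_y eq_cb.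
exists (fun i => fpsC (b i)).
have etaE p : mmap (@fpsC k) (fun i => fpsC (b i)) p = fpsC p.@[b].
  by rewrite /meval rmorph_mmap; apply: eq_mmap.
split=> [p /spec pb|//|]; rewrite etaE; first by rewrite pb rmorph0.
apply: contraNneq nz_s => sb0; rewrite evE fmorph_eq0.
by have /(congr1 (fun f => fpscoef f 0)) /= -> := sb0.
Qed.

Section Line.
Local Open Scope classical_set_scope.
Variables (d : nat) (zeta0 : 'I_d -> Y).
Local Notation Z := {mpoly k[d]}.
Local Notation zeta := (mmap (@mpolyC M k) zeta0).
Local Notation z := (fun i => ev (zeta0 i)).
Hypothesis indep : forall p : Z, mmap iota z p = 0 -> p = 0.
Hypothesis int_y : forall i, integralOver (mmap iota z) (y i).

Lemma ev_zeta p : ev (zeta p) = mmap iota z p.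
Proof. exact: mmap_comp. Qed.

Lemma int_ev i : integralOver (ev \o zeta) (ev 'X_i).
Proof.
have [P monP P0] := int_y i; exists P => //.
by rewrite mmapXU (eq_map_poly (g := mmap iota z)) // => p; rewrite /= ev_zeta.
Qed.

Lemma zeta_const c : exists p, zeta p = c%:MP.
Proof. by exists c%:MP; rewrite mmapC. Qed.

Variables (m : nat) (r : 'I_m -> Y).
Hypothesis span : forall p, exists c : 'I_m -> Z,
  ev p = \sum_l ev (zeta (c l) * r l).

Lemma ev_zeta_inj p : ev (zeta p) = 0 -> p = 0.
Proof. by rewrite ev_zeta => /indep. Qed.

Variable a : 'I_d -> k.
(** Restriction of polynomial functions to the line through phi (z) in the
    direction a, where phi is evaluation at b. *)
Definition line_map : {rmorphism Z -> {poly k}} :=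
  mmap (@polyC k) (fun i => (zeta0 i).@[b]%:P + (a i)%:P * 'X).

Lemma line_map0 p : (line_map p).[0] = (zeta p).@[b].
Proof.
rewrite -horner_evalE /line_map (rmorph_mmap (horner_eval 0)) /= /meval.
rewrite (rmorph_mmap (mmap idfun b)); apply: eq_mmap => [x|i] /=.
  by rewrite mmapC /= /horner_eval hornerC.
by rewrite /horner_eval hornerD hornerM !hornerC hornerX mulr0 addr0.
Qed.

(** By going down, the extension J of the prime of the line avoids the products
    u h with u outside the kernel of phi and h outside that prime.  A prime
    containing J and avoiding these products lies over the line and in phi. *)
Lemma line_prime : exists Q, [/\ is_prime Q,
  forall p, ev p = 0 -> Q p, forall p, Q p -> p.@[b] = 0 &
  forall h, Q (zeta h) <-> line_map h = 0].
Proof.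
pose J : set Y := [set p | exists2 s : seq (Z * Y),
  {in s, forall t, line_map t.1 = 0} & ev p = ev (\sum_(t <- s) zeta t.1 * t.2)].
pose S : set Y := [set p | exists u h,
  [/\ u.@[b] != 0, line_map h != 0 & p = u * zeta h]].
have iJ : is_ideal J.
  split=> [|p q [s s0 def_p] [s' s'0 def_q]|x p [s s0 def_p]].
  - by exists [::] => //; rewrite big_nil.
  - exists (s ++ [seq (t.1, - t.2) | t <- s']).
      by move=> t; rewrite mem_cat => /orP[/s0//|/mapP[t' /s'0 ? ->]].
    rewrite mmapB def_p def_q -mmapB big_cat big_map -sumrN; congr (ev (_ + _)).
    by apply: eq_bigr => t _; rewrite mulrN.
  - exists [seq (t.1, x * t.2) | t <- s]; first by move=> t /mapP[t' /s0 ? ->].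
    rewrite rmorphM /= def_p -rmorphM mulr_sumr big_map /=.
    by congr (ev _); apply: eq_bigr => t _; rewrite mulrCA.
have [|p q|p|Q [pQ JQ QS]] := @exists_prime Y J S iJ.
- by exists 1, 1; rewrite !rmorph1 mulr1 !oner_neq0.
- move=> [u [h [ub nz_h ->]]] [u' [h' [u'b nz_h' ->]]]; exists (u * u'), (h * h').
  by rewrite !rmorphM /= !mulf_neq0 //; split=> //; ring.
- move=> [s s0 def_p] [u [h [/eqP ub nz_h def_p']]]; apply: ub.
  rewrite def_p' big_tnth in def_p.
  apply: (@going_down k Z (@mpolyC d k)
    (@mpoly_completely_integrally_closed k d) Y L ev zeta ev_zeta_inj
    m r span _ line_map (meval b) (horner_eval 0) _ spec u h (size s)
    (fun i => (tnth (in_tuple s) i).1) (fun i => (tnth (in_tuple s) i).2)) => // [p'|i].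
    exact: (esym (line_map0 p')).
  by apply: s0; rewrite mem_tnth.
exists Q; split=> // [p p0|p Qp|h].
- apply: JQ; exists [::] => //.
  by rewrite big_nil p0 rmorph0.
- apply/eqP; apply: contraPT (QS p Qp) => pb.
  by move=> H; apply: H; exists p, 1; rewrite !rmorph1 mulr1 oner_neq0.
- split=> [Qh|h0]; last first.
    apply: JQ; exists [:: (h, 1)]; first by move=> t; rewrite inE => /eqP ->.
    by rewrite big_seq1 mulr1.
  apply/eqP; apply: contraPT (QS _ Qh) => nz_h.
  by move=> H; apply: H; exists 1, h; rewrite rmorph1 mul1r oner_neq0.
Qed.

(** The prime Q of the line cuts out a curve through b; its function field is
    finite over k(x), so a place centred at b is discrete and elements of the
    curve have power series expansions. *)
Lemma line_arc (i0 : 'I_d) (s s' : Y) (sigma : Z) :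
    a i0 != 0 -> line_map sigma != 0 -> ev (zeta sigma) = ev (s * s') ->
  exists eta : 'I_M -> fps k,
    [/\ forall p, ev p = 0 -> mmap (@fpsC k) eta p = 0,
        forall i, fpscoef (eta i) 0 = b i &
        mmap (@fpsC k) eta s != 0].
Proof.
move=> nz_a nz_sigma ev_sigma.
have [Q [pQ evQ Qb Qline]] := line_prime.
have [E [e [e0 e_frac]]] := prime_quotient_field pQ.
have e_ev p q : ev p = ev q -> e p = e q.
  move=> epq; apply/eqP; rewrite -subr_eq0 -rmorphB; apply/eqP/e0/evQ.
  by rewrite mmapB epq subrr.
pose c : {rmorphism k -> E} := e \o @mpolyC M k.
pose zt : Z := (a i0)^-1%:MP * ('X_i0 - (zeta0 i0).@[b]%:MP).
have line_zt : line_map zt = 'X.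
  rewrite rmorphM rmorphB /= !mmapC mmapXU addrC addKr mulrA -polyCM mulVf //.
  by rewrite mul1r.
pose x := e (zeta zt).
have nz_x : x != 0.
  by apply/eqP => /e0/Qline; rewrite line_zt => /eqP; rewrite polyX_eq0.
have e_zeta h : e (zeta h) = (map_poly c (line_map h)).[x].
  apply: (@eq_rmorph_mpoly k d E (e \o zeta)
    (horner_eval x \o map_poly c \o line_map)) => [u|i] /=.
    by rewrite !mmapC map_polyC /horner_eval hornerC.
  rewrite !mmapXU rmorphD rmorphM /= map_polyX !map_polyC /horner_eval.
  rewrite hornerD hornerM !hornerC hornerX /x /=.
  apply/eqP; rewrite -rmorphM -rmorphD -subr_eq0 -rmorphB; apply/eqP/e0.
  have -> : zeta0 i - ((zeta0 i).@[b]%:MP + (a i)%:MP * zeta zt) =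
     zeta ('X_i - ((zeta0 i).@[b]%:MP + (a i)%:MP * zt)).
    by rewrite mmapB mmapD [zeta (_ * zt)]rmorphM /= !mmapC mmapXU.
  by apply/Qline; rewrite rmorphB rmorphD rmorphM /= line_zt !mmapC mmapXU subrr.
(* The place of the curve at b. *)
have [P Pe] := @chevalley k E Y (@mpolyC M k) e (meval b) (@mevalC _ _ b)
  (fun p (p0 : e p = 0) => Qb p (iffLR (e0 p) p0)).
have Pc u : P (c u) u by have := Pe u%:MP; rewrite /= mevalC.
have Px : P x 0.
  by have := Pe (zeta zt); rewrite /= -line_map0 line_zt hornerX.
(* After clearing denominators, m + 1 elements of E are combinations over k[x] of
   the m elements e (r l). *)
have dependent (f : 'I_m.+1 -> E) : exists g : 'I_m.+1 -> {poly k},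
    (exists i, g i != 0) /\ \sum_i (map_poly c (g i)).[x] * f i = 0.
  have /choice[q Hq] : forall i, exists q : Y * Y, e q.2 != 0 /\ e q.2 * f i = e q.1.
    by move=> i; have [p [q ?]] := e_frac (f i); exists (p, q).
  pose den := \prod_i (q i).2.
  have nz_den : e den != 0.
    by rewrite rmorph_prod; apply/prodf_neq0 => i _; case: (Hq i).
  have /choice[num Hnum] : forall i, exists p, e den * f i = e p.
    move=> i; exists ((\prod_(j | j != i) (q j).2) * (q i).1).
    rewrite /den (bigD1 i) //= rmorphM [in RHS]rmorphM -(proj2 (Hq i)).
    by rewrite mulrCA mulrA.
  have /choice[u Hu] := fun i => span (num i).
  have [g nz_g gA] := wide_kernel (\matrix_(i, l) line_map (u i l)).
  exists (fun i => g 0 i); split.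
    have /rV0Pn[i gi] := nz_g; by exists i.
  apply: (mulfI nz_den); rewrite mulr0 mulr_sumr.
  have num_span i : e (num i) = \sum_l (map_poly c (line_map (u i l))).[x] * e (r l).
    rewrite (e_ev (num i) (\sum_l zeta (u i l) * r l)); last by rewrite Hu rmorph_sum.
    by rewrite rmorph_sum; apply: eq_bigr => l _; rewrite rmorphM /= e_zeta.
  under eq_bigr => i _ do rewrite mulrCA Hnum num_span mulr_sumr.
  rewrite exchange_big big1 // => l _ /=.
  under eq_bigr => i _ do rewrite mulrA -hornerM -rmorphM.
  rewrite -mulr_suml -horner_sum -rmorph_sum.
  have /rowP/(_ l) := gA; rewrite !mxE.
  by under eq_bigr => i _ do rewrite mxE; move=> ->; rewrite rmorph0 horner0 mul0r.
have [pi [nz_pi Ppi div_pi]] := uniformizer Pc nz_x Px dependent.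
have /choice[eta Heta] : forall i, exists f,
    expansion P c pi (e 'X_i) f /\ fpscoef f 0 = b i.
  move=> i; have := Pe 'X_i; rewrite /= mevalXU => Pi.
  by have [f ? ?] := expansion_exists Pc nz_pi div_pi Pi; exists f.
have exp_eta p : expansion P c pi (e p) (mmap (@fpsC k) eta p).
  by apply: expansion_mmap => // i; case: (Heta i).
exists eta; split=> [p /evQ/e0 p0|i|].
- by apply: (expansion_inj0 Pc nz_pi Ppi); rewrite -p0.
- by case: (Heta i).
have nz_zs : mmap (@fpsC k) eta (zeta sigma) != 0.
  have := exp_eta (zeta sigma); rewrite e_zeta.
  exact: (expansion_horner_neq0 Pc nz_x Px dependent nz_pi Ppi div_pi).
apply: contraNneq nz_zs => s0.
have /e_ev sigma_e := ev_sigma.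
have := expansionB (exp_eta (zeta sigma)) (exp_eta (s * s')).
rewrite sigma_e subrr => /(expansion_inj0 Pc nz_pi Ppi)/eqP.
by rewrite rmorphM /= s0 mul0r subr0.
Qed.

End Line.

(** The line is chosen through a point w where neither sigma nor z_i0 - phi (z_i0)
    vanishes; the latter makes its direction nonzero.  For d = 0 there is no line,
    but then the y_i are constants. *)
Lemma arc (s : Y) : ev s != 0 -> exists eta : 'I_M -> fps k,
  [/\ forall p, ev p = 0 -> mmap (@fpsC k) eta p = 0,
      forall i, fpscoef (eta i) 0 = b i &
      mmap (@fpsC k) eta s != 0].
Proof.
move=> nz_s; have [d [zeta0 /=[indep int_y]]] := noether_normalization iota y.
have [i0 _|no_i] := pickP (@predT 'I_d); last first.
  apply: constant_arc nz_s _ => i; apply: algebraic_const.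
  have [G monG Gy] := int_y i.
  have d0 : d = 0%N by case: (d) no_i => // d' /(_ ord0).
  exists (map_poly (mcoeff 0%MM) G); first exact: monic_map.
  congr (root _ _): Gy; rewrite -map_poly_comp; apply: eq_map_poly => p /=.
  by rewrite {1}(nvar0_mpolyC_eq p d0) mmapC.
have [m [r span]] := finite_span (zeta_const zeta0) (int_ev int_y).
(* The constant term of an equation of s, divided by a power of T, is a nonzero
   multiple of s. *)
have [sigma [s' [nz_sigma ev_sigma]]] : exists sigma s',
    sigma != 0 /\ ev (mmap (@mpolyC M k) zeta0 sigma) = ev (s * s').
  have [G monG] := integral_span span s.
  have [n [q [q0 def_G]]] := multiplicity_XsubC G 0.
  rewrite (monic_neq0 monG) /= in q0.
  have /factor_theorem[q1 def_q] : root (q - q.[0]%:P) 0.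
    by rewrite /root !hornerE subrr.
  rewrite subr0 in def_q.
  pose F : {rmorphism {mpoly k[d]} -> L} := mmap iota y \o mmap (@mpolyC M k) zeta0.
  move=> Gs; have fq0 : (map_poly F q).[ev s] = 0.
    have : (map_poly F G).[ev s] = 0 by apply/rootP.
    rewrite def_G subr0 rmorphM rmorphXn /= map_polyX hornerM hornerXn.
    by move/eqP; rewrite mulf_eq0 expf_eq0 (negPf nz_s) andbF orbF => /eqP.
  exists q.[0], (- (map_poly (mmap (@mpolyC M k) zeta0) q1).[s]); split=> //.
  have ev_q1 : ev (map_poly (mmap (@mpolyC M k) zeta0) q1).[s] = (map_poly F q1).[ev s].
    by rewrite map_poly_comp horner_map.
  rewrite mulrN mmapN rmorphM /= ev_q1.
  apply/eqP; rewrite -addr_eq0 -fq0 [in X in _ == X](_ : q = q1 * 'X + q.[0]%:P).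
    rewrite rmorphD rmorphM /= map_polyX map_polyC hornerMXaddC.
    by rewrite mulrC addrC.
  by rewrite -def_q subrK.
have [w] : exists w, (sigma * ('X_i0 - (zeta0 i0).@[b]%:MP)).@[w] != 0.
  apply: mpoly_nonroot; rewrite mulf_neq0 //.
  apply/eqP => /(congr1 (mcoeff U_(i0))); rewrite mcoeffB mcoeffXU eqxx mcoeffC.
  by rewrite mnm1_eq0 mulr0 subr0 mcoeff0 => /eqP; rewrite oner_eq0.
rewrite mevalM mevalB mevalXU mevalC mulf_eq0 negb_or => /andP[sw aw].
apply: (@line_arc d zeta0 indep m r span (fun i => w i - (zeta0 i).@[b])
  i0 s s' sigma) => //.
apply: contraNneq sw => line0.
have /(congr1 (horner_eval 1)) := line0.
rewrite (rmorph_mmap (horner_eval 1)) rmorph0 => <-; rewrite /meval; apply/eqP.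
apply: eq_mmap => [u|i] /=; first by rewrite /horner_eval hornerC.
by rewrite /horner_eval hornerD hornerM !hornerC hornerX mulr1 addrC subrK.
Qed.
End Arc.

(** * Structure constants and base change *)

Section StructureConstants.
Variables (R : comNzRingType) (n : nat).
Local Notation sconst := ('I_n -> 'I_n -> 'I_n -> R).

Definition lcomb (X : lmodType R) (e : 'I_n -> X) (x : 'rV[R]_n) : X :=
  \sum_i x 0 i *: e i.

Lemma lcomb_linear (X : lmodType R) (e : 'I_n -> X) : linear (lcomb e).
Proof.
move=> a x y; rewrite /lcomb scaler_sumr -big_split; apply: eq_bigr => i _ /=.
by rewrite !mxE scalerDl scalerA.
Qed.

HB.instance Definition _ (X : lmodType R) (e : 'I_n -> X) :=
  GRing.isLinear.Build R 'rV[R]_n X *:%R (lcomb e) (lcomb_linear e).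

Definition sbasis (X : assocAlg R) (e : 'I_n -> X) (c : sconst) :=
  bijective (lcomb e) /\
  forall i j, amul (e i) (e j) = lcomb e (\row_l c i j l).

Definition smul (c : sconst) (x y : 'rV[R]_n) : 'rV[R]_n :=
  \sum_i \sum_j (x 0 i * y 0 j) *: \row_l c i j l.

Lemma amul_suml (X : assocAlg R) (I : Type) (s : seq I) (P : pred I) (F : I -> X) y :
  amul (\sum_(i <- s | P i) F i) y = \sum_(i <- s | P i) amul (F i) y.
Proof.
by apply: (big_morph (fun x => amul x y)) => [x z|]; [exact: amulDl | exact: amul0l].
Qed.

Lemma amul_sumr (X : assocAlg R) (I : Type) (s : seq I) (P : pred I) (F : I -> X) y :
  amul y (\sum_(i <- s | P i) F i) = \sum_(i <- s | P i) amul y (F i).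
Proof.
by apply: (big_morph (fun x => amul y x)) => [x z|]; [exact: amulDr | exact: amul0r].
Qed.

Lemma amul_lcomb2 (X : assocAlg R) (e : 'I_n -> X) x y :
  amul (lcomb e x) (lcomb e y) =
    \sum_i \sum_j (x 0 i * y 0 j) *: amul (e i) (e j).
Proof.
rewrite amul_suml; apply: eq_bigr => i _.
rewrite amulZl amul_sumr scaler_sumr; apply: eq_bigr => j _.
by rewrite amulZr scalerA.
Qed.

Lemma amul_lcomb (X : assocAlg R) (e : 'I_n -> X) c x y : sbasis e c ->
  amul (lcomb e x) (lcomb e y) = lcomb e (smul c x y).
Proof.
move=> [_ ec]; rewrite amul_lcomb2 raddf_sum; apply: eq_bigr => i _.
rewrite raddf_sum; apply: eq_bigr => j _.
by rewrite [RHS]linearZ ec.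
Qed.

Lemma lcomb_delta (X : lmodType R) (e : 'I_n -> X) i :
  lcomb e (delta_mx 0 i) = e i.
Proof.
rewrite /lcomb (bigD1 i) //= mxE !eqxx scale1r big1 ?addr0 // => j ne_ji.
by rewrite mxE (negPf ne_ji) andbF scale0r.
Qed.

Lemma sbasis_uniq (X : assocAlg R) (e : 'I_n -> X) c c' :
  sbasis e c -> sbasis e c' -> forall i j l, c i j l = c' i j l.
Proof.
move=> [/bij_inj inj ec] [_ ec'] i j l; have := ec i j; rewrite ec' => /inj/rowP/(_ l).
by rewrite !mxE.
Qed.

Lemma eq_sbasis (X : assocAlg R) (e e' : 'I_n -> X) c c' :
    e =1 e' -> (forall i j l, c i j l = c' i j l) ->
  sbasis e c -> sbasis e' c'.
Proof.
move=> /funext <- cc'; suff -> : c = c' by [].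
by apply/funext=> i; apply/funext=> j; apply/funext=> l.
Qed.

Lemma sbasis_iso (X Y : assocAlg R) (e : 'I_n -> X) (e' : 'I_n -> Y) c :
  sbasis e c -> sbasis e' c -> isomorphic X Y.
Proof.
move=> se se'; have [[kappa eK kappaK] _] := se; have [bij' _] := se'.
pose F x := lcomb e' (kappa x).
have linF : linear F.
  move=> a x y; rewrite -linearP; congr (lcomb e' _).
  by apply: (can_inj eK); rewrite linearP /= !kappaK.
pose FL : {linear X -> Y} := HB.pack F (GRing.isLinear.Build R X Y *:%R F linF).
split; apply: (@AlgIso R X Y FL) => [x y|] /=.
  rewrite /F (amul_lcomb _ _ se'); congr (lcomb e' _).
  by apply: (can_inj eK); rewrite kappaK -(amul_lcomb _ _ se) !kappaK.
by apply: bij_comp => //; exists (lcomb e).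
Qed.

Lemma iso_sbasis (X Y : assocAlg R) (f : algIso X Y) (e : 'I_n -> X) c :
  sbasis e c -> sbasis (f \o e) c.
Proof.
have fe x : lcomb (f \o e) x = f (lcomb e x).
  by rewrite raddf_sum; apply: eq_bigr => i _; rewrite /= linearZ.
move=> [bij_e ec]; split=> [|i j].
  by apply: (eq_bij (bij_comp (iso_bij f) bij_e)) => x /=; rewrite fe.
by rewrite fe -ec iso_mul.
Qed.

End StructureConstants.

Lemma tens_lift0 (R S : comNzRingType) (f : {rmorphism R -> S}) (X : lmodType R)
    (Z : zmodType) (g : X -> S -> Z) :
  balanced f g -> tens_lift g (0 : tens f X) = 0.
Proof. by move=> bg; rewrite -[0]/(tens_pi f [::]) tens_lift_pi // big_nil. Qed.

(** The inverse of the coordinate map comes from the balanced map sending x (x) s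
    to s times the coordinates of x. *)
Lemma base_change_sbasis (R S : comNzRingType) (f : {rmorphism R -> S}) n
    (X : assocAlg R) (e : 'I_n -> X) c :
  sbasis e c ->
  sbasis (X := base_change f X) (fun i => tensor f (e i) 1) (fun i j l => f (c i j l)).
Proof.
move=> se; have [[kappa eK kappaK] ec] := se.
pose T := base_change f X.
have lin_kappa : linear kappa.
  by move=> a x y; apply: (can_inj eK); rewrite linearP /= !kappaK.
have kappaD x y : kappa (x + y) = kappa x + kappa y.
  by have := lin_kappa 1 x y; rewrite !scale1r.
have kappaZ a x : kappa (a *: x) = a *: kappa x.
  have k0 : kappa 0 = 0 by apply: (addrI (kappa 0)); rewrite -kappaD !addr0.
  by have := lin_kappa a x 0; rewrite k0 !addr0.
pose g (x : X) (s : S) : 'rV[S]_n := s *: map_mx f (kappa x).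
have bal_g : balanced f g.
  split=> [x y s|x s t|a x s]; rewrite /g.
  - by rewrite kappaD raddfD scalerDr.
  - by rewrite scalerDl.
  - by rewrite kappaZ map_mxZ scalerA mulrC.
have tensor_lcomb x : tensor f (lcomb e x) 1 =
    lcomb (fun i => tensor f (e i) 1 : T) (map_mx f x).
  rewrite /lcomb (big_morph (fun x => tensor f x 1) (id1 := 0) (op1 := +%R)).
  - by apply: eq_bigr => i _; rewrite tensorZ mxE scale_tensor.
  - by move=> u v; exact: tensorDl.
  - by apply: (addrI (tensor f 0 1)); rewrite -tensorDl !addr0.
split; last first.
  move=> i j; rewrite [LHS]/= tens_mul_tensor mulr1 ec tensor_lcomb.
  by congr (lcomb _ _); apply/rowP => l; rewrite !mxE.
have lift_scale s (u : tens f X) : tens_lift g (s *: u) = s *: tens_lift g u.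
  elim/tens_ind: u => [|x t|u v IHu IHv].
  - by rewrite scaler0 tens_lift0 ?scaler0.
  - by rewrite scale_tensor !tens_lift_tensor // /g scalerA.
  - by rewrite scalerDr !tens_liftD // IHu IHv scalerDr.
exists (tens_lift g : T -> 'rV[S]_n).
- move=> x; rewrite /lcomb.
  rewrite (big_morph (fun u : T => tens_lift g u) (id1 := 0) (op1 := +%R)).
  + rewrite [RHS]row_sum_delta; apply: eq_bigr => i _.
    rewrite lift_scale tens_lift_tensor // /g scale1r -[e i](lcomb_delta e) eK.
    by rewrite map_delta_mx.
  + by move=> u v; exact: tens_liftD.
  + exact: tens_lift0.
- move=> u; elim/tens_ind: u => [|x s|u v IHu IHv].
  + by rewrite tens_lift0 // raddf0.
  + by rewrite tens_lift_tensor // /g linearZ /= -tensor_lcomb kappaK scale_tensor mulr1.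
  + by rewrite tens_liftD // raddfD /= IHu IHv.
Qed.

(** * Structure constants in varying bases *)

Section Theta.
Variables (R : comNzRingType) (n : nat).

(** Structure constants in the basis with matrix mu det(h) h; written with the
    adjugate, they are polynomial in h and mu. *)
Definition theta (a : 'I_n -> 'I_n -> 'I_n -> R) (h : 'M[R]_n) (mu : R) i j l :=
  mu * (smul a (row i h) (row j h) *m \adj h) 0 l.

Lemma smulZZ (a : 'I_n -> 'I_n -> 'I_n -> R) x y u v :
  smul a (x *: u) (y *: v) = (x * y) *: smul a u v.
Proof.
rewrite /smul scaler_sumr; apply: eq_bigr => i _; rewrite scaler_sumr.
apply: eq_bigr => j _; rewrite !mxE scalerA; congr (_ *: _); ring.
Qed.

Lemma lcomb_mul (X : lmodType R) (e e' : 'I_n -> X) (H : 'M[R]_n) x :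
  (forall i, e' i = lcomb e (row i H)) -> lcomb e' x = lcomb e (x *m H).
Proof.
move=> def_e'; rewrite [in LHS]/lcomb mulmx_sum_row raddf_sum.
by apply: eq_bigr => i _; rewrite def_e' /= linearZ.
Qed.

End Theta.

Lemma map_smul (R S : comNzRingType) (f : {rmorphism R -> S}) n
    (a : 'I_n -> 'I_n -> 'I_n -> R) x y :
  map_mx f (smul a x y) = smul (fun i j l => f (a i j l)) (map_mx f x) (map_mx f y).
Proof.
rewrite /smul raddf_sum; apply: eq_bigr => i _; rewrite raddf_sum.
apply: eq_bigr => j _; rewrite /= map_mxZ !mxE rmorphM; congr (_ *: _).
by apply/rowP => l; rewrite !mxE.
Qed.

Lemma map_theta (R S : comNzRingType) (f : {rmorphism R -> S}) n a (h : 'M[R]_n)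
    mu i j l :
  f (theta a h mu i j l) =
  theta (fun i j l => f (a i j l)) (map_mx f h) (f mu) i j l.
Proof.
rewrite /theta rmorphM; congr (_ * _).
by rewrite -!map_row -map_smul -map_mx_adj -map_mxM [in RHS]mxE.
Qed.

Section ThetaBasis.
Variables (F : fieldType) (n : nat) (X : assocAlg F) (e : 'I_n -> X).
Variable a : 'I_n -> 'I_n -> 'I_n -> F.
Hypothesis se : sbasis e a.

Lemma theta_sbasis h mu : mu * \det h != 0 ->
  sbasis (fun i => (mu * \det h) *: lcomb e (row i h)) (theta a h mu).
Proof.
set nu := mu * \det h => nz_nu; set e' := fun i => _.
pose H := nu *: h.
have def_e' i : e' i = lcomb e (row i H).
  by rewrite /e' -linearZ; congr (lcomb e _); rewrite linearZ.
have nz_det : \det h != 0 by move: nz_nu; rewrite mulf_eq0 negb_or => /andP[].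
have uH : H \in unitmx by rewrite unitmxZ ?unitmxE ?unitfE.
split=> [|i j].
  apply: (@eq_bij _ _ (lcomb e \o mulmxr H)); last first.
    by move=> x /=; rewrite (lcomb_mul _ def_e').
  apply: bij_comp; first by case: se.
  by exists (mulmxr (invmx H)); [apply: mulmxK | apply: mulmxKV].
rewrite (lcomb_mul _ def_e') !def_e' (amul_lcomb _ _ se); congr (lcomb e _).
rewrite !linearZ /= smulZZ -/nu.
have -> : \row_l theta a h mu i j l = mu *: (smul a (row i h) (row j h) *m \adj h).
  by apply/rowP => l; rewrite [LHS]mxE [RHS]mxE.
rewrite -scalemxAl -mulmxA mul_adj_mx mul_mx_scalar !scalerA.
by congr (_ *: _); rewrite /nu; ring.
Qed.

(** For the matrix h of e', the choice mu = 1 / det h gives mu det(h) h = h. *)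
Lemma sbasis_theta (e' : 'I_n -> X) c : sbasis e' c ->
  exists h mu, mu * \det h != 0 /\ forall i j l, c i j l = theta a h mu i j l.
Proof.
move=> se'; have [[kappa eK kappaK] _] := se.
pose h := \matrix_i kappa (e' i).
have def_e' i : e' i = lcomb e (row i h) by rewrite rowK kappaK.
have uh : h \in unitmx.
  rewrite -row_free_unit -kermx_eq0; apply/eqP/row_matrixP => i.
  rewrite row0; case: se' => /bij_inj inj _; apply: inj.
  by rewrite (lcomb_mul _ def_e') raddf0 -row_mul mulmx_ker row0 raddf0.
exists h, (\det h)^-1.
have nz_det : \det h != 0 by rewrite unitmxE unitfE in uh.
have nu1 : (\det h)^-1 * \det h = 1 by rewrite mulVf.
split; first by rewrite nu1 oner_neq0.
apply: (sbasis_uniq se'); have := @theta_sbasis h (\det h)^-1.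
rewrite nu1 oner_neq0 => /(_ isT); apply: eq_sbasis => // i.
by rewrite scale1r -def_e'.
Qed.

End ThetaBasis.

(** * Orbits and closures in terms of structure constants *)

Section AssCoordinates.
Local Open Scope classical_set_scope.
Variables (k : closedFieldType) (V : vectType k).
Local Notation n := (\dim {:V}).
Local Notation H := 'Hom(V, 'Hom(V, V)).
Local Notation orbit := Defs.orbit.
Implicit Types A B : Ass V.

Definition vb (i : 'I_n) : V := (vbasis {:V})`_i.
Definition sc A (i j l : 'I_n) : k := coord (vbasis {:V}) l (A (vb i) (vb j)).

Lemma vb_bij : bijective (lcomb vb).
Proof.
exists (fun w => \row_i coord (vbasis {:V}) i w) => [x|w].
  apply/rowP => i; rewrite mxE /lcomb /vb.
  by rewrite (coord_sum_free _ _ (basis_free (vbasisP _))).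
rewrite [RHS](coord_vbasis (memvf w)); apply: eq_bigr => i _.
by rewrite mxE.
Qed.

Lemma lcomb_coord w : lcomb vb (\row_i coord (vbasis {:V}) i w) = w.
Proof.
by rewrite [RHS](coord_vbasis (memvf w)); apply: eq_bigr => i _; rewrite mxE.
Qed.

Lemma ass_sbasis A : sbasis (X := ass_alg A) vb (sc A).
Proof.
by split=> [|i j]; [exact: vb_bij | rewrite /= [RHS]lcomb_coord].
Qed.

Lemma orbit_sbasis A A' : orbit A A' ->
  exists e, sbasis (X := ass_alg A) e (sc A').
Proof.
case=> g _ <-; set g' := ((val g)^-1)%VF.
have gK : cancel (val g) g' by apply: lker0_lfunK; exact: valP g.
have g'K : cancel g' (val g) by apply: lker0_lfunVK; exact: valP g.
have lcomb_g' x : lcomb (X := ass_alg A) (fun i => g' (vb i)) x = g' (lcomb vb x).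
  by rewrite /lcomb linear_sum; apply: eq_bigr => i _; rewrite linearZ.
exists (fun i => g' (vb i)); split=> [|i j].
  apply: (@eq_bij _ _ (g' \o lcomb vb)) => [|x /=]; last by rewrite lcomb_g'.
  by apply: bij_comp vb_bij; exists (val g).
by rewrite lcomb_g' lcomb_coord gl_act_mulE gK.
Qed.

Lemma sbasis_orbit A e c : sbasis (X := ass_alg A) e c ->
  exists A', orbit A A' /\ forall i j l, sc A' i j l = c i j l.
Proof.
case=> [[kappa eK kappaK] ec].
pose F (w : V) : V := lcomb vb (kappa w).
have linF : linear F.
  move=> a x y; rewrite -linearP; congr (lcomb vb _).
  by apply: (can_inj eK); rewrite linearP /= !kappaK.
pose FL : {linear V -> V} := HB.pack F (GRing.isLinear.Build k V V *:%R F linF).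
have FE x : linfun FL x = F x by rewrite lfunE.
have ker0 : lker (linfun FL) == 0%VS.
  apply/lker0P => x y; rewrite !FE => /(bij_inj vb_bij) eq_xy.
  by rewrite -[x]kappaK -[y]kappaK eq_xy.
pose g : GL V := exist _ (linfun FL) ker0.
exists (gl_act g A); split; first by exists g.
have F_lcomb x : F (lcomb (X := ass_alg A) e x) = lcomb vb x by rewrite /F eK.
have gV i : ((val g)^-1)%VF (vb i) = e i.
  apply: (lker0P ker0); rewrite lker0_lfunVK // FE -(lcomb_delta (X := ass_alg A) e).
  by rewrite F_lcomb lcomb_delta.
move=> i j l; rewrite /sc gl_act_mulE !gV.
have := ec i j; rewrite /= => ->; rewrite [val g _]FE F_lcomb.
rewrite /lcomb (coord_sum_free _ _ (basis_free (vbasisP _))) mxE //.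
Qed.

Local Notation T := ('I_n * 'I_n * 'I_n)%type.
Local Notation N := #|{: T}|.

Definition sc_point (R : Type) (c : 'I_n -> 'I_n -> 'I_n -> R) (t : 'I_N) : R :=
  c (enum_val t).1.1 (enum_val t).1.2 (enum_val t).2.

Local Notation D := (\dim {:H}).

(** The change of coordinates from those of Hom(V, Hom(V, V)), in which closed
    sets are defined, to structure constants. *)
Definition sc_mx : 'M[k]_(D, N) := \matrix_(m, t)
  coord (vbasis {:V}) (enum_val t).2
    ((vbasis {:H})`_m (vb (enum_val t).1.1) (vb (enum_val t).1.2)).

Definition coord_row (A : H) : 'rV[k]_D := \row_m coord (vbasis {:H}) m A.

Lemma sc_mxE A : \row_t sc_point (sc A) t = coord_row A *m sc_mx.
Proof.
apply/rowP=> t; rewrite !mxE /sc_point /sc [in LHS](coord_vbasis (memvf (A : H))).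
rewrite sum_lfunE sum_lfunE linear_sum; apply: eq_bigr => m _ /=.
by rewrite !scale_lfunE linearZ !mxE.
Qed.

(** A bilinear map is zero when its structure constants are. *)
Lemma sc_mx_free : row_free sc_mx.
Proof.
rewrite -kermx_eq0; apply/eqP/row_matrixP => i0; rewrite row0.
set x := row i0 _; have x0 : x *m sc_mx = 0 by rewrite -row_mul mulmx_ker row0.
pose A : H := \sum_m x 0 m *: (vbasis {:H})`_m.
have coordA m : coord (vbasis {:H}) m A = x 0 m.
  by rewrite /A (coord_sum_free _ _ (basis_free (vbasisP _))).
have A0 : A = 0.
  have A0ij i j : A (vb i) (vb j) = 0.
    rewrite -(lcomb_coord (A (vb i) (vb j))) (_ : \row__ _ = 0) ?raddf0 //.
    apply/rowP => l; rewrite !mxE.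
    have /rowP/(_ (enum_rank (i, j, l))) := x0; rewrite !mxE => <-.
    rewrite /A sum_lfunE sum_lfunE linear_sum; apply: eq_bigr => m _ /=.
    by rewrite !scale_lfunE linearZ !mxE enum_rankK.
  have A0i i w : A (vb i) w = 0.
    rewrite -(lcomb_coord w) /lcomb linear_sum big1 //= => j _.
    by rewrite linearZ /= A0ij scaler0.
  apply/lfunP => u; apply/lfunP => w; rewrite !zero_lfunE -(lcomb_coord u) /lcomb.
  rewrite linear_sum sum_lfunE big1 //= => i _.
  by rewrite linearZ /= scale_lfunE A0i scaler0.
by apply/rowP => m; rewrite -coordA A0 linear0 mxE.
Qed.

(** The substitution sc_mx turns a polynomial in the structure constants into one
    in the coordinates of Hom(V, Hom(V, V)). *)
Lemma degeneration_polynomials A B : is_degeneration B A ->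
  forall p : {mpoly k[N]}, (forall A', orbit A A' -> p.@[sc_point (sc A')] = 0) ->
  p.@[sc_point (sc B)] = 0.
Proof.
move=> degBA p pA.
pose q := mmap (@mpolyC D k) (fun t => \sum_m sc_mx m t *: 'X_m) p.
have eval_q A' : poly_eval q A' = p.@[sc_point (sc A')].
  rewrite /poly_eval /meval (rmorph_mmap (meval _)); apply: eq_mmap => [c|t] /=.
    exact: mevalC.
  rewrite raddf_sum /=; have /rowP/(_ t) := sc_mxE A'; rewrite !mxE => ->.
  by apply: eq_bigr => m _; rewrite mevalZ mevalXU !mxE mulrC.
have BB : orbit B B.
  have ker0 : lker (\1%VF : 'End(V)) == 0%VS.
    by apply/lker0P => x y; rewrite !id_lfunE.
  exists (exist _ \1%VF ker0) => //.
  have inv1 x : ((\1%VF : 'End(V))^-1)%VF x = x.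
    by apply: (lker0P ker0); rewrite lker0_lfunVK // id_lfunE.
  apply: ass_mul_inj; apply/lfunP => x; apply/lfunP => y.
  by rewrite gl_act_mulE /= !inv1 id_lfunE.
have := degBA B BB [set A' | poly_eval q A' = 0]; rewrite /= eval_q; apply.
split; last by move=> A' /pA; rewrite /= eval_q.
exists [set q]; apply/seteqP; split=> [A' /= qA' p' -> //|A' /=].
exact.
Qed.

(** Being injective, sc_mx has a one-sided inverse alpha, which substitutes in the
    other direction. *)
Lemma polynomials_degeneration A B :
    (forall B', orbit B B' -> forall p : {mpoly k[N]},
      (forall A', orbit A A' -> p.@[sc_point (sc A')] = 0) ->
      p.@[sc_point (sc B')] = 0) ->
  is_degeneration B A.
Proof.
move=> vanish B' BB' _ [[P ->] AP] q Pq.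
have [alpha alphaK] := row_freeP sc_mx_free.
pose p := mmap (@mpolyC N k) (fun m => \sum_t alpha t m *: 'X_t) q.
have eval_p A' : p.@[sc_point (sc A')] = poly_eval q A'.
  rewrite /poly_eval /meval (rmorph_mmap (meval _)); apply: eq_mmap => [c|m] /=.
    exact: mevalC.
  rewrite raddf_sum /=.
  have /(congr1 (mulmx^~ alpha)) := sc_mxE A'; rewrite -mulmxA alphaK mulmx1.
  move/rowP/(_ m); rewrite !mxE => <-.
  by apply: eq_bigr => t _; rewrite mevalZ mevalXU !mxE mulrC.
by rewrite -eval_p; apply: (vanish B' BB') => A' /AP /(_ q Pq); rewrite eval_p.
Qed.

End AssCoordinates.

(** * Freeness of formal deformations *)

Section FpsShift.
Variable k : fieldType.
Implicit Types f g : fps k.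

Definition fps_drop m f : fps k := Fps (fun n => fpscoef f (n + m)).

Lemma fpscoefX0 f : fpscoef (fpsX k * f) 0 = 0.
Proof. by rewrite fpscoefM big_ord1 /= mul0r. Qed.

Lemma fpscoefXS f n : fpscoef (fpsX k * f) n.+1 = fpscoef f n.
Proof.
rewrite fpscoefM big_ord_recl mul0r add0r big_ord_recl /= mul1r big1 ?addr0.
  by rewrite /bump /= subn1.
by move=> i _; rewrite mul0r.
Qed.

Lemma fpscoefXn f m n :
  fpscoef (fpsX k ^+ m * f) n = if (n < m)%N then 0 else fpscoef f (n - m).
Proof.
elim: m n => [|m IHm] n; first by rewrite mul1r subn0.
rewrite exprS -mulrA; case: n => [|n]; first exact: fpscoefX0.
by rewrite fpscoefXS IHm.
Qed.

Lemma fps_dropE m f : (forall n, (n < m)%N -> fpscoef f n = 0) ->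
  f = fpsX k ^+ m * fps_drop m f.
Proof.
move=> f0; apply/fpsP => n; rewrite fpscoefXn /=; case: ltnP => [/f0 //|le_mn].
by rewrite subnK.
Qed.

Lemma fps_split f : f = fpsC (fpscoef f 0) + fpsX k * fps_drop 1 f.
Proof.
apply/fpsP => [[|n]]; rewrite fpscoefD ?fpscoefX0 ?fpscoefXS /= ?addr0 //.
by rewrite add0r addn1.
Qed.

Lemma fpsX_neq0 : fpsX k != 0.
Proof.
apply/eqP => /(congr1 (fun f => fpscoef f 1)) /= /eqP.
by rewrite oner_eq0.
Qed.
End FpsShift.

Section DeformationBasis.
Variables (k : fieldType) (B : assocAlg k) (X : formal_deformation B).
Variables (n : nat) (w : 'I_n -> B) (c0 : 'I_n -> 'I_n -> 'I_n -> k).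
Hypothesis sw : sbasis w c0.
Local Notation ev0 := (@fps_ev0 k).
Local Notation t := (fpsX k).

Definition reduce (x : X) : B := def_iso X (tensor ev0 x 1).

Lemma reduceD x y : reduce (x + y) = reduce x + reduce y.
Proof. by rewrite /reduce tensorDl raddfD. Qed.
Lemma reduceZ r x : reduce (r *: x) = fpscoef r 0 *: reduce x.
Proof. by rewrite /reduce tensorZ -scale_tensor linearZ. Qed.
Lemma reduceM x y : reduce (amul x y) = amul (reduce x) (reduce y).
Proof. by rewrite /reduce -iso_mul /= tens_mul_tensor mulr1. Qed.
Lemma reduce_lcomb (e : 'I_n -> X) f :
  reduce (lcomb e f) = lcomb (reduce \o e) (\row_i fpscoef (f 0 i) 0).
Proof.
rewrite /lcomb (big_morph reduce (id1 := 0) (op1 := +%R)) => [|x y|].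
- by apply: eq_bigr => i _; rewrite reduceZ mxE.
- exact: reduceD.
- by apply: (addrI (reduce 0)); rewrite -reduceD !addr0.
Qed.

Lemma reduce_surj y : exists x, reduce x = y.
Proof.
have [g fK gK] := iso_bij (def_iso X).
suff [x def_x] : exists x, tensor ev0 x 1 = g y by exists x; rewrite /reduce def_x gK.
elim/tens_ind: (g y) => [|x a|u v [x <-] [x' <-]].
- by exists 0; apply: (addrI (tensor ev0 0 1)); rewrite -tensorDl !addr0.
- by exists (fpsC a *: x); rewrite tensorZ mulr1.
- by exists (x + x'); rewrite tensorDl.
Qed.

Lemma tdivB m (x y : X) : tdiv m x -> tdiv m y -> tdiv m (x - y).
Proof. by move=> [x' ->] [y' ->]; exists (x' - y'); rewrite scalerBr. Qed.
Lemma tdiv0 m : tdiv m (0 : X).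
Proof. by exists 0; rewrite scaler0. Qed.

(** Tensors being classes of formal sums, the kernel of the reduction is found by
    checking that each generating relation preserves the value modulo t. *)
Lemma tens_rel_tdiv (s s' : seq (X * k)) : tens_rel ev0 s s' ->
  tdiv 1 (\sum_(p <- s) fpsC p.2 *: p.1 - \sum_(p <- s') fpsC p.2 *: p.1).
Proof.
have tdivD x y : tdiv 1 x -> tdiv 1 y -> tdiv 1 (x + y : X).
  by move=> [x' ->] [y' ->]; exists (x' + y'); rewrite scalerDr.
elim=> {s s'}.
- by move=> s; rewrite subrr; exact: tdiv0.
- by move=> s s' _ IH; rewrite -opprB -sub0r; apply: tdivB => //; exact: tdiv0.
- move=> s s' u _ IH _ IH'; have := tdivD _ _ IH IH'.
  by rewrite addrA subrK.
- move=> s s' u u' _ IH _ IH'; have := tdivD _ _ IH IH'.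
  by rewrite !big_cat /= opprD addrACA.
- by move=> s u; rewrite !big_cat /= addrC subrr; exact: tdiv0.
- by move=> a; rewrite big_seq1 big_nil scaler0 subrr; exact: tdiv0.
- move=> x y a; rewrite !big_cons !big_nil !addr0 scalerDr subrr; exact: tdiv0.
- by move=> x a b; rewrite !big_cons !big_nil !addr0 rmorphD scalerDl subrr; exact: tdiv0.
- move=> r x a; rewrite !big_seq1 /= scalerA -scalerBl rmorphM.
  exists ((fpsC a * fps_drop 1 r) *: x); rewrite scalerA; congr (_ *: _).
  by rewrite {1}(fps_split r) /fps_ev0; ring.
Qed.

Lemma reduce_eq0 x : reduce x = 0 -> exists x', x = t *: x'.
Proof.
move=> x0; have: tensor ev0 x 1 = 0.
  by apply: (bij_inj (iso_bij (def_iso X))); rewrite raddf0.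
rewrite [tensor _ _ _]/(tens_pi ev0 [:: (x, 1)]) -[0]/(tens_pi ev0 [::]).
move/tens_piP/asboolP/tens_rel_tdiv; rewrite big_seq1 big_nil subr0 rmorph1 scale1r.
by case=> x' def_x; exists x'; rewrite -def_x.
Qed.

(** The lifts of a basis generate X because successive approximation modulo the
    powers of t converges in the separated module X.  They are independent
    because a relation can be divided by t, X being free of torsion, until some
    coefficient has a nonzero constant term; reduction then contradicts the
    independence of the basis of B. *)
Lemma deformation_sbasis : exists (e : 'I_n -> X) c,
  sbasis e c /\ forall i j l, fpscoef (c i j l) 0 = c0 i j l.
Proof.
have [bij_w wc] := sw; have inj_w := bij_inj bij_w.
have /choice[e def_e] := fun i => reduce_surj (w i).
have reduce_e f : reduce (lcomb e f) = lcomb w (\row_i fpscoef (f 0 i) 0).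
  by rewrite reduce_lcomb; congr (lcomb _ _); apply/funext => i /=.
have lcomb_inj : injective (lcomb e).
  suff ker f : lcomb e f = 0 -> f = 0.
    move=> f g eq_fg; apply/eqP; rewrite -subr_eq0; apply/eqP/ker.
    by rewrite linearB /= eq_fg subrr.
  suff coef0 m : forall f, lcomb e f = 0 -> forall i, fpscoef (f 0 i) m = 0.
    move=> f0; apply/rowP => i; rewrite mxE; apply/fpsP => m.
    by rewrite fpscoef0; apply: coef0.
  have step g : lcomb e g = 0 -> g = t *: map_mx (fps_drop 1) g.
    move=> g0; have := reduce_e g; rewrite g0.
    have -> : reduce 0 = 0 by apply: (addrI (reduce 0)); rewrite -reduceD !addr0.
    rewrite -(raddf0 (lcomb w)) => /inj_w/rowP g00.
    apply/rowP => i; rewrite !mxE {1}(fps_split (g 0 i)).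
    by have := g00 i; rewrite !mxE => <-; rewrite rmorph0 add0r.
  elim: m => [|m IHm] g g0 i; have def_g := step g g0.
    by rewrite def_g mxE fpscoefX0.
  have g'0 : lcomb e (map_mx (fps_drop 1) g) = 0.
    move: g0; rewrite {1}def_g linearZ => /(@def_torsion_free _ _ X)[/eqP|//].
    by rewrite (negPf (fpsX_neq0 k)).
  by rewrite def_g mxE fpscoefXS; exact: (IHm _ g'0 i).
have lcomb_surj x : exists f, lcomb e f = x.
  have /choice[a Ha] : forall y : X, exists a : 'rV[k]_n, lcomb w a = reduce y.
    by move=> y; case: (bij_w) => v _ vK; exists (v (reduce y)); rewrite vK.
  have /choice[s Hs] : forall y, exists y',
      y - lcomb e (map_mx (@fpsC k) (a y)) = t *: y'.
    move=> y; apply: reduce_eq0; rewrite -[- _]scaleN1r reduceD reduceZ reduce_e.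
    rewrite -Ha (_ : \row_i _ = a y); last by apply/rowP => i; rewrite !mxE.
    by rewrite /= scaleN1r subrr.
  pose f : 'rV[fps k]_n := \row_i Fps (fun m => a (iter m s x) 0 i).
  exists f; apply/eqP; rewrite eq_sym -subr_eq0; apply/eqP.
  have [sep _] := def_complete X; apply: sep => m.
  exists (iter m s x - lcomb e (map_mx (fps_drop m) f)).
  elim: m => [|m IHm].
    rewrite expr0 scale1r; congr (_ - lcomb e _); apply/rowP => i; rewrite !mxE.
    by apply/fpsP => j /=; rewrite addn0.
  rewrite IHm exprSr -scalerA; congr (_ *: _); rewrite scalerBr /= -Hs.
  rewrite -linearZ -addrA -opprD -linearD; congr (_ - lcomb e _).
  apply/rowP => i; rewrite !mxE [LHS]fps_split; congr (_ + _ * _).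
  by apply/fpsP => j /=; rewrite addn1 addSnnS.
have /choice[kappa kappaK] := lcomb_surj.
exists e, (fun i j l => kappa (amul (e i) (e j)) 0 l).
split; first split.
- by exists kappa => // x; apply: lcomb_inj.
- by move=> i j; rewrite -[LHS]kappaK; congr (lcomb e _); apply/rowP => l; rewrite mxE.
move=> i j l; have := reduce_e (kappa (amul (e i) (e j))).
by rewrite kappaK reduceM !def_e wc => /inj_w/rowP/(_ l); rewrite !mxE.
Qed.
End DeformationBasis.

(** * Deformations with given structure constants *)

Section FreeDeformation.
Variables (k : fieldType) (n : nat) (c : 'I_n -> 'I_n -> 'I_n -> fps k).
Hypothesis cA : associative (smul c).

Lemma smul_linearr (R : comNzRingType) (a : 'I_n -> 'I_n -> 'I_n -> R) x :
  linear (smul a x).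
Proof.
move=> u y z; rewrite /smul scaler_sumr -big_split; apply: eq_bigr => i _ /=.
rewrite scaler_sumr -big_split; apply: eq_bigr => j _ /=.
by rewrite !mxE mulrDr scalerDl scalerA mulrCA.
Qed.

Lemma smul_linearl (R : comNzRingType) (a : 'I_n -> 'I_n -> 'I_n -> R) y :
  linear (smul a ^~ y).
Proof.
move=> u x z; rewrite /smul scaler_sumr -big_split; apply: eq_bigr => i _ /=.
rewrite scaler_sumr -big_split; apply: eq_bigr => j _ /=.
by rewrite !mxE mulrDl scalerDl scalerA mulrA.
Qed.

Definition free_alg : assocAlg (fps k) :=
  @AssocAlg (fps k) 'rV[fps k]_n (smul c) (smul_linearr c) (smul_linearl c) cA.

Lemma free_alg_sbasis : sbasis (X := free_alg) (fun i => delta_mx 0 i) c.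
Proof.
have lcombE x : lcomb (X := free_alg) (fun i => delta_mx 0 i) x = x.
  by rewrite [RHS]row_sum_delta.
split=> [|i j]; first by exists id => x; rewrite lcombE.
rewrite lcombE /= /smul (bigD1 i) //= [X in _ + X]big1 => [|i' ne_i]; last first.
  by apply: big1 => j' _; rewrite mxE (negPf ne_i) andbF mul0r scale0r.
rewrite addr0 (bigD1 j) //= big1 => [|j' ne_j]; last first.
  by rewrite [X in _ * X]mxE (negPf ne_j) andbF mulr0 scale0r.
by rewrite !mxE !eqxx mulr1 scale1r addr0.
Qed.

Lemma free_alg_complete : t_complete free_alg.
Proof.
split=> [x x_div|u u_div].
  apply/rowP => i; rewrite mxE; apply/fpsP => m; rewrite fpscoef0.
  by have [y ->] := x_div m.+1; rewrite mxE fpscoefXn ltnSn.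
have stable m N i : (m < N)%N -> fpscoef (u N 0 i) m = fpscoef (u m.+1 0 i) m.
  elim: N => // N IHN; rewrite ltnS leq_eqVlt => /predU1P[->//|lt_mN].
  rewrite -(IHN lt_mN); apply/eqP; rewrite -subr_eq0 -fpscoefN -fpscoefD.
  have [y /rowP/(_ i)] := u_div N; rewrite !mxE => ->.
  by rewrite fpscoefXn lt_mN.
exists (\row_i Fps (fun m => fpscoef (u m.+1 0 i) m)) => N.
exists (\row_i fps_drop N (Fps (fun m => fpscoef (u m.+1 0 i) m) - u N 0 i)).
apply/rowP => i; rewrite !mxE; apply: fps_dropE => m lt_mN.
by rewrite fpscoefD fpscoefN /= (stable m N) // subrr.
Qed.

Lemma free_alg_torsion_free : torsion_free free_alg.
Proof.
move=> r x rx0; have [->|nz_r] := eqVneq r 0; [by left | right].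
apply/rowP => i; have /rowP/(_ i)/eqP := rx0; rewrite !mxE mulf_eq0 (negPf nz_r).
by move/eqP.
Qed.

(** Both the reduction of the free algebra and B have the structure constants c(0). *)
Lemma free_deformation (B : assocAlg k) (w : 'I_n -> B) :
    sbasis w (fun i j l => fpscoef (c i j l) 0) ->
  exists (X : formal_deformation B) (e : 'I_n -> X), sbasis e c.
Proof.
move=> sw.
have [f] := sbasis_iso (base_change_sbasis (@fps_ev0 k) free_alg_sbasis) sw.
exists (FormalDeformation free_alg_complete free_alg_torsion_free f).
exists (fun i => delta_mx 0 i); exact: free_alg_sbasis.
Qed.

End FreeDeformation.

Lemma sbasis_smulA (R : comNzRingType) n (X : assocAlg R) (e : 'I_n -> X) c :
  sbasis e c -> associative (smul c).
Proof.
move=> se x y z; have [bij_e _] := se; apply: (bij_inj bij_e).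
by rewrite -!(amul_lcomb _ _ se) amulA.
Qed.

Lemma inj_smulA (R S : comNzRingType) (f : {rmorphism R -> S}) n
    (c : 'I_n -> 'I_n -> 'I_n -> R) :
    injective f -> associative (smul (fun i j l => f (c i j l))) ->
  associative (smul c).
Proof.
move=> inj_f cA x y z; apply/rowP => i; apply: inj_f.
have := cA (map_mx f x) (map_mx f y) (map_mx f z).
by rewrite -!map_smul => /rowP/(_ i); rewrite !mxE.
Qed.

(** * Polynomials vanishing on an orbit *)

Section OrbitPolynomials.
Variables (k : closedFieldType) (V : vectType k) (A : Ass V).
Local Notation n := (\dim {:V}).
Local Notation orbit := Defs.orbit.

(* Indices of the entries of a pair (h, mu); None stands for mu. *)
Local Notation Q := (option ('I_n * 'I_n)).
Local Notation M := #|{: Q}|.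

Section Generic.
Variables (S : comNzRingType) (iota : {rmorphism k -> S}).

Definition theta_at (u : Q -> S) i j l : S :=
  theta (fun i j l => iota (sc A i j l)) (\matrix_(i, j) u (Some (i, j))) (u None) i j l.

End Generic.

Definition xvar (q : Q) : {mpoly k[M]} := 'X_(enum_rank q).
Definition generic_theta := theta_at (@mpolyC M k) xvar.
Definition generic_nu : {mpoly k[M]} :=
  xvar None * \det (\matrix_(i, j) xvar (Some (i, j))).

Lemma mmap_theta (S : comNzRingType) (iota : {rmorphism k -> S}) (u : Q -> S) i j l :
  mmap iota (fun m => u (enum_val m)) (generic_theta i j l) = theta_at iota u i j l.
Proof.
rewrite /generic_theta /theta_at map_theta; congr theta.
- by do 3 (apply/funext=> ?); rewrite /= mmapC.
- by apply/matrixP => i' j'; rewrite !mxE /xvar /= mmapXU enum_rankK.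
- by rewrite /xvar /= mmapXU enum_rankK.
Qed.

Lemma mmap_nu (S : comNzRingType) (iota : {rmorphism k -> S}) (u : Q -> S) :
  mmap iota (fun m => u (enum_val m)) generic_nu =
  u None * \det (\matrix_(i, j) u (Some (i, j))).
Proof.
rewrite /generic_nu /xvar rmorphM /= mmapXU enum_rankK -det_map_mx; congr (_ * \det _).
by apply/matrixP => i' j'; rewrite !mxE /xvar /= mmapXU enum_rankK.
Qed.

Lemma generic_nu_neq0 : generic_nu != 0.
Proof.
apply/eqP => nu0.
have := mmap_nu (idfun : {rmorphism k -> k})
  (fun q => if q is Some (i, j) then (i == j)%:R else 1).
rewrite nu0 mmap0 (_ : \matrix_(i, j) _ = 1%:M) ?det1 ?mulr1.
  by move/esym/eqP; rewrite oner_eq0.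
by apply/matrixP => i j; rewrite !mxE.
Qed.

Lemma orbit_theta A' : orbit A A' -> exists u : Q -> k,
  u None * \det (\matrix_(i, j) u (Some (i, j))) != 0 /\
  forall i j l, sc A' i j l = theta_at idfun u i j l.
Proof.
case/orbit_sbasis=> e se; have [h [mu [nz_nu def_c]]] := sbasis_theta (ass_sbasis A) se.
exists (fun q => if q is Some (i, j) then h i j else mu).
have -> : \matrix_(i, j) h i j = h by apply/matrixP => i j; rewrite mxE.
split=> // i j l; rewrite def_c /theta_at; congr theta.
by apply/matrixP => i' j'; rewrite mxE.
Qed.

Lemma theta_orbit (u : Q -> k) :
    u None * \det (\matrix_(i, j) u (Some (i, j))) != 0 ->
  exists A', orbit A A' /\ forall i j l, sc A' i j l = theta_at idfun u i j l.
Proof. by move=> nz_nu; apply: sbasis_orbit (theta_sbasis (ass_sbasis A) nz_nu). Qed.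

Local Notation N := #|{: 'I_n * 'I_n * 'I_n}|.

(** The orbit is the image of the open set generic_nu <> 0 of an affine space, and
    k is infinite. *)
Lemma orbit_polynomialP (p : {mpoly k[N]}) :
  (forall A', orbit A A' -> p.@[sc_point (sc A')] = 0) <->
  mmap (@mpolyC M k) (sc_point generic_theta) p = 0.
Proof.
set P := mmap _ _ p.
have evP (u : Q -> k) : P.@[fun m => u (enum_val m)] = p.@[sc_point (theta_at idfun u)].
  rewrite /P /meval (rmorph_mmap (mmap idfun _)); apply: eq_mmap => [c|t] /=.
    by rewrite mmapC.
  exact: mmap_theta.
split=> [p0|P0 A' /orbit_theta[u [_ def_A']]]; last first.
  have := evP u; rewrite P0 meval0 => ->.
  by apply: meval_eq => t; rewrite /sc_point def_A'.
apply/eqP; apply: contraT => nz_P.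
have [v] : exists v, (P * generic_nu).@[v] != 0.
  by apply: mpoly_nonroot; rewrite mulf_neq0 // generic_nu_neq0.
have -> : v = fun m => v (enum_rank (enum_val m)).
  by apply/funext => m; rewrite enum_valK.
rewrite mevalM mulf_eq0 negb_or (evP (v \o enum_rank)).
rewrite [X in _ && (X != 0)](mmap_nu idfun (v \o enum_rank)) => /andP[+ nz_nu].
have [A' [OA' def_A']] := theta_orbit nz_nu.
by rewrite -(p0 A' OA') => /eqP; case; apply: meval_eq => t; rewrite /sc_point def_A'.
Qed.

End OrbitPolynomials.

(** * Degenerations and deformations *)

Lemma place_mmap (k : closedFieldType) (E : fieldType) (P : place k E) n
    (iota : {rmorphism k -> E}) (y : 'I_n -> E) (b : 'I_n -> k) :
    (forall a, P (iota a) a) -> (forall i, P (y i) (b i)) ->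
  forall p : {mpoly k[n]}, P (mmap iota y p) p.@[b].
Proof.
move=> Pc Py p; rewrite mevalE /mmap; apply: pl_sum => m _; apply: plM => //.
apply: (big_ind2 P) => [|*|i _]; [exact: pl1 | exact: plM | exact: plX].
Qed.

Section Correspondence.
Variables (k L K : fieldType) (iota : {rmorphism k -> L}) (iota' : {rmorphism k -> K}).
Variables (n : nat) (y : 'I_n -> L) (eta : 'I_n -> K).
Hypothesis spec : forall p, mmap iota y p = 0 -> mmap iota' eta p = 0.

(** The correspondence p(y)/q(y) |-> p(eta)/q(eta).  Unlike the homomorphism
    y |-> eta it can be followed through inverses. *)
Definition corresp (x : L) (x' : K) := exists p q,
  [/\ mmap iota' eta q != 0, x * mmap iota y q = mmap iota y p
    & x' * mmap iota' eta q = mmap iota' eta p].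

Lemma corresp_den q : mmap iota' eta q != 0 -> mmap iota y q != 0.
Proof. by apply: contraNneq => /spec ->. Qed.

Lemma corresp_fun x u v : corresp x u -> corresp x v -> u = v.
Proof.
move=> [p [q [nz_q xq uq]]] [p' [q' [nz_q' xq' vq']]].
have /spec : mmap iota y (p * q' - p' * q) = 0.
  by rewrite mmapB !rmorphM /= -xq -xq'; ring.
rewrite mmapB !rmorphM /= -uq -vq' => /eqP.
rewrite (_ : _ - _ = (u - v) * (mmap iota' eta q * mmap iota' eta q')); last by ring.
by rewrite !mulf_eq0 (negPf nz_q) (negPf nz_q') !orbF subr_eq0 => /eqP.
Qed.

Lemma correspD x x' z z' : corresp x x' -> corresp z z' -> corresp (x + z) (x' + z').
Proof.
move=> [p [q [nz_q xq x'q]]] [p' [q' [nz_q' zq z'q]]].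
exists (p * q' + p' * q), (q * q').
rewrite !rmorphD !rmorphM /= mulf_neq0 // -xq -zq -x'q -z'q.
by split=> //; ring.
Qed.

Lemma correspM x x' z z' : corresp x x' -> corresp z z' -> corresp (x * z) (x' * z').
Proof.
move=> [p [q [nz_q xq x'q]]] [p' [q' [nz_q' zq z'q]]].
exists (p * p'), (q * q').
rewrite !rmorphM /= mulf_neq0 // -xq -zq -x'q -z'q.
by split=> //; ring.
Qed.

Lemma corresp_eval p : corresp (mmap iota y p) (mmap iota' eta p).
Proof. by exists p, 1; rewrite !rmorph1 oner_neq0 !mulr1. Qed.

Lemma correspV x x' : corresp x x' -> x' != 0 -> corresp x^-1 x'^-1.
Proof.
move=> [p [q [nz_q xq x'q]]] nz_x'; exists q, p.
have nz_p : mmap iota' eta p != 0 by rewrite -x'q mulf_neq0.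
have := corresp_den nz_p; rewrite -xq -x'q mulf_eq0 negb_or => /andP[nz_x _].
by rewrite !mulKf // mulf_neq0.
Qed.

Lemma corresp_mmap m (u : 'I_m -> L) (v : 'I_m -> K) (p : {mpoly k[m]}) :
  (forall i, corresp (u i) (v i)) -> corresp (mmap iota u p) (mmap iota' v p).
Proof.
move=> uv; have corr_c c : corresp (iota c) (iota' c).
  by have := corresp_eval c%:MP; rewrite !mmapC.
have corr1 : corresp 1 1 by have := corr_c 1; rewrite !rmorph1.
rewrite /mmap; apply: (big_ind2 corresp) => [|*|m' _].
- by have := corr_c 0; rewrite !rmorph0.
- exact: correspD.
apply: correspM => //; apply: (big_ind2 corresp) => [//|*|i _]; first exact: correspM.
by elim: (m' i) => [//|l IHl]; rewrite !exprS; apply: correspM.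
Qed.

End Correspondence.

Section DegenerationDeformation.
Variables (k : closedFieldType) (V : vectType k) (A B : Ass V).
Local Notation n := (\dim {:V}).
Local Notation N := #|{: 'I_n * 'I_n * 'I_n}|.
Local Notation Q := (option ('I_n * 'I_n)).
Local Notation M := #|{: Q}|.
Local Notation orbit := Defs.orbit.

(** A polynomial relation satisfied by theta holds for the structure constants of
    X, which are values of theta over the Laurent series, and can then be
    reduced at t = 0. *)
Lemma deformation_degeneration (X : formal_deformation (ass_alg B)) :
    isomorphic (base_change (fps_laurent k) X)
               (base_change (const_laurent k) (ass_alg A)) ->
  is_degeneration B A.
Proof.
move=> [f]; apply: polynomials_degeneration => B' /orbit_sbasis[eB sB] p pA.
have [e [c [se c0]]] := deformation_sbasis X sB.
have sXK := iso_sbasis f (base_change_sbasis (fps_laurent k) se).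
have sAK := base_change_sbasis (const_laurent k) (ass_sbasis A).
have [h [mu [_ def_c]]] := sbasis_theta sAK sXK.
pose u (q : Q) := if q is Some (i, j) then h i j else mu.
have theta_u i j l : theta_at A (const_laurent k) u i j l = fps_laurent k (c i j l).
  have def_h : \matrix_(i, j) u (Some (i, j)) = h.
    by apply/matrixP => i' j'; rewrite mxE.
  by rewrite /theta_at def_h; exact: esym (def_c i j l).
have /orbit_polynomialP P0 := pA.
have pc0 : mmap (@fpsC k) (sc_point c) p = 0.
  apply/eqP; rewrite -tofrac_eq0 -[tofrac _]/(fps_laurent k _) rmorph_mmap.
  have /(congr1 (mmap (const_laurent k) (fun m => u (enum_val m)))) := P0.
  rewrite mmap0 => <-; rewrite (rmorph_mmap (mmap (const_laurent k) _)).
  apply/eqP/eq_mmap => [a|t] /=.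
    by rewrite mmapC.
  by rewrite /sc_point mmap_theta theta_u.
have /(congr1 (@fps_ev0 k)) := pc0; rewrite rmorph_mmap rmorph0 => <-.
by apply: eq_mmap => t //; rewrite /sc_point -c0.
Qed.

(** The place B of the generic structure constants is turned into an arc, along
    which the parameters (h, mu) stay in the Laurent series and keep
    mu det(h) <> 0. *)
Lemma degeneration_deformation : is_degeneration B A ->
  exists X : formal_deformation (ass_alg B),
    isomorphic (base_change (fps_laurent k) X)
               (base_change (const_laurent k) (ass_alg A)).
Proof.
move=> degBA.
pose L : fieldType := {fraction {mpoly k[M]}}.
pose iota : {rmorphism k -> L} := @tofrac {mpoly k[M]} \o @mpolyC M k.
pose F (t : 'I_N) : L := tofrac (sc_point (generic_theta A) t).
have specB (p : {mpoly k[N]}) : mmap iota F p = 0 -> p.@[sc_point (sc B)] = 0.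
  rewrite (_ : mmap iota F p =
    tofrac (mmap (@mpolyC M k) (sc_point (generic_theta A)) p)).
    move/eqP; rewrite tofrac_eq0 => /eqP/orbit_polynomialP.
    exact: degeneration_polynomials.
  by rewrite (rmorph_mmap (@tofrac {mpoly k[M]})).
have [P Pe] := @chevalley k L {mpoly k[N]} (@mpolyC N k) (mmap iota F)
  (meval (sc_point (sc B))) (@mevalC _ _ _) specB.
have PF t : P (F t) (sc_point (sc B) t).
  by have := Pe 'X_t; rewrite /= mmapXU mevalXU.
have Pc a : P (iota a) a by have := Pe a%:MP; rewrite /= mmapC mevalC.
(* The parameters and mu det(h): the arc must not send them to 0 or infinity, so
   each of them enters the arc lemma directly or inverted, as the place allows,
   and all of them enter the product s. *)
pose w (q : option Q) : L :=
  if q is Some q' then tofrac (xvar q') else tofrac (generic_nu V).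
have nz_w q : w q != 0.
  case: q => [q|]; rewrite tofrac_eq0; last exact: generic_nu_neq0.
  by rewrite -msize_poly_eq0 msizeX.
have /choice[sb Hsb] : forall q, exists sb : bool * k,
    P (if sb.1 then w q else (w q)^-1) sb.2.
  move=> q; have [[a Pa]|Pa] := pl_total P (w q); first by exists (true, a).
  by exists (false, 0).
pose T := ('I_N + option Q)%type.
pose y0 (t : T) : L := match t with
  | inl t => F t
  | inr q => if (sb q).1 then w q else (w q)^-1 end.
pose b0 (t : T) : k := match t with inl t => sc_point (sc B) t | inr q => (sb q).2 end.
pose y (i : 'I_#|{: T}|) := y0 (enum_val i).
pose b (i : 'I_#|{: T}|) := b0 (enum_val i).
have spec p : mmap iota y p = 0 -> p.@[b] = 0.
  move=> p0; apply: (@pl_fun0 _ _ P); rewrite -p0; apply: place_mmap => // i.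
  by rewrite /y /b; case: (enum_val i) => [t|q] /=; [exact: PF | exact: Hsb].
pose s : {mpoly k[#|{: T}|]} := \prod_q 'X_(enum_rank (inr q : T)).
have nz_s : mmap iota y s != 0.
  rewrite rmorph_prod; apply/prodf_neq0 => q _; rewrite /= mmapXU /y enum_rankK /=.
  by case: ifP => _; rewrite ?invr_eq0.
have [eta [eta_spec eta0 eta_s]] := arc spec nz_s.
pose tK := fps_laurent k; pose iK := const_laurent k.
have tK_inj : injective tK by move=> f g /eqP; rewrite tofrac_eq => /eqP.
pose etaK i := tK (eta i).
have etaKE p : mmap iK etaK p = tK (mmap (@fpsC k) eta p) by rewrite rmorph_mmap.
have specK p : mmap iota y p = 0 -> mmap iK etaK p = 0.
  by move/eta_spec => p0; rewrite etaKE p0 rmorph0.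
(* C transports identities between the generic parameters and the generic
   structure constants to the arc. *)
pose C := corresp iota iK y etaK.
pose et (t : T) := eta (enum_rank t).
have Cy t : C (y0 t) (tK (et t)).
  have := corresp_eval iota iK y etaK 'X_(enum_rank t).
  by rewrite !mmapXU /y enum_rankK.
have nz_et q : tK (et (inr q)) != 0.
  rewrite tofrac_eq0; apply: contraNneq eta_s => q0.
  by rewrite rmorph_prod (bigD1 q) //= mmapXU -/(et _) q0 mul0r.
pose w' q := if (sb q).1 then tK (et (inr q)) else (tK (et (inr q)))^-1.
have Cw q : C (w q) (w' q).
  have := Cy (inr q); rewrite /w' /=; case: ifP => // _ Cq.
  by have := correspV specK Cq (nz_et q); rewrite invrK.
have nz_w' q : w' q != 0 by rewrite /w'; case: ifP => _; rewrite ?invr_eq0.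
pose u (q : Q) := w' (Some q).
have Cmmap (p : {mpoly k[M]}) : C (tofrac p) (mmap iK (fun m => u (enum_val m)) p).
  rewrite (_ : tofrac p = mmap iota (fun m => w (Some (enum_val m))) p).
    by apply: corresp_mmap => // m; apply: Cw.
  rewrite [LHS]rmorph_mpoly; apply: eq_mmap => // m /=.
  by rewrite /xvar enum_valK.
have theta_u i j l : theta_at A iK u i j l = tK (et (inl (enum_rank (i, j, l)))).
  apply: (corresp_fun specK) (Cy _); rewrite -mmap_theta /= /F /sc_point enum_rankK.
  exact: Cmmap.
have nz_nu : u None * \det (\matrix_(i, j) u (Some (i, j))) != 0.
  rewrite -(mmap_nu iK u) (corresp_fun specK (Cmmap _) (Cw None)).
  exact: nz_w'.
pose c i j l := et (inl (enum_rank (i, j, l))).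
have sAK : exists e,
    sbasis (X := base_change iK (ass_alg A)) e (fun i j l => tK (c i j l)).
  have := theta_sbasis (base_change_sbasis iK (ass_sbasis A)) nz_nu.
  by eexists; apply: eq_sbasis H => // i j l; rewrite -theta_u.
have [e se] := sAK.
have cA : associative (smul c) by apply: (inj_smulA tK_inj); exact: sbasis_smulA se.
have sB : sbasis (X := ass_alg B) (@vb k V) (fun i j l => fpscoef (c i j l) 0).
  apply: eq_sbasis (ass_sbasis B) => // i j l.
  by rewrite /c /et eta0 /b enum_rankK /= /sc_point enum_rankK.
have [X [eX sX]] := free_deformation cA sB.
exists X; exact: sbasis_iso (base_change_sbasis tK sX) se.
Qed.

End DegenerationDeformation.

Theorem theorem4p1 (k : closedFieldType) (V : vectType k) (A B : Ass V) :
  is_degeneration B A <->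
  exists X : formal_deformation (ass_alg B),
    isomorphic (base_change (fps_laurent k) X)
               (base_change (const_laurent k) (ass_alg A)).
Proof.
split=> [|[X]]; [exact: degeneration_deformation | exact: deformation_degeneration].
Qed.
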